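(* Let $1<p<N$, let $\mathcal{X}$ be an admissible function space, and set $T=\inf\{J(u)\;|\;u\in\mathcal{X},\ V(u)=1\}$. Let $(\mathcal{P}_1)$ denote the problem of minimizing $J(u)$ in the set $\{u\in\mathcal{X}\;|\;V(u)=1\}$. Assume that: (1) $T>0$ and problem $(\mathcal{P}_1)$ has a minimizer $u_*\in\mathcal{X}$; (2) any minimizer $u\in\mathcal{X}$ of $(\mathcal{P}_1)$ is a $C^1$ function and satisfies, for some $\alpha\in\mathbf{R}$, the system $-\mathrm{div}(|\nabla u_i|^{p-2}\nabla u_i)=\alpha g_i(u)$ in $\mathcal{D}'(\mathbf{R}^N)$ for $i=1,\dots,m$; (3) whenever $\alpha\in\mathbf{R}$ and $u\in\mathcal{X}$ satisfies $-\mathrm{div}(|\nabla u_i|^{p-2}\nabla u_i)=\alpha g_i(u)$ in $\mathcal{D}'(\mathbf{R}^N)$ for $i=1,\dots,m$, one has the Pohozaev identity $(N-p)J(u)=\alpha N V(u)$. Then the system $-\mathrm{div}(|\nabla u_i|^{p-2}\nabla u_i)=g_i(u)$, $i=1,\dots,m$, admits a least energy solution, and each least energy solution is radially symmetric (up to a translation in $\mathbf{R}^N$).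
   Context: Setting: $m\ge 1$, $1<p<\infty$, $g_1,\dots,g_m$ are real functions on $\mathbf{R}^m$ with $g_i(0)=0$, and there is $G\in C^1(\mathbf{R}^m\setminus\{0\},\mathbf{R})\cap C(\mathbf{R}^m,\mathbf{R})$ such that $g_i(u)=\frac{\partial G}{\partial u_i}(u)$ for $u\ne0$. For $u=(u_1,\dots,u_m):\mathbf{R}^N\to\mathbf{R}^m$ consider the system $$-\mathrm{div}(|\nabla u_i|^{p-2}\nabla u_i)=g_i(u),\qquad i=1,\dots,m. \qquad ( * )$$ Here $|y|^p=\big(\sum_{j=1}^N y_j^2\big)^{p/2}$, and gradients are weak gradients. Notation: for $\sigma>0$, $f_\sigma(x)=f(x/\sigma)$. For an affine hyperplane $\Pi$ in $\mathbf{R}^N$, $\Pi^+$ and $\Pi^-$ are the two closed half-spaces determined by $\Pi$ and $s_\Pi$ is the reflection in $\Pi$; for $f$ defined on $\mathbf{R}^N$, $f_{\Pi^+}(x)=f(x)$ if $x\in\Pi^+$ and $f(s_\Pi(x))$ if $x\in\Pi^-$; $f_{\Pi^-}(x)=f(x)$ if $x\in\Pi^-$ and $f(s_\Pi(x))$ if $x\in\Pi^+$. A space $\mathcal{X}$ of functions on $\mathbf{R}^N$ is admissible if it is nonempty and: (i) $\mathcal{X}\subset L^1_{loc}(\mathbf{R}^N,\mathbf{R}^m)$ and $\{x\;|\;|u(x)|>\alpha\}$ has finite measure for all $u\in\mathcal{X}$, $\alpha>0$; (ii) $g_i(u)\in L^1_{loc}(\mathbf{R}^N)$ for all $u\in\mathcal{X}$,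 $i=1,\dots,m$; (iii) $\sum_{i=1}^m|\nabla u_i|^p$ and $G(u)$ belong to $L^1(\mathbf{R}^N)$ for all $u\in\mathcal{X}$; (iv) $u_\sigma\in\mathcal{X}$ for all $u\in\mathcal{X}$, $\sigma>0$; (v) $u_{\Pi^+},u_{\Pi^-}\in\mathcal{X}$ for all $u\in\mathcal{X}$ and all affine hyperplanes $\Pi$ in $\mathbf{R}^N$. Functionals on $\mathcal{X}$: $J(u)=\frac1p\int_{\mathbf{R}^N}\sum_{i=1}^m|\nabla u_i|^p\,dx$, $V(u)=\int_{\mathbf{R}^N}G(u)\,dx$, $S(u)=J(u)-V(u)$. A function $u\in\mathcal{X}$ is a solution of $( * )$ if it satisfies $( * )$ in $\mathcal{D}'(\mathbf{R}^N)$. A least energy solution is a nontrivial (i.e. $\neq 0$) solution $\underline{u}\in\mathcal{X}$ of $( * )$ with $S(\underline{u})=\inf\{S(u)\;|\;u\in\mathcal{X}\setminus\{0\},\ u\text{ is a solution of }( * )\}$. *)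

(* Defs.v *)
From HB Require Import structures.
From mathcomp Require Import all_boot all_order all_algebra.
From mathcomp Require Import all_classical all_reals all_analysis.

Set Implicit Arguments.
Unset Strict Implicit.
Unset Printing Implicit Defensive.
Import Order.TTheory GRing.Theory Num.Theory.
Import numFieldNormedType.Exports.

Local Open Scope classical_set_scope.
Local Open Scope ring_scope.

(* R^n is 'rV[R]_n, with the sigma-algebra generated by the coordinates, i.e.
   the Borel one. *)
Section measurable_rV.
Context {R : realType} (n : nat).

Let coors : 'I_n -> 'rV[R]_n -> measurableTypeR R := fun i x => x 0 i.

Let rV_set0 : g_sigma_preimage coors set0.
Proof. exact: sigma_algebra0. Qed.

Let rV_setC A : g_sigma_preimage coors A -> g_sigma_preimage coors (~` A).
Proof. exact: sigma_algebraC. Qed.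

Let rV_bigcup (F : (set 'rV[R]_n)^nat) :
  (forall i, g_sigma_preimage coors (F i)) ->
  g_sigma_preimage coors (\bigcup_i (F i)).
Proof. exact: sigma_algebra_bigcup. Qed.

HB.instance Definition _ := @isMeasurable.Build default_measure_display
  'rV[R]_n (g_sigma_preimage coors) rV_set0 rV_setC rV_bigcup.

End measurable_rV.

Lemma measurable_coord (R : realType) n (i : 'I_n) :
  measurable_fun [set: 'rV[R]_n] (fun x => x 0 i : measurableTypeR R).
Proof.
move=> _ Y mY; rewrite setTI; apply: sub_sigma_algebra => /=.
rewrite -bigcup_seq/=; exists i => /=; first by rewrite mem_index_enum.
by exists Y => //; rewrite setTI.
Qed.

Lemma measurable_fun_rV d (T : measurableType d) (R : realType) n
    (f : T -> 'rV[R]_n) :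
  (forall i, measurable_fun setT (fun t => f t 0 i : measurableTypeR R)) ->
  measurable_fun setT f.
Proof.
move=> mf _ A mA; rewrite setTI.
pose S := [set B : set 'rV[R]_n | measurable (f @^-1` B)].
suff : (@measurable _ 'rV[R]_n) `<=` S by apply.
apply: smallest_sub.
  split => /=; first by rewrite /S/= preimage_set0.
    by move=> B SB; rewrite /S/= setTD preimage_setC; exact: measurableC.
  by move=> F SF; rewrite /S/= preimage_bigcup; exact: bigcupT_measurable.
move=> B; rewrite -bigcup_seq => -[i _] [C mC <-].
rewrite /S/= setTI -comp_preimage -[X in measurable X]setTI.
exact: mf.
Qed.

Section lebesgue_rV.
Context {R : realType}.

Definition cons_rV n (z : measurableTypeR R * 'rV[R]_n) : 'rV[R]_n.+1 :=
  \row_(j < n.+1) (if unlift ord0 j is Some k then z.2 0 k else z.1).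

Definition uncons_rV n (x : 'rV[R]_n.+1) : measurableTypeR R * 'rV[R]_n :=
  (x 0 0, \row_k x 0 (lift ord0 k)).

Lemma measurable_cons_rV n : measurable_fun setT (@cons_rV n).
Proof.
apply: measurable_fun_rV => i; rewrite /cons_rV.
under eq_fun do rewrite mxE.
case: (unlift ord0 i) => [k|]; last exact: measurable_fst.
exact: (measurableT_comp (measurable_coord k) measurable_snd).
Qed.

Lemma measurable_uncons_rV n : measurable_fun setT
  (@uncons_rV n).
Proof.
apply/measurable_fun_pairP; split => /=; first exact: measurable_coord.
apply: measurable_fun_rV => i /=.
by under eq_fun do rewrite mxE; exact: measurable_coord.
Qed.

Section step.
Context n (mu : {sigma_finite_measure set 'rV[R]_n -> \bar R}).

Definition lebesgue_step : set 'rV[R]_n.+1 -> \bar R :=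
  pushforward (@lebesgue_measure R \x mu)%E (@cons_rV n).

Let step0 : lebesgue_step set0 = 0%E.
Proof. by rewrite /lebesgue_step /pushforward preimage_set0 measure0. Qed.

Let step_ge0 A : (0 <= lebesgue_step A)%E.
Proof. exact: (measure_ge0 (@lebesgue_measure R \x mu)%E). Qed.

Let step_sigma_additive : semi_sigma_additive lebesgue_step.
Proof.
exact: (@measure_semi_sigma_additive _ _ _
  (measure_function_pushforward__canonical__measure_function_Measure
     (@lebesgue_measure R \x mu)%E (@measurable_cons_rV n))).
Qed.

HB.instance Definition _ := isMeasure.Build _ _ _
  lebesgue_step step0 step_ge0 step_sigma_additive.

Let step_sigma_finite : sigma_finite setT lebesgue_step.
Proof.
have /sigma_finiteP[F [TF ndF Foo]] := sigma_finiteT (@lebesgue_measure R).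
have /sigma_finiteP[G [TG ndG Goo]] := sigma_finiteT mu.
exists (fun k => @uncons_rV n @^-1` (F k `*` G k)).
  apply/esym; rewrite -subTset => v _.
  have [k _ Fk] : (\bigcup_k F k) (uncons_rV v).1 by rewrite -TF.
  have [l _ Gl] : (\bigcup_k G k) (uncons_rV v).2 by rewrite -TG.
  exists (maxn k l) => //; split => /=.
  - by move: Fk; exact/subsetPset/ndF/leq_maxl.
  - by move: Gl; exact/subsetPset/ndG/leq_maxr.
move=> k; have [mF Fk] := Foo k; have [mG Gk] := Goo k; split.
  rewrite -[X in measurable X]setTI.
  by apply: measurable_uncons_rV => //; exact: measurableX.
rewrite /lebesgue_step /pushforward -comp_preimage.
rewrite (_ : _ \o _ = id); last first.
  apply/funext => -[a v]; rewrite /uncons_rV/=; congr (_, _).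
    by rewrite mxE unlift_none.
  by apply/rowP => j; rewrite !mxE liftK.
rewrite preimage_id product_measure1E//.
by rewrite lte_mul_pinfty// ge0_fin_numE.
Qed.

HB.instance Definition _ := Measure_isSigmaFinite.Build _ _ _
  lebesgue_step step_sigma_finite.

End step.


Definition lebesgue0 : set 'rV[R]_0 -> \bar R :=
  dirac (0 : 'rV[R]_0).

HB.instance Definition _ := Measure.on lebesgue0.

Let lebesgue0_sigma_finite : sigma_finite setT lebesgue0.
Proof.
apply: fin_num_fun_sigma_finite; first by rewrite measure0.
by move=> A mA; rewrite /lebesgue0 diracE.
Qed.

HB.instance Definition _ := Measure_isSigmaFinite.Build _ _ _
  lebesgue0 lebesgue0_sigma_finite.

(* Lebesgue measure on R^n, as the n-fold product of the one-dimensional one. *)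
Fixpoint lebesgue n : {sigma_finite_measure set 'rV[R]_n -> \bar R} :=
  if n is k.+1 then lebesgue_step (lebesgue k) else lebesgue0.

End lebesgue_rV.

Section euclidean.
Context {R : realType}.

Definition dotv n (x y : 'rV[R]_n) : R := \sum_j x 0 j * y 0 j.

(* The Euclidean norm; the library norm `|x| on 'rV is the sup norm. *)
Definition enorm n (x : 'rV[R]_n) : R := Num.sqrt (dotv x x).

(* C^1 on the open set D: differentiable, with continuous partial derivatives. *)
Definition C1_on n (D : set 'rV[R]_n) (f : 'rV[R]_n -> R) : Prop :=
  forall x, D x -> differentiable f x /\
    forall j, {for x, continuous ('D_(delta_mx 0 j) f)}.

Fixpoint Ck n (k : nat) (f : 'rV[R]_n -> R) : Prop :=
  if k is k'.+1 then
    (forall x, differentiable f x) /\ (forall j, Ck k' ('D_(delta_mx 0 j) f))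
  else continuous f.

Definition test_function n (phi : 'rV[R]_n -> R) : Prop :=
  (forall k, Ck k phi) /\ compact (closure [set x | phi x != 0]).

Definition dilate n T (s : R) (f : 'rV[R]_n -> T) : 'rV[R]_n -> T :=
  fun x => f (s^-1 *: x).

(* The affine hyperplane {x | dotv x a = b}, for a != 0, has the closed
   half-spaces b <= dotv x a and dotv x a <= b. *)
Definition reflect_hyp n (a : 'rV[R]_n) (b : R) (x : 'rV[R]_n) : 'rV[R]_n :=
  x - (2 * (dotv x a - b) / dotv a a) *: a.

Definition fold_plus n T (a : 'rV[R]_n) (b : R) (f : 'rV[R]_n -> T) :=
  fun x => if b <= dotv x a then f x else f (reflect_hyp a b x).

Definition fold_minus n T (a : 'rV[R]_n) (b : R) (f : 'rV[R]_n -> T) :=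
  fun x => if dotv x a <= b then f x else f (reflect_hyp a b x).

End euclidean.

(* Functions on R^n are taken as representatives: each notion below that
   concerns elements of function spaces is invariant under equality almost
   everywhere. *)
Section weak_derivatives.
Context {R : realType} (n : nat).
Implicit Types f w : 'rV[R]_n -> R.

Definition loc_integrable f : Prop :=
  measurable_fun setT f /\
  forall K : set 'rV[R]_n, compact K ->
    (\int[lebesgue n]_(x in K) `|f x|%:E < +oo)%E.

Definition is_weak_partial (j : 'I_n) f w : Prop :=
  loc_integrable w /\
  forall phi, test_function phi ->
    \int[lebesgue n]_x (f x * 'D_(delta_mx 0 j) phi x) =
    - \int[lebesgue n]_x (w x * phi x).

(* A chosen weak partial derivative; it is unique up to equality almost
   everywhere, and the value is junk when there is none. *)
Definition weak_partial (j : 'I_n) f : 'rV[R]_n -> R :=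
  xget (fun=> 0) [set w | is_weak_partial j f w].

Definition weakly_differentiable f : Prop :=
  forall j, exists w, is_weak_partial j f w.

Definition weak_grad f (x : 'rV[R]_n) : 'rV[R]_n :=
  \row_j weak_partial j f x.

End weak_derivatives.

Section functionals.
Context {R : realType} (m n : nat) (p : R).
Context (g : 'I_m -> 'rV[R]_m -> R) (G : 'rV[R]_m -> R).
Implicit Types u v : 'rV[R]_n -> 'rV[R]_m.
Implicit Types X : set ('rV[R]_n -> 'rV[R]_m).

Definition component u (i : 'I_m) : 'rV[R]_n -> R := fun x => u x 0 i.

Definition grad_energy u (x : 'rV[R]_n) : R :=
  \sum_i enorm (weak_grad (component u i) x) `^ p.

Definition energyJ u : R := p^-1 * \int[lebesgue n]_x grad_energy u x.

Definition energyV u : R := \int[lebesgue n]_x G (u x).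

Definition action u : R := energyJ u - energyV u.

Definition admissible X : Prop :=
  [/\ X !=set0,
      (forall u, X u ->
        [/\ (forall i, loc_integrable (component u i)),
            (forall a, 0 < a ->
               (lebesgue n [set x | (a < enorm (u x))%R] < +oo)%E),
            (forall i, loc_integrable (fun x => g i (u x))),
            (forall i, weakly_differentiable (component u i)) &
            (lebesgue n).-integrable setT (EFin \o grad_energy u) /\
            (lebesgue n).-integrable setT (fun x => (G (u x))%:E)]),
      (forall u s, X u -> 0 < s -> X (dilate s u)) &
      (forall u a b, X u -> a != 0 ->
         X (fold_plus a b u) /\ X (fold_minus a b u))].

(* - div (|grad u_i|^(p-2) grad u_i) = alpha g_i(u) in D'(R^n), for all i. *)
Definition weak_system (alpha : R) u : Prop :=
  forall (i : 'I_m) (phi : 'rV[R]_n -> R), test_function phi ->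
    \int[lebesgue n]_x (enorm (weak_grad (component u i) x) `^ (p - 2) *
       dotv (weak_grad (component u i) x) (\row_j 'D_(delta_mx 0 j) phi x)) =
    alpha * \int[lebesgue n]_x (g i (u x) * phi x).

Definition nontrivial u : Prop := ~ {ae lebesgue n, forall x, u x = 0}.

Definition constraint_set X : set ('rV[R]_n -> 'rV[R]_m) :=
  [set u | X u /\ energyV u = 1].

Definition minimizer X u : Prop :=
  constraint_set X u /\ forall v, constraint_set X v -> energyJ u <= energyJ v.

Definition solution X u : Prop := X u /\ weak_system 1 u.

Definition least_energy_solution X u : Prop :=
  [/\ solution X u, nontrivial u &
      (action u)%:E =
      ereal_inf [set (action v)%:E | v in [set v | solution X v /\ nontrivial v]]].

Definition C1_function u : Prop :=
  exists v : 'rV[R]_n -> 'rV[R]_m,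
    (forall i, C1_on setT (component v i)) /\ {ae lebesgue n, forall x, u x = v x}.

Definition radial_up_to_translation u : Prop :=
  exists (x0 : 'rV[R]_n) (h : R -> 'rV[R]_m),
    {ae lebesgue n, forall x, u x = h (enorm (x - x0))}.

End functionals.

(* Main.v *)
From HB Require Import structures.
Require Import Defs.
From mathcomp Require Import all_boot all_order all_algebra.
From mathcomp Require Import all_classical all_reals all_analysis.
From mathcomp Require Import measurable_realfun.
From mathcomp Require Import ring lra zify.
Set Implicit Arguments.
Unset Strict Implicit.
Unset Printing Implicit Defensive.
Import Order.TTheory GRing.Theory Num.Theory.
Import numFieldNormedType.Exports.
Local Open Scope classical_set_scope.
Local Open Scope ring_scope.

(** Why the theorem holds.

    Reflection argument. Let [u] minimize [energyJ] under [energyV u = 1]. In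
    every direction [a] some hyperplane orthogonal to [a] halves the integral of
    [G \o u] ([half_mass]), so both foldings of [u] satisfy the constraint. Their
    energies add up to [2 * energyJ u] ([energyJ_fold]) and neither is below the
    minimum, so both foldings are again minimizers ([minimizer_fold]), hence
    C^1 functions. A folding of a C^1 function [w] reads [w (x + |t| a)] along
    the normal of the hyperplane; if it is differentiable too, the normal
    derivative of [w] vanishes on the hyperplane ([fold_normal_derivative]).

    From one hyperplane to all of them. Folding successively along the
    coordinate directions gives minimizers symmetric in [n] orthogonal
    hyperplanes, thus even about their common point [c]. For such a function
    every hyperplane through [c] halves the constraint, so all normal derivatives
    along these hyperplanes vanish, which says that the derivative is zero in
    all directions tangent to the spheres about [c]: the function is radial
    ([radial_of_even]). Undoing one folding at a time, the two foldings of a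
    function are radial about two centres lying on the folding hyperplane, and
    agree on it. The centres coincide, for otherwise the common values on the
    line through them would be periodic and some superlevel set would have
    infinite measure ([same_centers]); so the function itself is radial
    ([radial_of_mirrors]).

    Solutions and minimizers. Put [kappa = (n - p) / n]. By the Pohozaev identity
    a solution [v] satisfies [energyV v = kappa * energyJ v], so its action is
    [(kappa^-1 - 1) * energyV v]. Dilating by [s] multiplies [energyV] by [s ^ n]
    and [energyJ] by [s ^ (n - p)]. A suitable dilation of the given minimizer
    [u0] solves the system with multiplier [1]; a suitable dilation of any
    nontrivial solution [v] is a competitor of [u0], and comparing the two
    energies gives [energyV v >= sigma ^ n] ([solution_energyV_ge]), the value
    reached by the dilation of [u0] by [sigma]. In case of equality the dilation
    of [v] is a minimizer, hence radial, and so is [v].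

    Nontrivial solutions have positive energy because a function with vanishing
    weak gradient is invariant under translations along an axis, and cannot have
    superlevel sets of finite nonzero measure ([weak_partial0_eq0]).

    Since elements of the space are only measurable functions with chosen weak
    derivatives, all of this rests on three facts: isometries and dilations act
    on Lebesgue measure as expected ([scales_lebesgue_isometry], from the
    uniqueness of translation invariant measures), weak derivatives are unique
    almost everywhere ([du_bois_reymond]), and they are local: on an open
    half-space they depend on the function there only
    ([weak_partial_half_space]). *)

(** * Borel sets and boxes *)

Definition box (R : realType) n (a b : 'rV[R]_n) : set 'rV[R]_n :=
  [set x | forall i, a 0 i < x 0 i < b 0 i].

Section borel.
Context {R : realType} {n : nat}.
Implicit Types a b : 'rV[R]_n.

Lemma measurable_box a b : measurable (box a b).
Proof.
rewrite (_ : box a b = \bigcap_(i in [set: 'I_n])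
   ((fun x : 'rV[R]_n => x 0 i) @^-1` `]a 0 i, b 0 i[%classic)); last first.
  apply/seteqP; split=> x /=.
    by move=> h i _ /=; rewrite in_itv /=; exact: h.
  by move=> h i; have := h i I; rewrite /= in_itv.
apply: fin_bigcap_measurable; first exact: finite_finset.
move=> i _; rewrite -[X in measurable X]setTI.
exact: (@measurable_coord R n i measurableT _ (measurable_itv _)).
Qed.

Lemma box_setI a b a' b' : box a b `&` box a' b' =
  box (\row_i Num.max (a 0 i) (a' 0 i)) (\row_i Num.min (b 0 i) (b' 0 i)).
Proof.
apply/seteqP; split=> x /=.
  move=> [h h'] i; rewrite !mxE gt_max lt_min.
  by have /andP[-> ->] := h i; have /andP[-> ->] := h' i.
move=> h; split=> i; have := h i; rewrite !mxE gt_max lt_min;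
  by case/andP => /andP[h1 h2] /andP[h3 h4]; apply/andP; split.
Qed.

Lemma bigcup_box : \bigcup_k box (const_mx (- k%:R)) (const_mx k%:R)
  = [set: 'rV[R]_n].
Proof.
apply/seteqP; split=> // x _.
have [k xk] : exists k : nat, forall i, `|x 0 i| < k%:R.
  exists (\max_i (Num.truncn `|x ord0 i|).+1)%N => i.
  apply: lt_le_trans (truncnS_gt `|x 0 i|) _.
  by rewrite ler_nat (leq_bigmax i).
by exists k => // i; rewrite !mxE -ltr_norml.
Qed.

(** Boxes generate the Borel sets and are stable under intersection, so that
    measures are determined by their values on them. *)
Lemma measurable_boxE :
  @measurable _ 'rV[R]_n = <<s [set A | exists a b, A = box a b] >>.
Proof.
apply/seteqP; split; last first.
  apply: smallest_sub; first exact: sigma_algebra_measurable.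
  by move=> _ [a [b ->]]; exact: measurable_box.
apply: smallest_sub; first exact: smallest_sigma_algebra.
move=> B; rewrite -bigcup_seq => -[i _] [C mC <-]; rewrite setTI.
move: C mC; change (@measurable _ (measurableTypeR R) `<=`
  [set C | <<s [set A | exists a b, A = box a b] >>
     ((fun x : 'rV[R]_n => x 0 i) @^-1` C)]).
have -> : @measurable _ (measurableTypeR R) =
   (@RGenOpens.G R).-sigma.-measurable by exact: measurable_realfun.RGenOpens.measurableE.
pose G := [set A | exists a b : 'rV[R]_n, A = box a b].
have sG : sigma_algebra setT <<s G >> by exact: smallest_sigma_algebra.
apply: smallest_sub.
  split=> /=.
  - by rewrite -/G preimage_set0; case: sG.
  - by move=> A hA; rewrite setTD preimage_setC -setTD; case: sG => _ + _; apply.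
  - by move=> F hF; rewrite preimage_bigcup; case: sG => _ _; apply.
move=> _ [x [y ->]] /=.
rewrite (_ : _ @^-1` _ = \bigcup_k
   box (\row_j (if j == i then x else - k%:R))
       (\row_j (if j == i then y else k%:R))).
  case: sG => _ _; apply => k; apply: sub_sigma_algebra.
  by eexists; eexists.
apply/seteqP; split=> z /=.
  rewrite in_itv /= => hz.
  have : (\bigcup_k box (const_mx (- k%:R)) (const_mx k%:R)) z by rewrite bigcup_box.
  move=> [k _ hk]; exists k => // j; rewrite !mxE; case: eqP => [->|_]//.
  by have := hk j; rewrite !mxE.
by move=> [k _ /(_ i)]; rewrite !mxE eqxx in_itv.
Qed.

Lemma open_measurable_rV (O : set 'rV[R]_n) : open O -> measurable O.
Proof.
move=> oO.
pose D := [set ab : 'rV[rat]_n * 'rV[rat]_n |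
  box (map_mx ratr ab.1) (map_mx ratr ab.2) `<=` O].
rewrite (_ : O = \bigcup_(ab in D)
   box (map_mx ratr ab.1) (map_mx ratr ab.2)); last first.
  apply/seteqP; split=> x; last by move=> [ab /= h]; exact: h.
  move=> Ox; have /nbhs_ballP[e /= e0 he] : nbhs x O by exact: open_nbhs_nbhs.
  have ha i : exists q : rat, ratr q \in `](x 0 i - e), (x 0 i)[.
    by have [|q qi] := @rat_in_itvoo _ (x 0 i - e) (x 0 i);
      [rewrite ltrBlDr ltrDl|exists q].
  have hb i : exists q : rat, ratr q \in `](x 0 i), (x 0 i + e)[.
    by have [|q qi] := @rat_in_itvoo _ (x 0 i) (x 0 i + e);
      [rewrite ltrDl|exists q].
  have [a Ha] := choice ha; have [b Hb] := choice hb.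
  exists (\row_i a i, \row_i b i); last first.
    move=> i /=; rewrite !mxE.
      have := Ha i; rewrite in_itv /= => /andP[_ ->].
    by have := Hb i; rewrite in_itv /= => /andP[-> _].
  move=> y /= hy; apply: he; split => // i j; rewrite ord1.
  have := hy j; rewrite !mxE => /andP[h1 h2].
  have := Ha j; have := Hb j; rewrite !in_itv /= => /andP[_ h3] /andP[h4 _].
  rewrite /ball /= ltr_distlC.
  by rewrite (lt_trans h4 h1) (lt_trans h2 h3).
rewrite bigcup_mkcond; apply: countable_bigcupT_measurable => [|ab].
  exact: countableP.
by case: ifP => _ //; exact: measurable_box.
Qed.

Lemma closed_measurable_rV (C : set 'rV[R]_n) : closed C -> measurable C.
Proof.
move=> cC; rewrite -[C]setCK; apply: measurableC.
by apply: open_measurable_rV; exact: closed_openC.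
Qed.

Lemma compact_measurable_rV (K : set 'rV[R]_n) : compact K -> measurable K.
Proof.
move=> cK; apply: closed_measurable_rV; exact: compact_closed.
Qed.

Lemma continuous_measurable_rV (f : 'rV[R]_n -> R) :
  continuous f -> measurable_fun setT f.
Proof.
move=> /continuousP cf; apply: (measurability _ (RGenOpens.measurableE R)).
move=> _ [_ [a [b ->] <-]]; rewrite setTI; apply: open_measurable_rV.
exact/cf/interval_open.
Qed.

Lemma measurable_superlevel (f : 'rV[R]_n -> R) al :
  measurable_fun setT f -> measurable [set x | al < f x].
Proof.
move=> mf; rewrite -[X in measurable X]setTI.
rewrite (_ : [set x | _] = f @^-1` `]al, +oo[%classic).
  by apply: mf => //; exact: measurable_itv.
by apply/seteqP; split=> x /=; rewrite in_itv /= andbT.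
Qed.

End borel.

Lemma continuous_measurable_rVrV (R : realType) n k (f : 'rV[R]_n -> 'rV[R]_k) :
  continuous f -> measurable_fun setT f.
Proof.
move=> cf; apply: measurable_fun_rV => i; apply: continuous_measurable_rV => x.
exact: (continuous_comp (cf x) (@coord_continuous _ _ _ 0 i _)).
Qed.

Section lebesgue_box.
Context {R : realType}.

Lemma lebesgue_box n (a b : 'rV[R]_n) :
  lebesgue n (box a b) = (\prod_i Num.max 0 (b 0 i - a 0 i))%:E.
Proof.
elim: n a b => [|n IH] a b.
  rewrite big_ord0 /= /lebesgue0 diracE mem_set //= => -[].
  by case.
rewrite /= /lebesgue_step /pushforward.
rewrite (_ : _ @^-1` _ = `]a 0 0, b 0 0[%classic `*`
    box (\row_k a 0 (lift ord0 k)) (\row_k b 0 (lift ord0 k))); last first.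
  apply/seteqP; split=> -[z y] /=.
    move=> h; split.
      by have := h 0; rewrite !mxE unlift_none in_itv.
    by move=> i; have := h (lift ord0 i); rewrite !mxE liftK.
  move=> [h1 h2] i; rewrite !mxE; case: unliftP => [j ->|->].
    by have := h2 j; rewrite !mxE.
  by move: h1; rewrite in_itv.
rewrite product_measure1E //; last exact: measurable_box.
rewrite IH big_ord_recl EFinM; congr (_ * _)%E; last first.
  by congr (_%:E); apply: eq_bigr => i _; rewrite !mxE.
rewrite /lebesgue_measure/= lebesgue_measure_itv /= lte_fin; case: ltP => h.
  by rewrite max_r // subr_ge0 ltW.
by rewrite max_l // subr_le0.
Qed.

Lemma lebesgue_unique n (nu : {measure set 'rV[R]_n -> \bar R}) :
  (forall a b, nu (box a b) = lebesgue n (box a b)) ->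
  forall A, measurable A -> nu A = lebesgue n A.
Proof.
move=> h; apply: (@measure_unique _ _ _ [set A | exists a b, A = box a b]
  (fun k => box (const_mx (- k%:R)) (const_mx k%:R))).
- exact: measurable_boxE.
- by move=> _ _ [a [b ->]] [a' [b' ->]]; rewrite box_setI; eexists; eexists.
- by move=> k; eexists; eexists.
- exact: bigcup_box.
- by move=> _ [a [b ->]].
- by move=> k; rewrite h lebesgue_box ltry.
Qed.

End lebesgue_box.

(** * Lebesgue measure under isometries and dilations *)

(** The Jacobian [c] of a change of variables, recorded on preimages. *)
Definition scales_lebesgue (R : realType) n (c : R) (T : 'rV[R]_n -> 'rV[R]_n) :=
  measurable_fun setT T /\
  forall A, measurable A -> lebesgue n (T @^-1` A) = (c%:E * lebesgue n A)%E.

Section scaling.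
Context {R : realType}.

Lemma measurable_preimage_rV n k (T : 'rV[R]_n -> 'rV[R]_k) A :
  measurable_fun setT T -> measurable A -> measurable (T @^-1` A).
Proof. by move=> mT mA; rewrite -[X in measurable X]setTI; exact: mT. Qed.

Lemma scales_lebesgue_box n (c : R) (T : 'rV[R]_n -> 'rV[R]_n) : 0 < c ->
  measurable_fun setT T ->
  (forall a b, lebesgue n (T @^-1` box a b) = (c%:E * lebesgue n (box a b))%E) ->
  scales_lebesgue c T.
Proof.
move=> c0 mT hT; split=> // A mA.
have ci0 : (0 <= c^-1)%R by rewrite invr_ge0 ltW.
pose nu := mscale (NngNum ci0)
  (measure_function_pushforward__canonical__measure_function_Measure
    (lebesgue n) mT).
have nuE B : nu B = (c^-1%:E * lebesgue n (T @^-1` B))%E by [].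
have <- : nu A = lebesgue n A.
  apply: (@lebesgue_unique _ _ nu) => // a b.
  rewrite [LHS]nuE hT muleA -EFinM mulVf ?mul1e//.
  by rewrite gt_eqF.
by rewrite nuE muleA -EFinM mulfV ?mul1e// gt_eqF.
Qed.

Lemma continuous_id_rV (T : topologicalType) : continuous (@id T).
Proof. by move=> x; exact: cvg_id. Qed.

Lemma measurable_add_rV n (h : 'rV[R]_n) :
  measurable_fun setT (fun x : 'rV[R]_n => x + h).
Proof.
apply: continuous_measurable_rVrV => x.
by apply: (@continuousD _ _ _ id (cst h)); [exact: continuous_id_rV|exact: cst_continuous].
Qed.

Lemma scales_lebesgue_translate n (h : 'rV[R]_n) :
  scales_lebesgue 1 (fun x => x + h).
Proof.
apply: scales_lebesgue_box => //; first exact: measurable_add_rV.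
move=> a b; rewrite mul1e.
rewrite (_ : _ @^-1` _ = box (a - h) (b - h)).
  rewrite !lebesgue_box; congr (_%:E); apply: eq_bigr => i _; rewrite !mxE.
  by congr (Num.max _ _); ring.
apply/seteqP; split=> x /= hx i; have := hx i; rewrite !mxE ltrBlDr ltrBrDr //.
Qed.

Lemma scales_lebesgue_dilate n (s : R) : 0 < s ->
  scales_lebesgue (s ^+ n) (fun x : 'rV[R]_n => s^-1 *: x).
Proof.
move=> s0; apply: scales_lebesgue_box; first exact: exprn_gt0.
  apply: continuous_measurable_rVrV => x; exact: scaler_continuous.
move=> a b.
rewrite (_ : _ @^-1` _ = box (s *: a) (s *: b)).
  rewrite !lebesgue_box -EFinM; congr (_%:E).
  rewrite -[X in _ ^+ X](card_ord n) -prodr_const -big_split /=.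
  apply: eq_bigr => i _; rewrite !mxE -mulrBr maxr_pMr ?mulr0 // ltW //.
apply/seteqP; split=> x /= hx i; have := hx i;
  by rewrite !mxE ltr_pdivlMl // ltr_pdivrMl.
Qed.

Lemma scales_lebesgue_comp n c d (T U : 'rV[R]_n -> 'rV[R]_n) :
  scales_lebesgue c T -> scales_lebesgue d U ->
  scales_lebesgue (d * c) (T \o U).
Proof.
move=> [mT hT] [mU hU]; split; first exact: measurableT_comp.
move=> A mA; rewrite comp_preimage hU; last exact: measurable_preimage_rV.
by rewrite hT // EFinM muleA.
Qed.

(** Uniqueness of Haar measure: the shears [(y, x) |-> (y, x + y)] and
    [(y, x) |-> (y + x, x)] preserve the product of the two measures and carry
    [B * A] to [A * -B]. *)
Lemma haar_swap n (nu : {sigma_finite_measure set 'rV[R]_n -> \bar R})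
    (A B : set 'rV[R]_n) :
  (forall (h : 'rV[R]_n) (C : set 'rV[R]_n), measurable C ->
     nu ((fun x => x + h) @^-1` C) = nu C) ->
  measurable A -> measurable B ->
  (nu B * lebesgue n A = nu A * lebesgue n (-%R @^-1` B))%E.
Proof.
move=> tnu mA mB.
have mN : measurable_fun setT (-%R : 'rV[R]_n -> 'rV[R]_n).
  by apply: continuous_measurable_rVrV => x; exact: opp_continuous.
have mnB : measurable (-%R @^-1` B) by exact: measurable_preimage_rV.
rewrite -(product_measure1E nu (lebesgue n) mB mA).
rewrite -(product_measure1E nu (lebesgue n) mA mnB).
pose E := [set z : 'rV[R]_n * 'rV[R]_n | B z.1 /\ A (z.2 + z.1)].
pose F := [set z : 'rV[R]_n * 'rV[R]_n | B (z.1 - z.2) /\ A z.1].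
have mD (k : R) : measurable_fun setT
    (fun z : 'rV[R]_n * 'rV[R]_n => z.1 + k *: z.2).
  apply: measurable_fun_rV => i.
  rewrite (_ : (fun t => _) = (fun z : 'rV[R]_n * 'rV[R]_n =>
    (z.1 0 i + k * z.2 0 i)%R)); last first.
    by apply/funext => z /=; rewrite !mxE.
  apply: (@measurable_funD _ _ _ setT (fun z : 'rV[R]_n * 'rV[R]_n => z.1 0 i)
     (fun z => k * z.2 0 i)).
    exact: (measurableT_comp (measurable_coord i)).
  apply: (@measurable_funM _ _ _ setT (cst k)
     (fun z : 'rV[R]_n * 'rV[R]_n => z.2 0 i)) => //.
  exact: (measurableT_comp (measurable_coord i)).
have mE : measurable E.
  rewrite (_ : E = (fst @^-1` B) `&` ((fun z => z.1 + 1 *: z.2) @^-1` A)).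
    by apply: measurableI; rewrite -[X in measurable X]setTI;
      [exact: measurable_fst|exact: mD].
  by apply/seteqP; split=> -[y x] /=; rewrite scale1r addrC.
have mF : measurable F.
  rewrite (_ : F = ((fun z => z.1 + (-1) *: z.2) @^-1` B) `&` (fst @^-1` A)).
    by apply: measurableI; rewrite -[X in measurable X]setTI;
      [exact: mD|exact: measurable_fst].
  by apply/seteqP; split=> -[y x] /=; rewrite scaleN1r.
transitivity ((nu \x lebesgue n) E)%E.
  apply: eq_integral => y _ /=.
  have [yB|yB] := pselect (B y).
    rewrite in_xsectionX ?inE // (_ : xsection E y = (fun x => x + y) @^-1` A).
      by rewrite (scales_lebesgue_translate y).2 // mul1e.
    by apply/seteqP; split=> x; rewrite /xsection /= inE /E /=; [case|].
  rewrite notin_xsectionX ?notin_setE // (_ : xsection E y = set0) //.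
  by apply/seteqP; split=> x; rewrite /xsection /= ?inE // /E /= => -[].
transitivity ((nu \x lebesgue n) F)%E.
  have sw X : measurable X -> (nu \x lebesgue n)%E X = (nu \x^ lebesgue n)%E X.
    by apply: product_measure_unique => C D mC mD'; exact: product_measure2E.
  rewrite !sw //; apply: eq_integral => x _ /=.
  rewrite (_ : ysection E x = (fun y => y + x) @^-1` ysection F x).
    by rewrite tnu //; exact: measurable_ysection.
  apply/seteqP; split=> y; rewrite /ysection /= !inE /E /F /= addrK addrC //.
apply: eq_integral => y _ /=.
have [yA|yA] := pselect (A y).
  rewrite in_xsectionX ?inE //.
  rewrite (_ : xsection F y = (fun x => x + - y) @^-1` (-%R @^-1` B)).
    by rewrite (scales_lebesgue_translate (- y)).2 // mul1e.
  by apply/seteqP; split=> x; rewrite /xsection /= inE /F /= opprB; [case|].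
rewrite notin_xsectionX ?notin_setE // (_ : xsection F y = set0) //.
by apply/seteqP; split=> x; rewrite /xsection /= ?inE // /F /= => -[].
Qed.

Lemma dotvDl n (x y z : 'rV[R]_n) : dotv (x + y) z = dotv x z + dotv y z.
Proof. by rewrite /dotv -big_split; apply: eq_bigr => i _; rewrite mxE mulrDl. Qed.
Lemma dotvC n (x y : 'rV[R]_n) : dotv x y = dotv y x.
Proof. by rewrite /dotv; apply: eq_bigr => i _; rewrite mulrC. Qed.
Lemma dotvZl n k (x y : 'rV[R]_n) : dotv (k *: x) y = k * dotv x y.
Proof. by rewrite /dotv mulr_sumr; apply: eq_bigr => i _; rewrite mxE mulrA. Qed.
Lemma dotvDr n (x y z : 'rV[R]_n) : dotv z (x + y) = dotv z x + dotv z y.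
Proof. by rewrite dotvC dotvDl !(dotvC z). Qed.
Lemma dotvZr n k (x y : 'rV[R]_n) : dotv y (k *: x) = k * dotv y x.
Proof. by rewrite dotvC dotvZl (dotvC y). Qed.
Lemma dotvNl n (x y : 'rV[R]_n) : dotv (- x) y = - dotv x y.
Proof. by rewrite -scaleN1r dotvZl mulN1r. Qed.
Lemma dotvNr n (x y : 'rV[R]_n) : dotv y (- x) = - dotv y x.
Proof. by rewrite -scaleN1r dotvZr mulN1r. Qed.
Definition dotvE := (dotvDl, dotvDr, dotvZl, dotvZr, dotvNl, dotvNr).

Lemma dotv_ge0 n (x : 'rV[R]_n) : 0 <= dotv x x.
Proof. by apply: sumr_ge0 => i _; rewrite -expr2 sqr_ge0. Qed.

Lemma dotv_eq0 n (x : 'rV[R]_n) : (dotv x x == 0) = (x == 0).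
Proof.
apply/eqP/eqP => [/psumr_eq0P h|->]; last first.
  by rewrite /dotv big1 // => i _; rewrite mxE mul0r.
apply/rowP => i; rewrite mxE; apply/eqP.
by rewrite -(sqrf_eq0 (x 0 i)) expr2 h // => j _; rewrite -expr2 sqr_ge0.
Qed.

Lemma dotv_gt0 n (x : 'rV[R]_n) : (0 < dotv x x) = (x != 0).
Proof. by rewrite lt_neqAle dotv_ge0 andbT eq_sym dotv_eq0. Qed.

Lemma continuous_sumr (T : topologicalType) I (r : seq I) (f : I -> T -> R) :
  (forall i, continuous (f i)) -> continuous (fun x => \sum_(i <- r) f i x).
Proof.
move=> cf; elim: r => [|i r IH] x.
  by under eq_fun do rewrite big_nil; exact: cvg_cst.
under eq_fun do rewrite big_cons.
by apply: continuousD; [exact: cf|exact: IH].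
Qed.

Lemma dotv_continuous n (a : 'rV[R]_n) : continuous (fun x => dotv x a).
Proof.
apply: continuous_sumr => i x.
by apply: continuousM; [exact: coord_continuous|exact: cst_continuous].
Qed.

Lemma dotvv_continuous n : continuous (fun x : 'rV[R]_n => dotv x x).
Proof.
by apply: continuous_sumr => i x; apply: continuousM; exact: coord_continuous.
Qed.

Lemma lebesgue_open_gt0 n (O : set 'rV[R]_n) :
  open O -> O !=set0 -> (0 < lebesgue n O)%E.
Proof.
move=> oO [x Ox]; have /nbhs_ballP[e /= e0 he] : nbhs x O by exact: open_nbhs_nbhs.
apply: (@lt_le_trans _ _ (lebesgue n (box (x - const_mx e) (x + const_mx e)))).
  rewrite lebesgue_box lte_fin; apply: prodr_gt0 => i _; rewrite !mxE lt_max.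
  by apply/orP; right; lra.
apply: le_measure; rewrite ?inE; [exact: measurable_box|exact: open_measurable_rV|].
move=> y hy; apply: he; split => // i j; rewrite ord1.
have := hy j; rewrite !mxE /ball /= => /andP[h1 h2].
by rewrite ltr_distlC; apply/andP; split.
Qed.

(** An alias of a measure known to be sigma-finite, on which that structure can
    be declared. *)
Section sigma_finite_copy.
Context n (nu : {measure set 'rV[R]_n -> \bar R}).
Hypothesis snu : sigma_finite setT nu.

Definition sigma_finite_copy : set 'rV[R]_n -> \bar R := nu.
HB.instance Definition _ := Measure.on sigma_finite_copy.
HB.instance Definition _ :=
  Measure_isSigmaFinite.Build _ _ _ sigma_finite_copy snu.

Lemma sigma_finite_measure_of :
  exists nu' : {sigma_finite_measure set 'rV[R]_n -> \bar R},
    nu' = nu :> (set 'rV[R]_n -> \bar R).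
Proof. by exists sigma_finite_copy. Qed.

End sigma_finite_copy.

(** Such a map carries Lebesgue measure to a translation invariant measure that
    gives balls their volume; [haar_swap] for the unit ball identifies the two. *)
Lemma scales_lebesgue_isometry n (T : 'rV[R]_n -> 'rV[R]_n) :
  continuous T -> (forall x y, T (x + y) = T x + T y) ->
  (forall x, T (T x) = x) -> (forall x, dotv (T x) (T x) = dotv x x) ->
  scales_lebesgue 1 T.
Proof.
move=> cT TD TK Tn.
have mT : measurable_fun setT T by exact: continuous_measurable_rVrV.
split=> // A mA; rewrite mul1e.
pose ball2 (r : R) := [set x : 'rV[R]_n | dotv x x < r].
have oball r : open (ball2 r).
  apply: (@open_comp _ _ (fun x => dotv x x) [set y | y < r]); last exact: open_lt.
  by move=> x _; exact: dotvv_continuous.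
have mball r : measurable (ball2 r) by exact: open_measurable_rV.
have Tball r : T @^-1` ball2 r = ball2 r.
  by apply/seteqP; split=> x /=; rewrite /ball2 /= Tn.
have ballfin (k : nat) : (lebesgue n (ball2 k%:R) < +oo)%E.
  apply: (@le_lt_trans _ _ (lebesgue n
    (box (const_mx (- (k.+1)%:R)) (const_mx (k.+1)%:R)))); last first.
    by rewrite lebesgue_box ltry.
  apply: le_measure; rewrite ?inE //; first exact: measurable_box.
  move=> x; rewrite /ball2 /= => hx i; rewrite !mxE -ltr_norml.
  rewrite -(@ltr_pXn2r _ 2%N) ?nnegrE // real_normK ?num_real //.
  apply: (@le_lt_trans _ _ (dotv x x)).
    rewrite /dotv (bigD1 i) //= -expr2 lerDl sumr_ge0 // => j _.
    by rewrite -expr2 sqr_ge0.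
  by rewrite (lt_le_trans hx) // -natrX ler_nat expnS expn1; nia.
pose nu := measure_function_pushforward__canonical__measure_function_Measure
    (lebesgue n) mT.
have snu : sigma_finite setT nu.
  exists (fun k => ball2 k%:R).
    apply/esym/seteqP; split=> // x _; exists (Num.truncn (dotv x x)).+1 => //.
    exact: truncnS_gt.
  by move=> k; split=> //; rewrite /nu /= /pushforward Tball.
have [nu' nuE] := sigma_finite_measure_of snu.
have tnu (h : 'rV[R]_n) (C : set 'rV[R]_n) :
    measurable C -> nu' ((fun x => x + h) @^-1` C) = nu' C.
  move=> mC; rewrite nuE /= /pushforward -comp_preimage.
  rewrite (_ : _ \o T = T \o (fun x => x + T h)); last first.
    by apply/funext => x /=; rewrite TD TK.
  rewrite comp_preimage (scales_lebesgue_translate (T h)).2 ?mul1e //.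
  exact: measurable_preimage_rV.
have := haar_swap tnu mA (mball 1).
have -> : -%R @^-1` ball2 1 = ball2 1.
  by apply/seteqP; split=> x; rewrite /ball2 /= !dotvE opprK.
rewrite nuE /= /pushforward Tball muleC.
have f1 : lebesgue n (ball2 1) \is a fin_num.
  by rewrite ge0_fin_numE //; exact: (ballfin 1%N).
have p1 : (0 < lebesgue n (ball2 1%R))%E.
  apply: lebesgue_open_gt0 => //; exists 0; rewrite /ball2 /= /dotv.
  by rewrite big1 // => i _; rewrite mxE mul0r.
move=> E; apply/eqP.
by rewrite eq_le -(lee_pmul2r f1 p1) -[X in _ && X](lee_pmul2r f1 p1) E lexx.
Qed.

Lemma reflect_hypK n (a : 'rV[R]_n) b : a != 0 -> involutive (reflect_hyp a b).
Proof.
rewrite -dotv_gt0 => a0 x; rewrite /reflect_hyp !dotvE -addrA -opprD -scalerDl.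
rewrite (_ : 2 * _ / _ + _ = 0) ?scale0r ?subr0 //.
by field; rewrite gt_eqF.
Qed.

Lemma reflect_hyp_continuous n (a : 'rV[R]_n) b : continuous (reflect_hyp a b).
Proof.
move=> x; apply: (@continuousB _ _ _ id); first exact: continuous_id_rV.
apply: (@continuousZr_tmp _ _ _ (fun y => 2 * (dotv y a - b) / dotv a a)).
apply: (@continuousM _ _ (fun y => 2 * (dotv y a - b)) (cst (dotv a a)^-1));
  last exact: cst_continuous.
apply: (@continuousM _ _ (cst 2) (fun y => dotv y a - b));
  first exact: cst_continuous.
apply: (@continuousB _ _ _ (fun y => dotv y a) (cst b));
  [exact: dotv_continuous|exact: cst_continuous].
Qed.

Lemma scales_lebesgue_reflect n (a : 'rV[R]_n) b : a != 0 ->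
  scales_lebesgue 1 (reflect_hyp a b).
Proof.
move=> a0; have a1 : dotv a a != 0 by rewrite dotv_eq0.
have -> : reflect_hyp a b =
    (fun x => x + (2 * b / dotv a a) *: a) \o reflect_hyp a 0.
  apply/funext => x; rewrite /reflect_hyp /= -addrA; congr (_ + _).
  have -> : 2 * (dotv x a - b) / dotv a a =
    2 * (dotv x a - 0) / dotv a a - 2 * b / dotv a a by ring.
  by rewrite scalerBl opprB addrC.
rewrite -[X in scales_lebesgue X](mul1r 1).
apply: scales_lebesgue_comp; first exact: scales_lebesgue_translate.
apply: scales_lebesgue_isometry.
- exact: reflect_hyp_continuous.
- move=> x y; rewrite /reflect_hyp !subr0 dotvDl mulrDr mulrDl scalerDl opprD.
  by rewrite addrACA.
- exact: reflect_hypK.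
- by move=> x; rewrite /reflect_hyp !dotvE (dotvC a x); field.
Qed.

End scaling.

(** * Integration under a change of variables *)

Section change_of_variables.
Context {R : realType} {n : nat}.
Implicit Types (c : R) (T : 'rV[R]_n -> 'rV[R]_n).

Lemma scales_lebesgue_ae c T (P : 'rV[R]_n -> Prop) : scales_lebesgue c T ->
  {ae lebesgue n, forall x, P x} -> {ae lebesgue n, forall x, P (T x)}.
Proof.
move=> [mT hT] [A [mA A0 PA]]; exists (T @^-1` A); split.
- exact: measurable_preimage_rV.
- by rewrite hT // A0 mule0.
- by move=> x /= hx; apply: PA => /=.
Qed.

Lemma ge0_integral_scales c T (D : set 'rV[R]_n) (f : 'rV[R]_n -> \bar R) : 0 <= c ->
  scales_lebesgue c T -> measurable D -> measurable_fun [set: 'rV[R]_n] f ->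
  (forall x, 0 <= f x)%E ->
  (\int[lebesgue n]_(x in T @^-1` D) f (T x) =
   c%:E * \int[lebesgue n]_(x in D) f x)%E.
Proof.
move=> c0 [mT hT] mD mf f0.
have mfD : measurable_fun D f by exact: measurable_funTS.
rewrite -[LHS](ge0_integral_pushforward mT (lebesgue n) mD mfD) //.
rewrite (eq_measure_integral (mscale (NngNum c0) (lebesgue n))).
  by rewrite ge0_integral_mscale.
by move=> A mA _; rewrite -[LHS]/(lebesgue n (T @^-1` A)) hT.
Qed.

Lemma integral_scales c T (D : set 'rV[R]_n) (f : 'rV[R]_n -> \bar R) : 0 < c ->
  scales_lebesgue c T -> measurable D -> measurable_fun [set: 'rV[R]_n] f ->
  (\int[lebesgue n]_(x in T @^-1` D) f (T x) =
   c%:E * \int[lebesgue n]_(x in D) f x)%E.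
Proof.
move=> c0 sT mD mf; rewrite [LHS]integralE [X in (_ * X)%E]integralE.
have c0' := ltW c0.
rewrite (_ : (fun x => f (T x))^\+%E = f^\+%E \o T); last first.
  by apply/funext => x; rewrite /= !funeposE.
rewrite (_ : (fun x => f (T x))^\-%E = f^\-%E \o T); last first.
  by apply/funext => x; rewrite /= !funenegE.
have mp : measurable_fun [set: 'rV[R]_n] f^\+%E by exact: measurable_funepos.
have mn : measurable_fun [set: 'rV[R]_n] f^\-%E by exact: measurable_funeneg.
rewrite (ge0_integral_scales c0' sT mD mp) // (ge0_integral_scales c0' sT mD mn) //.
move: (\int[_]_(x in D) f^\+ x)%E (\int[_]_(x in D) f^\- x)%E => [r| |] [s| |] /=;
  by rewrite ?gt0_muley ?gt0_muleNy ?lte_fin // -?EFinB -?EFinM -?EFinB ?mulrBr.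
Qed.

Lemma Rintegral_scales c T (D : set 'rV[R]_n) (f : 'rV[R]_n -> R) : 0 < c ->
  scales_lebesgue c T -> measurable D -> measurable_fun [set: 'rV[R]_n] f ->
  \int[lebesgue n]_(x in T @^-1` D) f (T x) =
  c * \int[lebesgue n]_(x in D) f x.
Proof.
move=> c0 sT mD mf; rewrite /Rintegral.
rewrite (integral_scales c0 sT mD (f := EFin \o f)); last first.
  exact/measurable_EFinP.
case: (\int[_]_(x in D) _)%E => [r| |] //=.
  by rewrite gt0_muley ?lte_fin //= mulr0.
by rewrite gt0_muleNy ?lte_fin //= mulr0.
Qed.

Lemma RintegralT_scales c T (f : 'rV[R]_n -> R) : 0 < c ->
  scales_lebesgue c T -> measurable_fun [set: 'rV[R]_n] f ->
  \int[lebesgue n]_x f (T x) = c * \int[lebesgue n]_x f x.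
Proof.
by move=> c0 sT mf; rewrite -(Rintegral_scales c0 sT measurableT mf).
Qed.

Lemma integrable_scales c T (D : set 'rV[R]_n) (f : 'rV[R]_n -> \bar R) : 0 <= c ->
  scales_lebesgue c T -> measurable D -> measurable_fun [set: 'rV[R]_n] f ->
  (lebesgue n).-integrable D f ->
  (lebesgue n).-integrable (T @^-1` D) (f \o T).
Proof.
move=> c0 sT mD mf /integrableP[_ fi]; apply/integrableP; split.
  by apply: measurable_funTS; apply: measurableT_comp => //; case: sT.
rewrite (ge0_integral_scales c0 sT mD (f := fun x => `|f x|%E)) //.
  by rewrite lte_mul_pinfty // ge0_fin_numE // integral_ge0.
exact: measurableT_comp.
Qed.

(** Otherwise the translates of [A], disjoint and of the same positive measure,
    would exceed the measure of [B]. *)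
Lemma disjoint_translates_null (A B : set 'rV[R]_n) (h : nat -> 'rV[R]_n) :
  measurable A -> measurable B -> (lebesgue n B < +oo)%E ->
  (forall k x, A (x + h k) -> B x) ->
  (forall j k x, A (x + h j) -> A (x + h k) -> j = k) ->
  lebesgue n A = 0%E.
Proof.
move=> mA mB Bfin AB tA.
pose F k := (fun x => x + h k) @^-1` A.
have mF k : measurable (F k).
  by apply: measurable_preimage_rV => //; exact: measurable_add_rV.
have FA k : lebesgue n (F k) = lebesgue n A.
  by rewrite (scales_lebesgue_translate (h k)).2 // mul1e.
have sumF (N : nat) : (N%:R%:E * lebesgue n A <= lebesgue n B)%E.
  apply: (@le_trans _ _ (lebesgue n (\big[setU/set0]_(k < N) F k))).
    rewrite measure_bigsetU //; last first.
      by apply/trivIsetP => i j _ _ ij; apply/seteqP; split=> x //= -[hi hj];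
        move/eqP: ij; apply; exact: tA hi hj.
    rewrite (eq_bigr (fun=> lebesgue n A)) => [|i _]; last exact: FA.
    have -> : (\sum_(k < N) lebesgue n A)%R = (N%:R%:E * lebesgue n A)%E => //.
    elim: (N) => [|M IH]; first by rewrite big_ord0 mul0e.
    by rewrite big_ord_recr /= IH -natr1 EFinD ge0_muleDl ?lee_fin // mul1e.
  apply: le_measure; rewrite ?inE //; first exact: bigsetU_measurable.
  by rewrite -bigcup_mkord => x [k _ /AB].
have A0 := measure_ge0 (lebesgue n) A.
apply/eqP; rewrite eq_le A0 andbT leNgt; apply/negP => Agt.
have Af : lebesgue n A \is a fin_num.
  rewrite ge0_fin_numE //; apply: le_lt_trans Bfin.
  by have := sumF 1%N; rewrite mul1e.
have Bf : lebesgue n B \is a fin_num by rewrite ge0_fin_numE.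
have a0 : 0 < fine (lebesgue n A) by rewrite fine_gt0 // Agt ltey_eq Af.
have := sumF (Num.truncn (fine (lebesgue n B) / fine (lebesgue n A))).+1.
rewrite -(fineK Af) -(fineK Bf) -EFinM lee_fin leNgt => /negP; apply.
by rewrite -ltr_pdivrMr // truncnS_gt.
Qed.

Lemma hyperplane_null (a : 'rV[R]_n) b : a != 0 ->
  lebesgue n [set x | dotv x a = b] = 0%E.
Proof.
move=> a0; have aa : 0 < dotv a a by rewrite dotv_gt0.
have mH : measurable [set x : 'rV[R]_n | dotv x a = b].
  apply: closed_measurable_rV.
  apply: (@closed_comp _ _ (fun x => dotv x a) [set y | y = b]) => [x _|].
    exact: dotv_continuous.
  exact: closed_eq.
have [s hs] : exists s : R, forall i, `|a 0 i| <= s.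
  exists (\sum_i `|a 0 i|) => i.
  by rewrite (bigD1 i) //= lerDl sumr_ge0.
have s0 : 0 <= s \/ n = 0%N.
  case: n a hs {a0 aa mH} => [|n'] a hs; [by right|left].
  by apply: le_trans (hs ord0); exact: normr_ge0.
suff hj j : lebesgue n ([set x | dotv x a = b] `&`
    box (const_mx (- j%:R)) (const_mx j%:R)) = 0%E.
  apply/negligibleP => //; rewrite -[X in negligible _ X]setIT -bigcup_box.
  rewrite setI_bigcupr; apply: negligible_bigcup => j; apply/negligibleP => //.
    by apply: measurableI => //; exact: measurable_box.
  exact: hj.
(* These vectors are bounded and move the hyperplane to distinct parallel ones. *)
pose h k := k.+1%:R^-1 *: a.
apply: (@disjoint_translates_null _
  (box (const_mx (- (j%:R + s))) (const_mx (j%:R + s))) h).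
- by apply: measurableI => //; exact: measurable_box.
- exact: measurable_box.
- by rewrite lebesgue_box ltry.
- move=> k x [_ hx] i; have := hx i; rewrite !mxE -!ltr_norml => hi.
  rewrite -[x 0 i](addrK (k.+1%:R^-1 * a 0 i)).
  apply: le_lt_trans (ler_normB _ _) _; apply: ltr_leD => //.
  rewrite normrM ger0_norm ?invr_ge0 //; apply: le_trans (hs i).
  by rewrite ler_piMl // invf_le1 ?ler1n // ltr0n.
- move=> i k x [/= hi _] [/= hk _]; move: hi hk.
  rewrite /h !dotvDl !dotvZl => <- /addrI /(mulIf (lt0r_neq0 aa)) /invr_inj.
  by move=> /(mulrIn (oner_neq0 R)) [].
Qed.

Lemma ae_not_on_hyperplane (a : 'rV[R]_n) b : a != 0 ->
  {ae lebesgue n, forall x, dotv x a != b}.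
Proof.
move=> a0; exists [set x | dotv x a = b]; split; last 2 first.
- exact: hyperplane_null.
- by move=> x /= /negP /negPn /eqP.
apply: closed_measurable_rV.
apply: (@closed_comp _ _ (fun x => dotv x a) [set y | y = b]) => [x _|].
  exact: dotv_continuous.
exact: closed_eq.
Qed.

Lemma open_half_space (a : 'rV[R]_n) b : open [set x : 'rV[R]_n | b < dotv x a].
Proof.
apply: (@open_comp _ _ (fun x => dotv x a) [set y | b < y]); last exact: open_gt.
by move=> x _; exact: dotv_continuous.
Qed.

Lemma ae_eq_continuous (f g : 'rV[R]_n -> R) :
  continuous f -> continuous g ->
  {ae lebesgue n, forall x, f x = g x} -> forall x, f x = g x.
Proof.
move=> cf cg [A [mA A0 fgA]] x; apply/eqP; rewrite -subr_eq0; apply/negPn/negP=> fgx.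
pose O := [set y | f y - g y != 0].
have oO : open O.
  apply: (@open_comp _ _ (fun y => f y - g y) [set z | z != 0]).
    by move=> y _; apply: continuousB; [exact: cf|exact: cg].
  exact: open_neq.
have : (0 < lebesgue n O)%E by apply: lebesgue_open_gt0 => //; exists x.
rewrite ltNge => /negP; apply; rewrite -A0; apply: le_measure; rewrite ?inE //.
  exact: open_measurable_rV.
by move=> y /= Oy; apply: fgA => /= fg; move: Oy; rewrite /O /= fg subrr eqxx.
Qed.

End change_of_variables.

(** * Smooth functions *)

Section Ck_algebra.
Context {R : realType} {n : nat}.
Implicit Types f g : 'rV[R]_n -> R.

Lemma CkS k f : Ck k.+1 f -> Ck k f.
Proof.
elim: k f => [|k IH] f [df Df].
  by move=> x; exact: differentiable_continuous.
by split => // j; exact/IH/Df.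
Qed.



Lemma Ck_cst k (c : R) : Ck k (fun _ : 'rV[R]_n => c).
Proof.
elim: k c => [|k IH] c /=; first by move=> x; exact: cst_continuous.
split=> [x|j]; first exact: differentiable_cst.
rewrite (_ : 'D_ _ _ = cst 0); last by apply/funext => x; exact: derive_cst.
exact: IH.
Qed.

Lemma CkD k f g : Ck k f -> Ck k g -> Ck k (fun x => f x + g x).
Proof.
elim: k f g => [|k IH] f g.
  by move=> cf cg x; apply: continuousD; [exact: cf|exact: cg].
move=> [df Df] [dg Dg]; split=> [x|j]; first exact: differentiableD.
rewrite (_ : 'D_ _ _ = fun x => 'D_(delta_mx 0 j) f x + 'D_(delta_mx 0 j) g x).
  by apply: IH; [exact: Df|exact: Dg].
by apply/funext => x; apply: deriveD; exact: diff_derivable.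
Qed.

Lemma CkM k f g : Ck k f -> Ck k g -> Ck k (fun x => f x * g x).
Proof.
elim: k f g => [|k IH] f g.
  by move=> cf cg x; apply: continuousM; [exact: cf|exact: cg].
move=> Cf Cg; have [df Df] := Cf; have [dg Dg] := Cg.
split=> [x|j]; first exact: differentiableM.
rewrite (_ : 'D_ _ _ = fun x =>
    f x * 'D_(delta_mx 0 j) g x + g x * 'D_(delta_mx 0 j) f x).
  apply: CkD; apply: IH; [exact: CkS Cf|exact: Dg|exact: CkS Cg|exact: Df].
by apply/funext => x; apply: deriveM; exact: diff_derivable.
Qed.

Lemma Ck_sum k I (r : seq I) (F : I -> 'rV[R]_n -> R) :
  (forall i, Ck k (F i)) -> Ck k (fun x => \sum_(i <- r) F i x).
Proof.
move=> CF; elim: r => [|i r IH].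
  by under eq_fun do rewrite big_nil; exact: Ck_cst.
by under eq_fun do rewrite big_cons; exact: CkD.
Qed.

Lemma Ck_prod k I (r : seq I) (F : I -> 'rV[R]_n -> R) :
  (forall i, Ck k (F i)) -> Ck k (fun x => \prod_(i <- r) F i x).
Proof.
move=> CF; elim: r => [|i r IH].
  by under eq_fun do rewrite big_nil; exact: Ck_cst.
by under eq_fun do rewrite big_cons; exact: CkM.
Qed.

Lemma row_basis (v : 'rV[R]_n) : v = \sum_i v 0 i *: delta_mx 0 i.
Proof. by rewrite {1}(row_sum_delta v). Qed.

Lemma derive_row f x v : differentiable f x ->
  'D_v f x = \sum_i v 0 i * 'D_(delta_mx 0 i) f x.
Proof.
move=> df; rewrite deriveE // {1}(row_basis v) linear_sum; apply: eq_bigr => i _.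
by rewrite linearZ /= deriveE.
Qed.

(** Only affine changes of variables occur, so the Jacobian of [T] is taken
    constant, with rows [l j]. *)
Lemma derive_comp_affine f (T : 'rV[R]_n -> 'rV[R]_n) (l : 'I_n -> 'rV[R]_n) j x :
  (forall x, differentiable T x) ->
  (forall j x, 'D_(delta_mx 0 j) T x = l j) ->
  differentiable f (T x) ->
  'D_(delta_mx 0 j) (f \o T) x = \sum_i l j 0 i * 'D_(delta_mx 0 i) f (T x).
Proof.
move=> dT DT df; rewrite deriveE; last exact: differentiable_comp.
by rewrite diff_comp //= -(deriveE _ (dT x)) DT -deriveE // derive_row.
Qed.

Lemma Ck_comp_affine k f (T : 'rV[R]_n -> 'rV[R]_n) (l : 'I_n -> 'rV[R]_n) :
  (forall x, differentiable T x) ->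
  (forall j x, 'D_(delta_mx 0 j) T x = l j) ->
  Ck k f -> Ck k (f \o T).
Proof.
move=> dT DT; elim: k f => [|k IH] f.
  move=> cf x; apply: continuous_comp; last exact: cf.
  exact: differentiable_continuous.
move=> [df Df]; split=> [x|j]; first exact: differentiable_comp.
rewrite (_ : 'D_ _ _ = fun x => \sum_i l j 0 i * 'D_(delta_mx 0 i) f (T x)).
  by apply: Ck_sum => i; apply: CkM; [exact: Ck_cst|exact: (IH _ (Df i))].
by apply/funext => x; exact: derive_comp_affine.
Qed.

End Ck_algebra.

Section smooth1.
Context {R : realType}.

Fixpoint smooth1 (k : nat) (F : R -> R) : Prop :=
  if k is k'.+1 then
    exists2 F' : R -> R, (forall x : R, is_derive x 1 F (F' x)) & smooth1 k' F'
  else continuous F.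

Lemma is_derive_continuous (F F' : R -> R) :
  (forall x : R, is_derive x 1 F (F' x)) -> continuous F.
Proof.
move=> h x; apply: differentiable_continuous; apply/derivable1_diffP.
exact: (@ex_derive _ _ _ _ _ _ _ (h x)).
Qed.

Lemma smooth1D k (F G : R -> R) :
  smooth1 k F -> smooth1 k G -> smooth1 k (F \+ G).
Proof.
elim: k F G => [|k IH] F G; first by move=> cF cG x; apply: continuousD; [exact: cF|exact: cG].
move=> [F' hF sF] [G' hG sG]; exists (F' \+ G'); last exact: IH.
by move=> x; apply: is_deriveD.
Qed.

Lemma smooth1Z k (c : R) F : smooth1 k F -> smooth1 k (c \o* F).
Proof.
elim: k F => [|k IH] F.
  by move=> cF x; apply: continuousM; [exact: cF|exact: cst_continuous].
move=> [F' hF sF]; exists (c \o* F'); last exact: IH.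
move=> x; have -> : c \o* F = c \*: F by apply/funext => y /=; rewrite mulrC.
by rewrite /= mulrC; exact: is_deriveZ.
Qed.

Lemma derive_affine (V W : normedModType R) (f : V -> W) (x v : V) (l : W) :
  (forall h, f (h *: v + x) = f x + h *: l) -> 'D_v f x = l.
Proof.
move=> fE; rewrite /derive; apply: cvg_lim => //.
apply: (@cvg_near_cst _ _ l); near=> h.
rewrite /= fE addrC addKr scalerA mulVf ?scale1r //.
by near: h; exact: nbhs_dnbhs_neq.
Unshelve. all: by end_near. Qed.

Lemma differentiable_dotv n (a x : 'rV[R]_n) :
  differentiable (fun x => dotv x a) x.
Proof.
rewrite (_ : (fun x => _) = \sum_(i < n) (fun x : 'rV[R]_n => x 0 i * a 0 i)).
  apply: differentiable_sum => i; apply: differentiableM => //.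
  exact: differentiable_coord.
by apply/funext => y; rewrite fct_sumE.
Qed.

Lemma Ck_smooth1_dot n k F (a : 'rV[R]_n) b : smooth1 k F ->
  Ck k (fun x => F (dotv x a - b)).
Proof.
have dd x : differentiable (fun x => dotv x a - b) x.
  by apply: differentiableB => //; exact: differentiable_dotv.
elim: k F => [|k IH] F.
  move=> cF x; apply: continuous_comp; last exact: cF.
  exact: differentiable_continuous.
move=> [F' hF sF].
have dF y : differentiable F y.
  by apply/derivable1_diffP; exact: (@ex_derive _ _ _ _ _ _ _ (hF y)).
split=> [x|j]; first exact: (differentiable_comp (dd x)).
rewrite (_ : 'D_ _ _ = fun x => a 0 j * F' (dotv x a - b)).
  by apply: CkM; [exact: Ck_cst|exact: IH].
apply/funext => x.
rewrite deriveE; last exact: (differentiable_comp (dd x)).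
rewrite (diff_comp (dd x)) //=.
rewrite -(deriveE _ (dd x)) (@derive_affine _ _ _ _ _ (a 0 j)); last first.
  move=> h; rewrite dotvDl dotvZl (_ : dotv _ a = a 0 j).
    by rewrite -[h *: _]/(h * _); ring.
  rewrite /dotv (bigD1 j) //= big1 ?addr0 ?mxE ?eqxx ?mul1r // => i /negPf ij.
  by rewrite !mxE ij /= mul0r.
rewrite -{1}[a 0 j]mulr1 -[a 0 j * 1]/(a 0 j *: (1 : R)) linearZ -deriveE //.
by rewrite (@derive_val _ _ _ _ _ _ _ (hF _)).
Qed.

(** The derivatives of [x |-> exp (-1/x)] are combinations of these. *)
Definition flat (j : nat) (x : R) : R :=
  if 0 < x then x^-1 ^+ j * expR (- x^-1) else 0.

(** Makes [flat j] differentiable at [0], with derivative [0]; the exponential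
    is compared with the power of exponent [j + 2]. *)
Lemma flat_bound j : exists2 C, 0 <= C & forall x, `|flat j x| <= C * x ^+ 2.
Proof.
pose k := j.+2; exists (k%:R ^+ k); first exact: exprn_ge0.
move=> x; rewrite /flat; case: ltP => x0; last first.
  by rewrite normr0; apply: mulr_ge0; [exact: exprn_ge0|exact: sqr_ge0].
have xi : 0 < x^-1 by rewrite invr_gt0.
have xj : 0 <= x^-1 ^+ j by apply: exprn_ge0; exact: ltW.
rewrite ger0_norm; last by apply: mulr_ge0 => //; exact: expR_ge0.
have e1 : (x^-1 / k%:R) ^+ k <= expR (x^-1).
  rewrite -[X in expR X](@divfK _ k%:R) ?pnatr_eq0 // expRM_natr.
  apply: lerXn2r; rewrite ?nnegrE ?expR_ge0 //.
    by rewrite divr_ge0 // ltW.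
  by apply: le_trans (expR_ge1Dx _); rewrite lerDr.
rewrite expRN ler_pdivrMr ?expR_gt0 //.
apply: le_trans (ler_wpM2l _ e1); last first.
  by apply: mulr_ge0; [exact: exprn_ge0|exact: sqr_ge0].
have kn : k%:R ^+ k != 0 :> R by rewrite expf_neq0 // pnatr_eq0.
have -> : x^-1 / k%:R = (k%:R)^-1 * x^-1 by rewrite mulrC.
rewrite exprMn [k%:R^-1 ^+ k]exprVn (_ : x^-1 ^+ k = x^-1 ^+ j * x^-1 ^+ 2); last first.
  by rewrite -exprD addn2.
move: (k%:R ^+ k) kn (x^-1 ^+ j) => K K0 y.
rewrite (_ : K * _ * _ = y) //; field.
by rewrite K0 gt_eqF.
Qed.

Lemma is_derive_flat j (x : R) :
  is_derive x 1 (flat j) (flat j.+2 x - j%:R * flat j.+1 x).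
Proof.
have [x0|x0|->] := ltgtP x 0.
- rewrite /flat !ltNge !(ltW x0) /= mulr0 subr0.
  apply: (@near_eq_is_derive _ _ _ (cst 0)).
  by near=> y; rewrite ltNge ltW //=; near: y; exact: lt_nbhsl.
- have xn : x != 0 by rewrite gt_eqF.
  rewrite {2 3}/flat x0.
  suff dd : is_derive x 1 (fun y : R => y^-1 ^+ j * expR (- y^-1))
      (x^-1 ^+ j.+2 * expR (- x^-1) - j%:R * (x^-1 ^+ j.+1 * expR (- x^-1))).
    refine (near_eq_is_derive _ dd); near=> y; rewrite /flat ifT //.
    by near: y; apply: open_nbhs_nbhs; split; [exact: open_gt|].
  have dV : is_derive x 1 (fun y : R => y^-1) (- x ^- 2).
    have := @is_deriveV _ id x 1 1 xn (@is_derive_id _ _ _ _).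
    by rewrite /= -[_ *: _]/(_ * _) mulr1.
  have dN : is_derive x 1 (fun y : R => - y^-1) (x ^- 2).
    by have := is_deriveN dV; rewrite opprK.
  have dE : is_derive x 1 (fun y : R => expR (- y^-1)) (expR (- x^-1) * x ^- 2).
    exact: (@is_derive1_comp _ expR).
  have dX : is_derive x 1 (fun y : R => y^-1 ^+ j) (j%:R * x^-1 ^+ j.-1 * - x ^- 2).
    rewrite (_ : (fun y : R => y^-1 ^+ j) = (fun y : R => y^-1) ^+ j).
      exact: (is_deriveX j dV).
    by apply/funext => y; rewrite exprfctE.
  have E : x^-1 ^+ j.+2 * expR (- x^-1) - j%:R * (x^-1 ^+ j.+1 * expR (- x^-1)) =
      x^-1 ^+ j *: (expR (- x^-1) * x ^- 2) +
      expR (- x^-1) *: (j%:R * x^-1 ^+ j.-1 * - x ^- 2).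
    rewrite -![_ *: _]/(_ * _) -exprVn.
    by case: (j) => [|i] /=; rewrite ?exprS; ring.
  rewrite E; exact: (is_deriveM dX dE).
- rewrite {2 3}/flat ltxx mulr0 subr0.
  have [C C0 hC] := flat_bound j.
  have f0 : flat j 0 = 0 by rewrite /flat ltxx.
  suff cv : h^-1 *: ((flat j \o shift 0) (h *: (1:R)) - flat j 0) @[h --> 0^'] --> (0 : R).
    by split; [apply/cvg_ex; exists 0|exact: cvg_lim cv].
  rewrite f0; under eq_cvg do rewrite /= subr0 addr0.
  apply: (@cvg_to_0_linear _ _ C 1) => // h /andP[h0 _].
  rewrite -[h *: 1]/(h * 1) mulr1 -[h^-1 *: _]/(h^-1 * _) normrM normfV.
  by rewrite mulrC ler_pdivrMr // -mulrA -expr2 real_normK ?num_real.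
Unshelve. all: by end_near. Qed.

Lemma smooth1_flat k j : smooth1 k (flat j).
Proof.
elim: k j => [|k IH] j.
  by apply: is_derive_continuous => x; exact: is_derive_flat.
exists (fun x => flat j.+2 x + - j%:R * flat j.+1 x).
  by move=> x; rewrite mulNr; exact: is_derive_flat.
apply: (@smooth1D k (flat j.+2) (fun x => - j%:R * flat j.+1 x)) => //.
have := smooth1Z (- j%:R) (IH j.+1); congr (smooth1 _ _).
by apply/funext => x /=; rewrite mulrC.
Qed.

End smooth1.

(** * Test functions *)

Section test_functions.
Context {R : realType} {n : nat}.
Implicit Types (phi f w : 'rV[R]_n -> R).

Lemma closure_sub_closed (A K : set 'rV[R]_n) :
  closed K -> A `<=` K -> closure A `<=` K.
Proof. by move=> /closure_id {2}->; exact: closureS. Qed.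

Lemma test_function_bounded phi r :
  (forall k, Ck k phi) -> (forall x, phi x != 0 -> forall i, `|x 0 i| <= r) ->
  test_function phi.
Proof.
move=> Cphi hr; split => //.
have cK := @rV_compact R n (fun=> `[- r, r]%classic)
  (fun=> @segment_compact R (- r) r).
apply: (subclosed_compact _ cK); first exact: closed_closure.
apply: closure_sub_closed; first exact: compact_closed.
by move=> x /= /hr h i; rewrite in_itv /= -ler_norml.
Qed.

Definition tsupp phi := closure [set x | phi x != 0].

Lemma tsuppP phi x : ~ tsupp phi x -> \near x, phi x = 0.
Proof.
move=> nx; have : open (~` tsupp phi) by apply: closed_openC; exact: closed_closure.
rewrite openE => /(_ x nx); apply: filterS => y ny.
by apply/eqP/negPn/negP => yn; apply: ny; exact: subset_closure.
Qed.

Lemma tsupp0 phi x : ~ tsupp phi x -> phi x = 0.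
Proof. by move/tsuppP/nbhs_singleton. Qed.

Lemma test_function_continuous phi : test_function phi -> continuous phi.
Proof. by move=> [/(_ 0%N)]. Qed.

Lemma test_function_differentiable phi x : test_function phi -> differentiable phi x.
Proof. by move=> [/(_ 1%N) [+ _] _]. Qed.

Lemma test_function_measurable phi : test_function phi -> measurable_fun setT phi.
Proof. by move=> /test_function_continuous; exact: continuous_measurable_rV. Qed.

Lemma test_function_derive phi j :
  test_function phi -> test_function ('D_(delta_mx 0 j) phi).
Proof.
move=> [Cphi kphi]; split; first by move=> k; have [_ h] := Cphi k.+1; exact: h.
apply: (subclosed_compact _ kphi); first exact: closed_closure.
apply: closure_sub_closed; first exact: closed_closure.
move=> x /= dx; apply/not_notP => nx; move/eqP: dx; apply.
rewrite (near_eq_derive _ (g := cst 0)) ?derive_cst //.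
exact: tsuppP.
Qed.

Lemma test_function_sup phi : test_function phi ->
  exists2 C, 0 <= C & forall x, `|phi x| <= C.
Proof.
move=> tphi; have cphi := test_function_continuous tphi.
have : bounded_set (phi @` tsupp phi).
  apply: compact_bounded; apply: continuous_compact; last by case: tphi.
  exact: continuous_subspaceT.
move=> [C [Cr hC]]; exists (`|C| + 1); first by rewrite addr_ge0.
move=> x; have [sx|nx] := pselect (tsupp phi x); last first.
  by rewrite (tsupp0 nx) normr0 addr_ge0.
by apply: hC; [rewrite ltr_pwDr // ler_norm|exists x].
Qed.

Lemma loc_integrable_on f (K : set 'rV[R]_n) : loc_integrable f -> compact K ->
  (lebesgue n).-integrable K (EFin \o f).
Proof.
move=> [mf kf] cK; apply/integrableP; split; last exact: kf.
by apply/measurable_EFinP; apply: measurable_funTS.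
Qed.

Lemma integrable_test f phi : loc_integrable f -> test_function phi ->
  (lebesgue n).-integrable setT (EFin \o (fun x => f x * phi x)).
Proof.
move=> lf tphi; have [_ kphi] := tphi; have [mf _] := lf.
have mK : measurable (tsupp phi) by exact: compact_measurable_rV.
have mfp : measurable_fun [set: 'rV[R]_n] (fun x => f x * phi x).
  by apply: measurable_funM => //; exact: test_function_measurable.
rewrite (_ : _ \o _ = (EFin \o (fun x => f x * phi x)) \_ (tsupp phi)); last first.
  apply/funext => x; rewrite patchE /=; case: ifPn => //.
  by rewrite notin_setE => /tsupp0 ->; rewrite mulr0.
apply/(integrable_mkcond _ mK).
have [C C0 hC] := test_function_sup tphi.
apply: (@le_integrable _ _ _ _ _ mK _ (EFin \o (fun x => C * f x))).
- by apply/measurable_EFinP; apply: measurable_funTS.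
- move=> x _ /=; rewrite lee_fin !normrM mulrC ler_wpM2r //.
  by rewrite (ger0_norm C0).
- rewrite (_ : _ \o _ = (fun x => C%:E * (EFin \o f) x)%E) //.
  by apply: integrableZl => //; exact: loc_integrable_on.
Qed.

Lemma test_functionM phi f : test_function phi -> (forall k, Ck k f) ->
  test_function (fun x => phi x * f x).
Proof.
move=> [Cphi kphi] Cf; split; first by move=> k; exact: CkM.
apply: (subclosed_compact _ kphi); first exact: closed_closure.
apply: closure_subset => x /=; apply: contra_neq => ->; exact: mul0r.
Qed.

(** The inverse [T'] carries the support of [phi] to that of [phi \o T], which
    is therefore compact. *)
Lemma test_function_comp phi (T T' : 'rV[R]_n -> 'rV[R]_n) (l : 'I_n -> 'rV[R]_n) :
  (forall x, differentiable T x) ->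
  (forall j x, 'D_(delta_mx 0 j) T x = l j) ->
  cancel T T' -> continuous T' ->
  test_function phi -> test_function (phi \o T).
Proof.
move=> dT DT TK cT' [Cphi kphi]; split=> [k|]; first exact: (Ck_comp_affine dT DT).
have cK : compact (T' @` tsupp phi).
  by apply: continuous_compact => //; exact: continuous_subspaceT.
apply: (subclosed_compact _ cK); first exact: closed_closure.
apply: closure_sub_closed; first exact: compact_closed.
move=> x /= hx; exists (T x) => //; exact: subset_closure.
Qed.

(** The factor [k] makes the family increase to the indicator of the open box,
    outside of which all its members vanish. *)
Definition smooth_bump (a b : 'rV[R]_n) (k : nat) : 'rV[R]_n -> R := fun x =>
  \prod_i (flat 0 (k%:R * (x 0 i - a 0 i)) * flat 0 (k%:R * (b 0 i - x 0 i))).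

Lemma flat0_ge0 (t : R) : 0 <= flat 0 t.
Proof. by rewrite /flat; case: ifP => // _; rewrite mul1r expR_ge0. Qed.

Lemma flat0_le1 (t : R) : flat 0 t <= 1.
Proof.
by rewrite /flat; case: ifP => // t0; rewrite mul1r expR_le1 lerNl oppr0 invr_ge0 ltW.
Qed.

Lemma flat0_le0 (t : R) : t <= 0 -> flat 0 t = 0.
Proof. by rewrite /flat leNgt => /negbTE ->. Qed.

Lemma flat0_cvg (t : R) : 0 < t -> flat 0 (k%:R * t) @[k --> \oo] --> (1 : R).
Proof.
move=> t0.
have : expR (- (t^-1 * (k.+1%:R)^-1)) @[k --> \oo] --> (1 : R).
  rewrite -[X in _ --> X](@expR0 R); apply: continuous_cvg; first exact: continuous_expR.
  rewrite -[X in _ --> X]oppr0; apply: cvgN.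
  by rewrite -[X in _ --> X](mulr0 t^-1); apply: cvgMr; exact: cvg_harmonic.
rewrite -(cvg_shiftS (fun k => flat 0 (k%:R * t))); apply: cvg_trans.
apply: near_eq_cvg; near=> k.
by rewrite /= /flat mulr_gt0 ?ltr0n // mul1r invfM mulrC.
Unshelve. all: by end_near. Qed.

Lemma smooth_bump_ge0 a b k x : 0 <= smooth_bump a b k x.
Proof. by apply: prodr_ge0 => i _; rewrite mulr_ge0 // flat0_ge0. Qed.

Lemma smooth_bump_le1 a b k x : smooth_bump a b k x <= 1.
Proof.
apply: prodr_ile1 => i _; rewrite mulr_ge0 ?flat0_ge0 //=.
by rewrite mulr_ile1 // ?flat0_ge0 // flat0_le1.
Qed.

Lemma smooth_bump_out a b k x : ~ box a b x -> smooth_bump a b k x = 0.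
Proof.
move=> /existsNP[i /negP]; rewrite negb_and -!leNgt => h; rewrite /smooth_bump (bigD1 i) //=.
case/orP: h => h.
  by rewrite [flat 0 (_ * (x 0 i - _))]flat0_le0 ?mul0r // mulr_ge0_le0 // subr_le0.
rewrite [flat 0 (_ * (b 0 i - _))]flat0_le0 ?mulr0 ?mul0r //.
by rewrite mulr_ge0_le0 // subr_le0.
Qed.

Lemma cvg_prodr I (r : seq I) (u : I -> nat -> R) (l : I -> R) :
  (forall i, u i k @[k --> \oo] --> l i) ->
  \prod_(i <- r) u i k @[k --> \oo] --> \prod_(i <- r) l i.
Proof.
move=> ul; elim: r => [|i r IH].
  by under eq_cvg do rewrite big_nil; rewrite big_nil; exact: cvg_cst.
under eq_cvg do rewrite big_cons; rewrite big_cons.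
by apply: cvgM => //; exact: ul.
Qed.

Lemma smooth_bump_cvg a b x : smooth_bump a b k x @[k --> \oo] --> (\1_(box a b) x : R).
Proof.
rewrite indicE; have [|nx] := boolP (x \in box a b).
  rewrite inE => bx.
  rewrite (_ : true%:R = \prod_(i < n) (1 * 1 : R)); last first.
    by rewrite big1 // => i _; rewrite mulr1.
  rewrite /smooth_bump; apply: cvg_prodr => i.
  have /andP[h1 h2] := bx i.
  by apply: cvgM; apply: flat0_cvg; rewrite subr_gt0.
apply: cvg_near_cst; near=> k; apply: smooth_bump_out; move: nx; rewrite notin_setE //.
Unshelve. all: by end_near. Qed.

Lemma dotv_delta (x : 'rV[R]_n) i : dotv x (delta_mx 0 i) = x 0 i.
Proof.
rewrite /dotv (bigD1 i) //= big1 ?addr0 ?mxE ?eqxx ?mulr1 // => j /negPf ij.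
by rewrite mxE ij andbF mulr0.
Qed.

Lemma test_function_smooth_bump a b k : test_function (smooth_bump a b k).
Proof.
apply: (@test_function_bounded _ (\sum_i (`|a 0 i| + `|b 0 i|))); last first.
  move=> x hx i; have bx : box a b x.
    by apply/not_notP => /smooth_bump_out h; move: hx; rewrite h eqxx.
  rewrite (bigD1 i) //= -[X in X <= _]addr0 lerD ?sumr_ge0 //.
  have /andP[h1 h2] := bx i; have h3 := ler_norm (- a 0 i).
  have h4 := ler_norm (b 0 i); have h5 := normr_ge0 (a 0 i).
  have h6 := normr_ge0 (b 0 i); rewrite normrN in h3.
  by rewrite ler_norml; apply/andP; split; lra.
move=> j; apply: Ck_prod => i; apply: CkM.
  rewrite (_ : (fun x => _) = fun x => flat 0 (dotv x (k%:R *: delta_mx 0 i) - k%:R * a 0 i)).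
    exact/Ck_smooth1_dot/smooth1_flat.
  by apply/funext => x; rewrite dotvZr dotv_delta mulrBr.
rewrite (_ : (fun x => _) = fun x => flat 0 (dotv x (- k%:R *: delta_mx 0 i) - - k%:R * b 0 i)).
  exact/Ck_smooth1_dot/smooth1_flat.
by apply/funext => x; rewrite dotvZr dotv_delta; congr flat; ring.
Qed.

End test_functions.

(** * The fundamental lemma of the calculus of variations *)

Section density.
Context {R : realType} {n : nat} (f : 'rV[R]_n -> \bar R).
Hypothesis mf : measurable_fun [set: 'rV[R]_n] f.
Hypothesis f0 : forall x, (0 <= f x)%E.

Definition density (A : set 'rV[R]_n) : \bar R :=
  (\int[lebesgue n]_(x in A) f x)%E.

Let density0 : density set0 = 0%E.
Proof. exact: integral_set0. Qed.

Let density_ge0 A : (0 <= density A)%E.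
Proof. exact: integral_ge0. Qed.

Let density_sigma_additive : semi_sigma_additive density.
Proof.
move=> F mF tF mUF; rewrite /density ge0_integral_bigcup //; last first.
  exact: measurable_funTS.
by apply/cvg_closeP; split; [apply: is_cvg_nneseries => *; exact: integral_ge0|
  rewrite closeE].
Qed.

HB.instance Definition _ := isMeasure.Build _ _ _ density
  density0 density_ge0 density_sigma_additive.

Definition density_measure : {measure set 'rV[R]_n -> \bar R} := density.

End density.

Section du_bois_reymond.
Context {R : realType} {n : nat}.
Implicit Types (phi f w : 'rV[R]_n -> R).

(** Says that [w] vanishes as a distribution. *)
Definition annihilates_test w := forall phi, test_function phi ->
  \int[lebesgue n]_x (w x * phi x) = 0.

Lemma dominated_limit0 (f_ : nat -> 'rV[R]_n -> \bar R) (f g : 'rV[R]_n -> \bar R) :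
  (forall k, measurable_fun [set: 'rV[R]_n] (f_ k)) ->
  measurable_fun [set: 'rV[R]_n] f ->
  (forall x, f_ k x @[k --> \oo] --> f x) ->
  (lebesgue n).-integrable setT g -> (forall k x, `|f_ k x| <= g x)%E ->
  (forall k, \int[lebesgue n]_x f_ k x = 0)%E ->
  (\int[lebesgue n]_x f x = 0)%E.
Proof.
move=> mf_ mf cf ig fg f0.
have cf' : {ae lebesgue n, forall x, setT x -> f_ k x @[k --> \oo] --> f x}.
  by apply/aeW => x _; exact: cf.
have fg' : {ae lebesgue n, forall x, forall k, setT x -> (`|f_ k x| <= g x)%E}.
  by apply/aeW => x k _; exact: fg.
have [_ _ h] := dominated_convergence measurableT mf_ mf cf' ig fg'.
apply/esym; apply: (cvg_unique _ _ h); first exact: ereal_hausdorff.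
by rewrite (_ : [sequence _]_k = cst 0%E); [exact: cvg_cst|apply/funext => k /=].
Qed.

(** The smooth bumps increase to the indicator of the box, and are dominated by
    it. *)
Lemma integral_box0 w (a b : 'rV[R]_n) :
  loc_integrable w -> annihilates_test w ->
  (\int[lebesgue n]_(x in box a b) (w x)%:E = 0)%E.
Proof.
move=> lw w0; have [mw _] := lw.
pose K := [set v : 'rV[R]_n | forall i, `[a 0 i, b 0 i]%classic (v ord0 i)].
have cK : compact K.
  exact: (@rV_compact R n (fun i => `[a 0 i, b 0 i]%classic)
    (fun i => @segment_compact R (a 0 i) (b 0 i))).
have mK := compact_measurable_rV cK.
have boxK : box a b `<=` K.
  by move=> x bx i /=; have /andP[h1 h2] := bx i; rewrite in_itv /= !ltW.
pose f_ k := EFin \o (fun x => w x * smooth_bump a b k x).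
have mf k : measurable_fun [set: 'rV[R]_n] (f_ k).
  apply/measurable_EFinP; apply: measurable_funM => //.
  apply: test_function_measurable; exact: test_function_smooth_bump.
pose wb x : R := w x * \1_(box a b) x.
have mb : measurable_fun [set: 'rV[R]_n] (EFin \o wb).
  apply/measurable_EFinP; apply: measurable_funM => //.
  by apply: measurable_indic; exact: measurable_box.
have fE : (\int[lebesgue n]_x (EFin \o wb) x =
           \int[lebesgue n]_(x in box a b) (w x)%:E)%E.
  rewrite [RHS]integral_mkcond; apply: eq_integral => x _.
  rewrite patchE /= /wb indicE; case: (x \in box a b); first by rewrite mulr1.
  by rewrite mulr0.
rewrite -fE; apply: (@dominated_limit0 f_ _ ((abse \o (EFin \o w)) \_ K)) => //.
- move=> x; apply: cvg_EFin; first by near=> k.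
  by apply: cvgMr; exact: smooth_bump_cvg.
- apply/(integrable_mkcond _ mK).
  by apply: integrable_abse; exact: loc_integrable_on.
- move=> k x; rewrite patchE /=.
  have [xK|xK] := boolP (x \in K).
    by rewrite /= lee_fin normrM ler_piMr // ger0_norm ?smooth_bump_ge0 // smooth_bump_le1.
  rewrite smooth_bump_out ?mulr0 ?normr0 //.
  by move=> /boxK; move: xK; rewrite notin_setE.
- move=> k.
  have ti := integrable_test lw (test_function_smooth_bump a b k).
  rewrite -(fineK (integrable_fin_num measurableT ti)).
  by congr (_%:E); exact: w0 (test_function_smooth_bump a b k).
Unshelve. all: by end_near. Qed.

(** The positive and negative parts of [w] are densities of measures that agree
    on boxes, hence on all Borel sets. *)
Lemma box_ae0 w : loc_integrable w ->
  (forall a b : 'rV[R]_n, \int[lebesgue n]_(x in box a b) (w x)%:E = 0)%E ->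
  {ae lebesgue n, forall x, w x = 0}.
Proof.
move=> lw w0; have [mw _] := lw.
pose B (k : nat) : set 'rV[R]_n := box (const_mx (- k%:R)) (const_mx k%:R).
have mB k : measurable (B k) by exact: measurable_box.
suff hk k : {ae lebesgue n, forall x, ((EFin \o w) \_ (B k)) x = 0%E}.
  have := ae_foralln hk; apply: filterS => x hx.
  have : (\bigcup_k B k) x by rewrite bigcup_box.
  by move=> [k _ Bk]; have := hx k; rewrite patchE mem_set //= => -[].
pose f := (EFin \o w) \_ (B k).
have mf : measurable_fun [set: 'rV[R]_n] f.
  apply/(measurable_restrictT _ (mB k)); apply/measurable_EFinP.
  exact: measurable_funTS.
pose K := [set v : 'rV[R]_n | forall i : 'I_n, `[- k%:R, k%:R]%classic (v ord0 i)].
have cK : compact K.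
  exact: (@rV_compact R n (fun i => `[- k%:R, k%:R]%classic)
    (fun i => @segment_compact R _ _)).
have BK : B k `<=` K.
  by move=> x bx i /=; have := bx i; rewrite !mxE in_itv /= => /andP[h1 h2]; rewrite !ltW.
have fi : (lebesgue n).-integrable setT f.
  apply/(integrable_mkcond _ (mB k)).
  apply: (integrableS _ (mB k) BK); first exact: compact_measurable_rV.
  exact: loc_integrable_on.
have fiE E : measurable E -> (lebesgue n).-integrable E f.
  by move=> mE; apply: (integrableS measurableT mE _ fi).
have f0 E : measurable E -> (\int[lebesgue n]_(x in E) f x = 0)%E.
  move=> mE.
  have mp : measurable_fun [set: 'rV[R]_n] f^\+%E by exact: measurable_funepos.
  have mn : measurable_fun [set: 'rV[R]_n] f^\-%E by exact: measurable_funeneg.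
  have pe : (\int[lebesgue n]_(x in E) f^\+ x =
             \int[lebesgue n]_(x in E) f^\- x)%E.
    apply: (@measure_unique _ _ _ [set A | exists a b : 'rV[R]_n, A = box a b] B
      _ _ _ _ (density_measure mp (funepos_ge0 _))
        (density_measure mn (funeneg_ge0 _))) => //.
    - exact: measurable_boxE.
    - by move=> _ _ [a [b ->]] [a' [b' ->]]; rewrite box_setI; eexists; eexists.
    - by move=> i; eexists; eexists.
    - exact: bigcup_box.
    - move=> _ [a [b ->]] /=; rewrite /density.
      have : (\int[lebesgue n]_(x in box a b) f x = 0)%E.
        rewrite /f -integral_mkcondr box_setI //.
      rewrite integralE => /eqP; rewrite sube_eq ?add0e; first by move/eqP.
        by apply: integrable_pos_fin_num; [|apply: fiE]; exact: measurable_box.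
      by rewrite fin_num_adde_defr.
    - move=> i /=; rewrite /density ltey_eq integrable_pos_fin_num //; exact: fiE.
  rewrite integralE pe subee //.
  by apply: integrable_neg_fin_num => //; exact: fiE.
have := @integral_ae_eq _ _ _ (lebesgue n) setT measurableT (cst 0%E) f fi _ _.
move=> /(_ (@measurable_cst _ _ _ _ _ _)) h.
have {h} : ae_eq (lebesgue n) setT f (cst 0%E).
  by apply: h => E _ mE; rewrite f0 // integral0.
by apply: filterS => x; apply.
Qed.

Lemma du_bois_reymond w : loc_integrable w -> annihilates_test w ->
  {ae lebesgue n, forall x, w x = 0}.
Proof. by move=> lw w0; apply: box_ae0 => // a b; exact: integral_box0. Qed.

End du_bois_reymond.

(** * Weak derivatives *)

Section loc_integrable_theory.
Context {R : realType} {n : nat}.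
Implicit Types (phi f w : 'rV[R]_n -> R).

Lemma loc_integrableP f : measurable_fun [set: 'rV[R]_n] f ->
  (forall K, compact K -> (lebesgue n).-integrable K (EFin \o f)) ->
  loc_integrable f.
Proof. by move=> mf h; split => // K /h /integrableP[]. Qed.

Lemma loc_integrableD f g : loc_integrable f -> loc_integrable g ->
  loc_integrable (fun x => f x + g x).
Proof.
move=> lf lg; apply: loc_integrableP => [|K cK].
  by apply: measurable_funD; [case: lf|case: lg].
rewrite (_ : _ \o _ = (EFin \o f) \+ (EFin \o g))%E //.
by apply: integrableD; [exact: compact_measurable_rV|exact: loc_integrable_on|
  exact: loc_integrable_on].
Qed.

Lemma loc_integrableZ k f : loc_integrable f -> loc_integrable (fun x => k * f x).
Proof.
move=> lf; apply: loc_integrableP => [|K cK].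
  by apply: measurable_funM => //; case: lf.
rewrite (_ : _ \o _ = (fun x => k%:E * (EFin \o f) x)%E) //.
by apply: integrableZl; [exact: compact_measurable_rV|exact: loc_integrable_on].
Qed.

Lemma loc_integrable0 : loc_integrable (fun _ : 'rV[R]_n => 0).
Proof.
by split => // K cK; rewrite integral0_eq // => x _; rewrite normr0.
Qed.

Lemma loc_integrable_sum I (r : seq I) (F : I -> 'rV[R]_n -> R) :
  (forall i, loc_integrable (F i)) -> loc_integrable (fun x => \sum_(i <- r) F i x).
Proof.
move=> lF; elim: r => [|i r IH].
  by under eq_fun do rewrite big_nil; exact: loc_integrable0.
by under eq_fun do rewrite big_cons; exact: loc_integrableD.
Qed.

Lemma loc_integrableB f g : loc_integrable f -> loc_integrable g ->
  loc_integrable (fun x => f x - g x).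
Proof.
move=> lf /(loc_integrableZ (-1)) lg; rewrite (_ : (fun x => _) =
  fun x => f x + -1 * g x); first exact: loc_integrableD.
by apply/funext => x; rewrite mulN1r.
Qed.

Lemma loc_integrable_comp c (T T' : 'rV[R]_n -> 'rV[R]_n) f : 0 < c ->
  scales_lebesgue c T -> continuous T -> cancel T T' ->
  loc_integrable f -> loc_integrable (f \o T).
Proof.
move=> c0 sT cT TK lf; have [mf _] := lf; have [mT _] := sT.
apply: loc_integrableP => [|K cK]; first exact: measurableT_comp.
have cTK : compact (T @` K).
  by apply: continuous_compact => //; exact: continuous_subspaceT.
have -> : K = T @^-1` (T @` K).
  apply/seteqP; split=> x /=; first by move=> Kx; exists x.
  by move=> [y Ky /(can_inj TK) <-].
apply: (@integrable_scales _ _ c T _ (EFin \o f)) => //; first exact: ltW.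
- exact: compact_measurable_rV.
- exact/measurable_EFinP.
- exact: loc_integrable_on.
Qed.

End loc_integrable_theory.

Section weak_derivative_theory.
Context {R : realType} {n : nat}.
Implicit Types (phi f w : 'rV[R]_n -> R).

Lemma Rintegral_eq_ae f g : measurable_fun [set: 'rV[R]_n] f ->
  measurable_fun [set: 'rV[R]_n] g -> {ae lebesgue n, forall x, f x = g x} ->
  \int[lebesgue n]_x f x = \int[lebesgue n]_x g x.
Proof.
move=> mf mg fg; rewrite /Rintegral; congr fine.
apply: ae_eq_integral => //; [exact/measurable_EFinP|exact/measurable_EFinP|].
by apply: filterS fg => x /= ->.
Qed.

(** True for infinite integrals as well: a positive factor preserves the values
    that [fine] sends to zero. *)
Lemma Rintegral_pZl (k : R) f : 0 < k -> measurable_fun [set: 'rV[R]_n] f ->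
  \int[lebesgue n]_x (k * f x) = k * \int[lebesgue n]_x f x.
Proof.
move=> k0 mf; rewrite /Rintegral.
have mF : measurable_fun [set: 'rV[R]_n] (EFin \o f) by exact/measurable_EFinP.
rewrite (_ : \int[lebesgue n]_x (k * f x)%:E = k%:E * \int[lebesgue n]_x (f x)%:E)%E.
  case: (\int[_]_x _)%E => [r| |] //=.
    by rewrite gt0_muley ?lte_fin //= mulr0.
  by rewrite gt0_muleNy ?lte_fin //= mulr0.
rewrite [LHS]integralE [X in (_ * X)%E]integralE.
rewrite (_ : (fun x => (k * f x)%:E)^\+%E = (fun x => k%:E * (EFin \o f)^\+ x)%E); last first.
  exact: (ge0_funeposM (EFin \o f) (ltW k0)).
rewrite (_ : (fun x => (k * f x)%:E)^\-%E = (fun x => k%:E * (EFin \o f)^\- x)%E); last first.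
  exact: (ge0_funenegM (EFin \o f) (ltW k0)).
rewrite !ge0_integralZl_EFin ?ltW //; last 2 first.
- exact: measurable_funeneg.
- exact: measurable_funepos.
move: (\int[_]_x _^\+ x)%E (\int[_]_x _^\- x)%E => [r| |] [s| |] /=;
  by rewrite ?gt0_muley ?gt0_muleNy ?lte_fin // -?EFinB -?EFinM -?EFinB ?mulrBr.
Qed.

Lemma Rintegral_scales_ae (c k : R) (T : 'rV[R]_n -> 'rV[R]_n) f
    (h : 'rV[R]_n -> R) : 0 < c -> 0 < k ->
  scales_lebesgue c T -> measurable_fun [set: 'rV[R]_n] f ->
  measurable_fun [set: 'rV[R]_n] h ->
  {ae lebesgue n, forall x, f x = k * h (T x)} ->
  \int[lebesgue n]_x f x = c * k * \int[lebesgue n]_x h x.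
Proof.
move=> c0 k0 sT mf mh fh.
have mkh : measurable_fun [set: 'rV[R]_n] (fun x => k * h x).
  exact: measurable_funM.
have [mT _] := sT.
rewrite (Rintegral_eq_ae mf (measurableT_comp mkh mT) fh).
by rewrite (RintegralT_scales c0 sT mkh) Rintegral_pZl // mulrA.
Qed.

Lemma Rintegral_test_sub f g phi : loc_integrable f -> loc_integrable g ->
  test_function phi ->
  \int[lebesgue n]_x ((f x - g x) * phi x) =
  \int[lebesgue n]_x (f x * phi x) - \int[lebesgue n]_x (g x * phi x).
Proof.
move=> lf lg tphi; rewrite -RintegralB //; [|exact: integrable_test..].
by apply: eq_Rintegral => x _; rewrite mulrBl.
Qed.

Lemma is_weak_partial_unique j f w1 w2 :
  is_weak_partial j f w1 -> is_weak_partial j f w2 ->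
  {ae lebesgue n, forall x, w1 x = w2 x}.
Proof.
move=> [l1 h1] [l2 h2].
have : {ae lebesgue n, forall x, w1 x - w2 x = 0}.
  apply: du_bois_reymond; first exact: loc_integrableB.
  move=> phi tphi; rewrite Rintegral_test_sub //.
  by apply/eqP; rewrite subr_eq0 -eqr_opp -h1 // -h2.
by apply: filterS => x /eqP; rewrite subr_eq0 => /eqP.
Qed.

Lemma weak_partialP j f :
  weakly_differentiable f -> is_weak_partial j f (weak_partial j f).
Proof. by move=> /(_ j) [w hw]; rewrite /weak_partial; exact: (xgetPex _ (ex_intro _ w hw)). Qed.

Lemma weak_partial_ae j f w : is_weak_partial j f w ->
  {ae lebesgue n, forall x, weak_partial j f x = w x}.
Proof.
move=> hw; apply: is_weak_partial_unique (hw).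
by rewrite /weak_partial; exact: (xgetPex _ (ex_intro _ w hw)).
Qed.

Lemma ae_forall_ord k (P : 'I_k -> 'rV[R]_n -> Prop) :
  (forall i, {ae lebesgue n, forall x, P i x}) ->
  {ae lebesgue n, forall x, forall i, P i x}.
Proof.
move=> h; apply: (@filterS _ _ _ (fun x => forall j : nat,
    if insub j is Some i then P i x else True)).
  by move=> x hx i; have := hx i; rewrite valK.
by apply: ae_foralln => j; case: insubP => [i _ _|_]; [exact: h|exact: aeW].
Qed.

Lemma weak_grad_ae f (w : 'I_n -> 'rV[R]_n -> R) :
  (forall j, is_weak_partial j f (w j)) ->
  {ae lebesgue n, forall x, weak_grad f x = \row_j w j x}.
Proof.
move=> hw; have := ae_forall_ord (fun j => weak_partial_ae (hw j)).
by apply: filterS => x hx; apply/rowP => j; rewrite !mxE.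
Qed.

Lemma integrable_lincomb I (r : seq I) (k : I -> R) (h : I -> 'rV[R]_n -> R) :
  (forall i, (lebesgue n).-integrable setT (EFin \o h i)) ->
  (lebesgue n).-integrable setT (EFin \o (fun x => \sum_(i <- r) k i * h i x)) /\
  \int[lebesgue n]_x (\sum_(i <- r) k i * h i x) =
    \sum_(i <- r) k i * \int[lebesgue n]_x h i x.
Proof.
move=> ih; elim: r => [|i r [IHi IH]].
  rewrite big_nil; split.
    rewrite (_ : EFin \o _ = cst 0%E); first exact: integrable0.
    by apply/funext => x /=; rewrite big_nil.
  by under eq_Rintegral do rewrite big_nil; rewrite Rintegral_cst // mul0r.
have ki : (lebesgue n).-integrable setT (EFin \o (fun x => k i * h i x)).
  rewrite (_ : _ \o _ = (fun x => (k i)%:E * (EFin \o h i) x)%E) //.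
  exact: integrableZl.
split.
  pose F1 := EFin \o (fun x => k i * h i x).
  pose F2 := EFin \o (fun x => \sum_(i <- r) k i * h i x).
  rewrite (_ : EFin \o _ = (F1 \+ F2)%E); first exact: integrableD.
  by apply/funext => x /=; rewrite big_cons EFinD.
under eq_Rintegral do rewrite big_cons.
by rewrite RintegralD // IH big_cons RintegralZl.
Qed.

(** Changing variables by [T] replaces the test function [phi] by [phi \o T'];
    the classical chain rule for the latter brings out the constant Jacobian. *)
Lemma is_weak_partial_comp c (T T' : 'rV[R]_n -> 'rV[R]_n)
    (l l' : 'I_n -> 'rV[R]_n) f (w : 'I_n -> 'rV[R]_n -> R) j :
  0 < c -> scales_lebesgue c T ->
  (forall x, differentiable T x) -> (forall x, differentiable T' x) ->
  (forall j x, 'D_(delta_mx 0 j) T x = l j) ->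
  (forall j x, 'D_(delta_mx 0 j) T' x = l' j) ->
  cancel T T' -> cancel T' T ->
  loc_integrable f -> (forall i, is_weak_partial i f (w i)) ->
  is_weak_partial j (f \o T) (fun x => \sum_i l j 0 i * w i (T x)).
Proof.
move=> c0 sT dT dT' DT DT' TK T'K lf hw.
have cT : continuous T by move=> x; exact: differentiable_continuous.
have lw i : loc_integrable (fun x => w i (T x)).
  by have [lwi _] := hw i; exact: (loc_integrable_comp c0 sT cT TK lwi).
split; first by apply: loc_integrable_sum => i; exact: loc_integrableZ.
move=> phi tphi; pose psi := phi \o T'.
have tpsi : test_function psi.
  by apply: (test_function_comp dT' DT' T'K) => // x; exact: cT.
have phiE x : phi x = psi (T x) by rewrite /psi /= TK.
have DphiE x : 'D_(delta_mx 0 j) phi x =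
    \sum_i l j 0 i * 'D_(delta_mx 0 i) psi (T x).
  rewrite -(derive_comp_affine j dT DT); last exact: test_function_differentiable.
  by rewrite {1}(_ : phi = psi \o T) //; apply/funext => y; rewrite phiE.
have tD i : test_function ('D_(delta_mx 0 i) psi) by exact: test_function_derive.
have ci (g h : 'rV[R]_n -> R) : loc_integrable g -> test_function h ->
    (lebesgue n).-integrable setT (EFin \o (fun x => g (T x) * h (T x))) /\
    \int[lebesgue n]_x (g (T x) * h (T x)) = c * \int[lebesgue n]_x (g x * h x).
  move=> lg th; have igh := integrable_test lg th.
  have mgh : measurable_fun [set: 'rV[R]_n] (fun x => g x * h x).
    by apply: measurable_funM; [case: lg|exact: test_function_measurable].
  split; last exact: (RintegralT_scales c0 sT mgh).
  apply: (integrable_scales (ltW c0) sT measurableT _ igh).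
  exact/measurable_EFinP.
have -> : \int[lebesgue n]_x ((f \o T) x * 'D_(delta_mx 0 j) phi x) =
    \int[lebesgue n]_x (\sum_i l j 0 i *
       (f (T x) * 'D_(delta_mx 0 i) psi (T x))).
  apply: eq_Rintegral => x _; rewrite DphiE /= mulr_sumr.
  by apply: eq_bigr => i _; rewrite mulrCA.
have -> : \int[lebesgue n]_x ((\sum_i l j 0 i * w i (T x)) * phi x) =
    \int[lebesgue n]_x (\sum_i l j 0 i * (w i (T x) * psi (T x))).
  apply: eq_Rintegral => x _; rewrite phiE /= mulr_suml.
  by apply: eq_bigr => i _; rewrite mulrA.
rewrite (integrable_lincomb _ _ (fun i => (ci _ _ lf (tD i)).1)).2.
have lwi i : loc_integrable (w i) by case: (hw i).
rewrite (integrable_lincomb _ _ (fun i => (ci _ _ (lwi i) tpsi).1)).2.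
rewrite -sumrN; apply: eq_bigr => i _; rewrite (ci _ _ lf (tD i)).2.
by rewrite (ci _ _ (lwi i) tpsi).2; have [_ ->] := hw i; rewrite ?mulrN.
Qed.

Lemma loc_integrable_indic f A : measurable A -> loc_integrable f ->
  loc_integrable (fun x => f x * \1_A x).
Proof.
move=> mA lf; have [mf _] := lf.
have mfA : measurable_fun [set: 'rV[R]_n] (fun x => f x * \1_A x).
  by apply: measurable_funM => //; exact: measurable_indic.
apply: loc_integrableP => // K cK.
have mK := compact_measurable_rV cK.
apply: (le_integrable mK _ _ (loc_integrable_on lf cK)).
  by apply/measurable_EFinP; apply: measurable_funTS.
move=> x _ /=; rewrite lee_fin normrM ler_piMr // indicE.
by case: (x \in A); rewrite ?normr1 ?normr0.
Qed.

(** The test functions are cut off by [flat 0 (k (x . a - b))], which increases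
    to the indicator of the half-space. *)
Lemma weak_partial_half_space j f1 f2 w1 w2 (a : 'rV[R]_n) b : a != 0 ->
  loc_integrable f1 -> loc_integrable f2 ->
  is_weak_partial j f1 w1 -> is_weak_partial j f2 w2 ->
  (forall x, b < dotv x a -> f1 x = f2 x) ->
  {ae lebesgue n, forall x, b < dotv x a -> w1 x = w2 x}.
Proof.
move=> a0 lf1 lf2 [lw1 h1] [lw2 h2] f12.
pose H := [set x : 'rV[R]_n | b < dotv x a].
have oH : open H.
  exact: open_half_space.
have mH := open_measurable_rV oH.
have lw : loc_integrable (fun x => w1 x - w2 x) by exact: loc_integrableB.
have lwH := loc_integrable_indic mH lw.
suff : annihilates_test (fun x => (w1 x - w2 x) * \1_H x).
  move=> /(du_bois_reymond lwH); apply: filterS => x + bx.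
  by rewrite indicE mem_set // mulr1 => /eqP; rewrite subr_eq0 => /eqP.
move=> phi tphi.
pose chi (k : nat) (x : 'rV[R]_n) : R := flat 0 (dotv x (k%:R *: a) - k%:R * b).
have chiE k x : chi k x = flat 0 (k%:R * (dotv x a - b)).
  by rewrite /chi dotvZr mulrBr.
have Cchi k i : Ck i (chi k) by exact/Ck_smooth1_dot/smooth1_flat.
have tpsi k : test_function (fun x => phi x * chi k x) by exact: test_functionM.
rewrite /Rintegral (@dominated_limit0 _ _
  (fun k x => ((w1 x - w2 x) * (phi x * chi k x))%:E) _
  (abse \o (EFin \o (fun x => (w1 x - w2 x) * phi x)))) //.
- move=> k; apply/measurable_EFinP; apply: measurable_funM; first by case: lw.
  exact: test_function_measurable.
- apply/measurable_EFinP; apply: measurable_funM; first by case: lwH.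
  exact: test_function_measurable.
- move=> x; apply: cvg_EFin; first by near=> k.
  rewrite -mulrA [\1_H x * _]mulrC; apply: cvgMr; apply: cvgMr.
  under eq_cvg do rewrite chiE.
  rewrite indicE; have [|nH] := boolP (x \in H).
    by rewrite inE => Hx; apply: flat0_cvg; rewrite subr_gt0.
  apply: cvg_near_cst; near=> k; apply: flat0_le0; rewrite mulr_ge0_le0 // subr_le0.
  by move: nH; rewrite notin_setE /H /= => /negP; rewrite -leNgt.
- by apply: integrable_abse; exact: integrable_test.
- move=> k x /=; rewrite lee_fin mulrA [in X in X <= _]normrM ler_piMr //.
  by rewrite /chi ger0_norm ?flat0_ge0 // flat0_le1.
- move=> k.
  have ti := integrable_test lw (tpsi k).
  rewrite -(fineK (integrable_fin_num measurableT ti)); congr (_%:E).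
  rewrite -[LHS]/(\int[lebesgue n]_x ((w1 x - w2 x) * (phi x * chi k x))).
  rewrite (Rintegral_test_sub lw1 lw2 (tpsi k)); apply/eqP; rewrite subr_eq0.
  rewrite -eqr_opp -h1 // -h2 //; apply/eqP.
  have tD := test_function_derive j (tpsi k).
  have mD := test_function_measurable tD.
  apply: Rintegral_eq_ae.
  + by apply: measurable_funM => //; case: lf1.
  + by apply: measurable_funM => //; case: lf2.
  apply: filterS (ae_not_on_hyperplane b a0) => x.
  rewrite neq_lt => /orP[xb|/f12 -> //].
  rewrite (near_eq_derive _ (g := cst 0)) ?derive_cst ?mulr0 //.
  have oH' : open [set x : 'rV[R]_n | dotv x a < b].
    apply: (@open_comp _ _ (fun x => dotv x a) [set y | y < b]); last exact: open_lt.
    by move=> y _; exact: dotv_continuous.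
  have : nbhs x [set x : 'rV[R]_n | dotv x a < b] by exact: open_nbhs_nbhs.
  apply: filterS => y /= yb.
  by rewrite chiE flat0_le0 ?mulr0 // mulr_ge0_le0 // subr_le0 ltW.
Unshelve. all: by end_near. Qed.

Lemma weak_grad_half_space f1 f2 (a : 'rV[R]_n) b : a != 0 ->
  loc_integrable f1 -> loc_integrable f2 ->
  weakly_differentiable f1 -> weakly_differentiable f2 ->
  (forall x, b < dotv x a -> f1 x = f2 x) ->
  {ae lebesgue n, forall x, b < dotv x a -> weak_grad f1 x = weak_grad f2 x}.
Proof.
move=> a0 lf1 lf2 d1 d2 f12.
have := ae_forall_ord (fun j => weak_partial_half_space a0 lf1 lf2
  (weak_partialP j d1) (weak_partialP j d2) f12).
by apply: filterS => x hx bx; apply/rowP => j; rewrite !mxE hx.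
Qed.

End weak_derivative_theory.

(** * The functionals under dilations and foldings *)

Section enorm_theory.
Context {R : realType}.

Lemma enormE n (x : 'rV[R]_n) : enorm x ^+ 2 = dotv x x.
Proof. by rewrite /enorm sqr_sqrtr // dotv_ge0. Qed.

Lemma enorm_ge0 n (x : 'rV[R]_n) : 0 <= enorm x.
Proof. exact: sqrtr_ge0. Qed.

Lemma enormZ n k (x : 'rV[R]_n) : 0 <= k -> enorm (k *: x) = k * enorm x.
Proof.
by move=> k0; rewrite /enorm !dotvE mulrA -expr2 sqrtrM ?sqr_ge0 // sqrtr_sqr ger0_norm.
Qed.

Lemma enorm_eq0 n (x : 'rV[R]_n) : (enorm x == 0) = (x == 0).
Proof. by rewrite -sqrf_eq0 enormE dotv_eq0. Qed.

Lemma enorm_reflect n (a x : 'rV[R]_n) : a != 0 ->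
  enorm (reflect_hyp a 0 x) = enorm x.
Proof.
move=> a0; have a1 : dotv a a != 0 by rewrite dotv_eq0.
by rewrite /enorm; congr Num.sqrt; rewrite /reflect_hyp !dotvE (dotvC a x); field.
Qed.

Lemma measurable_dotv n d (T : measurableType d) (f g : T -> 'rV[R]_n) :
  (forall j, measurable_fun setT (fun x => f x 0 j : R)) ->
  (forall j, measurable_fun setT (fun x => g x 0 j : R)) ->
  measurable_fun setT (fun x => dotv (f x) (g x)).
Proof. by move=> mf mg; apply: measurable_sum => j; exact: measurable_funM. Qed.

Lemma measurable_enorm n d (T : measurableType d) (f : T -> 'rV[R]_n) :
  (forall j, measurable_fun setT (fun x => f x 0 j : R)) ->
  measurable_fun setT (fun x => enorm (f x)).
Proof.
move=> mf; apply: (measurableT_comp (f := @Num.sqrt R)); last exact: measurable_dotv.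
by apply: continuous_measurable_fun; exact: sqrt_continuous.
Qed.

End enorm_theory.

Section affine_bijections.
Context {R : realType} {n : nat}.
Implicit Types (f : 'rV[R]_n -> R) (a : 'rV[R]_n).

Lemma differentiable_scale (k : R) (x : 'rV[R]_n) : differentiable ( *:%R k) x.
Proof. exact: (@differentiableZ _ _ _ id). Qed.

Lemma derive_scale (k : R) (v x : 'rV[R]_n) : 'D_v ( *:%R k) x = k *: v.
Proof.
by apply: derive_affine => h; rewrite scalerDr addrC !scalerA mulrC.
Qed.

Lemma differentiable_reflect a b x : differentiable (reflect_hyp a b) x.
Proof.
apply: differentiableB => //; apply: differentiableZl.
apply: differentiableM => //; apply: differentiableM => //.
by apply: differentiableB => //; exact: differentiable_dotv.
Qed.

Lemma derive_reflect a b v x : 'D_v (reflect_hyp a b) x = reflect_hyp a 0 v.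
Proof.
apply: derive_affine => h; rewrite /reflect_hyp subr0 !dotvE.
by apply/rowP => i; rewrite !mxE; ring.
Qed.

Lemma weak_grad_dilate f (s : R) : 0 < s -> loc_integrable f ->
  weakly_differentiable f ->
  {ae lebesgue n, forall x, weak_grad (f \o *:%R s^-1) x =
     s^-1 *: weak_grad f (s^-1 *: x)}.
Proof.
move=> s0 lf df.
have sn : s != 0 by rewrite gt_eqF.
have TK : cancel ( *:%R s^-1 : 'rV[R]_n -> 'rV[R]_n) ( *:%R s).
  by move=> x; rewrite scalerA mulfV ?scale1r.
have T'K : cancel ( *:%R s : 'rV[R]_n -> 'rV[R]_n) ( *:%R s^-1).
  by move=> x; rewrite scalerA mulVf ?scale1r.
have wp j := is_weak_partial_comp j (exprn_gt0 n s0)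
  (scales_lebesgue_dilate n s0) (differentiable_scale s^-1)
  (differentiable_scale s) (fun j => derive_scale s^-1 (delta_mx 0 j))
  (fun j => derive_scale s (delta_mx 0 j)) TK T'K lf
  (fun i => weak_partialP i df).
apply: filterS (weak_grad_ae wp) => x ->; apply/rowP => j; rewrite !mxE.
rewrite (bigD1 j) //= big1 ?addr0 ?mxE ?eqxx ?mulr1 //.
by move=> i /negPf ij; rewrite !mxE ij !(mulr0, mul0r).
Qed.

Lemma weak_grad_reflect f a b : a != 0 -> loc_integrable f ->
  weakly_differentiable f ->
  {ae lebesgue n, forall x, weak_grad (f \o reflect_hyp a b) x =
     reflect_hyp a 0 (weak_grad f (reflect_hyp a b x))}.
Proof.
move=> a0 lf df.
have TK := reflect_hypK b a0.
have wp j := is_weak_partial_comp j ltr01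
  (scales_lebesgue_reflect b a0) (differentiable_reflect a b)
  (differentiable_reflect a b) (fun j => derive_reflect a b (delta_mx 0 j))
  (fun j => derive_reflect a b (delta_mx 0 j)) TK TK lf
  (fun i => weak_partialP i df).
apply: filterS (weak_grad_ae wp) => x ->; apply/rowP => j; rewrite !mxE.
transitivity (dotv (reflect_hyp a 0 (delta_mx 0 j)) (weak_grad f (reflect_hyp a b x))).
  by apply: eq_bigr => i _; congr (_ * _); rewrite mxE.
rewrite /reflect_hyp !dotvE dotvC dotv_delta !subr0 (dotvC (delta_mx 0 j)).
rewrite dotv_delta (dotvC a) mxE; ring.
Qed.

End affine_bijections.

Section functionals_theory.
Context {R : realType} {m n : nat} {p : R}.
Context {g : 'I_m -> 'rV[R]_m -> R} {G : 'rV[R]_m -> R}.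
Implicit Types u v : 'rV[R]_n -> 'rV[R]_m.

(** The part of admissibility that concerns a single function, so that the
    effect of dilations and foldings can be computed without the space. *)
Record regular u : Prop := Regular {
  reg_loc : forall i, loc_integrable (component u i);
  reg_diff : forall i, weakly_differentiable (component u i);
  reg_g : forall i, loc_integrable (fun x => g i (u x));
  reg_energy : (lebesgue n).-integrable setT (EFin \o grad_energy p u);
  reg_G : (lebesgue n).-integrable setT (fun x => (G (u x))%:E) }.

Lemma admissible_regular X u : admissible p g G X -> X u -> regular u.
Proof. by move=> [_ h _ _] /h [? _ ? ? [? ?]]; split. Qed.

Lemma regular_energy_measurable u : regular u ->
  measurable_fun [set: 'rV[R]_n] (grad_energy p u).
Proof. by move=> ru; have /integrableP[/measurable_EFinP] := reg_energy ru. Qed.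

Lemma regular_G_measurable u : regular u ->
  measurable_fun [set: 'rV[R]_n] (fun x => G (u x)).
Proof. by move=> ru; have /integrableP[/measurable_EFinP] := reg_G ru. Qed.

Lemma weak_grad_measurable f j : weakly_differentiable f ->
  measurable_fun [set: 'rV[R]_n] (fun x => weak_grad f x 0 j).
Proof.
move=> df; under eq_fun do rewrite mxE.
by have [[]] := weak_partialP j df.
Qed.

Lemma grad_energy_dilate u s : 0 < s -> regular u ->
  {ae lebesgue n, forall x, grad_energy p (dilate s u) x =
     s^-1 `^ p * grad_energy p u (s^-1 *: x)}.
Proof.
move=> s0 ru.
have : {ae lebesgue n, forall x, forall i, weak_grad (component (dilate s u) i) x =
    s^-1 *: weak_grad (component u i) (s^-1 *: x)}.
  apply: ae_forall_ord => i.
  exact: (weak_grad_dilate s0 (reg_loc ru i) (reg_diff ru i)).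
apply: filterS => x hx; rewrite /grad_energy mulr_sumr; apply: eq_bigr => i _.
have si : 0 <= s^-1 by rewrite invr_ge0 ltW.
by rewrite hx enormZ // powRM // enorm_ge0.
Qed.

Lemma energyJ_dilate u s : 0 < s -> regular u -> regular (dilate s u) ->
  energyJ p (dilate s u) = s ^+ n * s^-1 `^ p * energyJ p u.
Proof.
move=> s0 ru rs; rewrite /energyJ.
have sp : 0 < s^-1 `^ p by rewrite powR_gt0 // invr_gt0.
have E := Rintegral_scales_ae (exprn_gt0 n s0) sp (scales_lebesgue_dilate n s0)
  (regular_energy_measurable rs) (regular_energy_measurable ru)
  (grad_energy_dilate s0 ru).
by apply: (etrans (congr1 ( *%R p^-1) E)); exact: mulrCA.
Qed.

Lemma energyV_dilate u s : 0 < s -> regular u ->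
  energyV G (dilate s u) = s ^+ n * energyV G u.
Proof.
move=> s0 ru; exact: (RintegralT_scales (exprn_gt0 n s0)
  (scales_lebesgue_dilate n s0) (regular_G_measurable ru)).
Qed.

Lemma test_function_scale phi (s : R) : s != 0 -> test_function phi ->
  test_function (phi \o *:%R s : 'rV[R]_n -> R).
Proof.
move=> s0; apply: (@test_function_comp _ _ _ _ ( *:%R s^-1)
  (fun j => s *: delta_mx 0 j)).
- exact: differentiable_scale.
- by move=> j x; exact: derive_scale.
- by move=> x; rewrite scalerA mulVf ?scale1r.
- by move=> x; exact: scaler_continuous.
Qed.

Lemma derive_scale_comp phi (s : R) j (x : 'rV[R]_n) : test_function phi ->
  'D_(delta_mx 0 j) (phi \o *:%R s) x = s * 'D_(delta_mx 0 j) phi (s *: x).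
Proof.
move=> tphi; rewrite (derive_comp_affine (l := fun j => s *: delta_mx 0 j)).
- rewrite (bigD1 j) //= big1 ?addr0 ?mxE ?eqxx ?mulr1 //.
  by move=> i /negPf ij; rewrite !mxE ij !(mulr0, mul0r).
- exact: differentiable_scale.
- by move=> i y; exact: derive_scale.
- exact: test_function_differentiable.
Qed.

(** The integrand of the left side of the weak system. *)
Definition flux u i (phi : 'rV[R]_n -> R) (x : 'rV[R]_n) : R :=
  enorm (weak_grad (component u i) x) `^ (p - 2) *
    dotv (weak_grad (component u i) x) (\row_j 'D_(delta_mx 0 j) phi x).

Lemma flux_measurable u i phi : regular u -> test_function phi ->
  measurable_fun [set: 'rV[R]_n] (flux u i phi).
Proof.
move=> ru tphi.
have mw j : measurable_fun [set: 'rV[R]_n]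
    (fun x => weak_grad (component u i) x 0 j).
  exact: weak_grad_measurable (reg_diff ru i).
apply: measurable_funM; last first.
  apply: measurable_dotv => // j; under eq_fun do rewrite mxE.
  by apply: test_function_measurable; exact: test_function_derive.
apply: (measurableT_comp (f := (@powR R)^~ (p - 2))); first exact: measurable_powR.
exact: measurable_enorm.
Qed.

Lemma flux_dilate u i phi s : 0 < s -> regular u -> test_function phi ->
  {ae lebesgue n, forall x, flux (dilate s u) i phi x =
     s^-1 `^ p * flux u i (phi \o *:%R s) (s^-1 *: x)}.
Proof.
move=> s0 ru tphi.
have := weak_grad_dilate s0 (reg_loc ru i) (reg_diff ru i).
have si : 0 < s^-1 by rewrite invr_gt0.
apply: filterS => x; rewrite /flux.
have -> : component (dilate s u) i = component u i \o *:%R s^-1 by [].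
move=> ->; rewrite enormZ ?ltW // powRM ?enorm_ge0 ?ltW // dotvZl.
have -> : (\row_j 'D_(delta_mx 0 j) (phi \o *:%R s) (s^-1 *: x)) =
    s *: \row_j 'D_(delta_mx 0 j) phi x.
  apply/rowP => j; rewrite !mxE derive_scale_comp //.
  by rewrite scalerA mulfV ?gt_eqF // scale1r.
have -> : s^-1 `^ p = s^-1 `^ (p - 2) * s^-1 * s^-1.
  have := @powRD _ s^-1 (p - 2) 2; rewrite subrK => ->.
    by rewrite (@powR_mulrn _ s^-1 2) ?ltW // expr2 mulrA.
  by rewrite (gt_eqF si) implybT.
rewrite dotvZr; field.
by rewrite gt_eqF.
Qed.

Lemma weak_system_dilate alpha u s : 0 < s -> regular u -> regular (dilate s u) ->
  weak_system p g alpha u -> weak_system p g (s^-1 `^ p * alpha) (dilate s u).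
Proof.
move=> s0 ru rs hu i phi tphi.
have tpsi : test_function (phi \o *:%R s).
  by apply: test_function_scale => //; rewrite gt_eqF.
have sp : 0 < s^-1 `^ p by rewrite powR_gt0 // invr_gt0.
have E1 := Rintegral_scales_ae (exprn_gt0 n s0) sp (scales_lebesgue_dilate n s0)
  (flux_measurable i rs tphi) (flux_measurable i ru tpsi)
  (flux_dilate i s0 ru tphi).
have mg : measurable_fun [set: 'rV[R]_n] (fun x => g i (u x) * (phi \o *:%R s) x).
  by apply: measurable_funM; [case: (reg_g ru i)|exact: test_function_measurable].
have E2 : \int[lebesgue n]_x (g i (dilate s u x) * phi x) =
    s ^+ n * \int[lebesgue n]_x (g i (u x) * (phi \o *:%R s) x).
  rewrite -(RintegralT_scales (exprn_gt0 n s0) (scales_lebesgue_dilate n s0) mg).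
  by apply: eq_Rintegral => x _; rewrite /= scalerA mulfV ?gt_eqF // scale1r.
apply: (etrans E1); rewrite E2.
have E3 : \int[lebesgue n]_x flux u i (phi \o *:%R s) x =
    alpha * \int[lebesgue n]_x (g i (u x) * (phi \o *:%R s) x).
  exact: hu.
by apply: (etrans (congr1 ( *%R _) E3)); ring.
Qed.

End functionals_theory.

Section foldings.
Context {R : realType} {m n : nat} {p : R}.
Context {g : 'I_m -> 'rV[R]_m -> R} {G : 'rV[R]_m -> R}.
Implicit Types u v : 'rV[R]_n -> 'rV[R]_m.
Local Notation regular := (@regular R m n p g G).

Lemma dotv_reflect (a x : 'rV[R]_n) b : a != 0 ->
  dotv (reflect_hyp a b x) a = 2 * b - dotv x a.
Proof.
rewrite -dotv_eq0 => a0; rewrite /reflect_hyp !dotvE; field; exact: a0.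
Qed.

Lemma weakly_differentiable_reflect (f : 'rV[R]_n -> R) (a : 'rV[R]_n) b :
  a != 0 -> loc_integrable f -> weakly_differentiable f ->
  loc_integrable (f \o reflect_hyp a b) /\
  weakly_differentiable (f \o reflect_hyp a b).
Proof.
move=> a0 lf df; have TK := reflect_hypK b a0; split.
  exact: (loc_integrable_comp ltr01 (scales_lebesgue_reflect b a0)
    (@reflect_hyp_continuous _ _ a b) TK lf).
move=> j; eexists.
exact: (is_weak_partial_comp j ltr01
  (scales_lebesgue_reflect b a0) (differentiable_reflect a b)
  (differentiable_reflect a b) (fun j => derive_reflect a b (delta_mx 0 j))
  (fun j => derive_reflect a b (delta_mx 0 j)) TK TK lf
  (fun i => weak_partialP i df)).
Qed.

(** Each of the two sides of the hyperplane determines the gradient of a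
    function on it: one of them carries [f], the other its reflection. *)
Lemma weak_grad_fold f h (a : 'rV[R]_n) b : a != 0 ->
  loc_integrable f -> weakly_differentiable f ->
  loc_integrable h -> weakly_differentiable h ->
  (forall x, b < dotv x a -> h x = f x) ->
  (forall x, dotv x a < b -> h x = f (reflect_hyp a b x)) ->
  {ae lebesgue n, forall x,
    enorm (weak_grad h x) = if b < dotv x a then enorm (weak_grad f x)
      else enorm (weak_grad f (reflect_hyp a b x))}.
Proof.
move=> a0 lf df lh dh hp hm.
have [lr dr] := weakly_differentiable_reflect b a0 lf df.
have na0 : - a != 0 by rewrite oppr_eq0.
have A1 := weak_grad_half_space a0 lh lf dh df hp.
have hm' x : - b < dotv x (- a) -> h x = (f \o reflect_hyp a b) x.
  by rewrite dotvNr ltrN2; exact: hm.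
have A2 := weak_grad_half_space na0 lh lr dh dr hm'.
have A3 := weak_grad_reflect b a0 lf df.
have A4 := ae_not_on_hyperplane b a0.
near=> x.
have h1 : b < dotv x a -> weak_grad h x = weak_grad f x by near: x.
have h2 : - b < dotv x (- a) -> weak_grad h x = weak_grad (f \o reflect_hyp a b) x.
  by near: x.
have h3 : weak_grad (f \o reflect_hyp a b) x =
     reflect_hyp a 0 (weak_grad f (reflect_hyp a b x)) by near: x.
have h4 : dotv x a != b by near: x.
move: h4; rewrite neq_lt => /orP[xb|bx]; last by rewrite bx h1.
rewrite ltNge (ltW xb) /= h2 ?h3 ?enorm_reflect //.
by rewrite dotvNr ltrN2.
Unshelve. all: by end_near. Qed.

Lemma grad_energy_fold u v (a : 'rV[R]_n) b : a != 0 -> regular u -> regular v ->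
  (forall x, b < dotv x a -> v x = u x) ->
  (forall x, dotv x a < b -> v x = u (reflect_hyp a b x)) ->
  {ae lebesgue n, forall x,
    grad_energy p v x = if b < dotv x a then grad_energy p u x
      else grad_energy p u (reflect_hyp a b x)}.
Proof.
move=> a0 ru rv hp hm.
have : {ae lebesgue n, forall x, forall i,
    enorm (weak_grad (component v i) x) =
      if b < dotv x a then enorm (weak_grad (component u i) x)
      else enorm (weak_grad (component u i) (reflect_hyp a b x))}.
  apply: ae_forall_ord => i.
  apply: (weak_grad_fold a0 (reg_loc ru i) (reg_diff ru i)
    (reg_loc rv i) (reg_diff rv i)) => x hx; rewrite /component.
    by rewrite hp.
  by rewrite hm.
apply: filterS => x hx; rewrite /grad_energy; case: ifP hx => _ hx;
  by apply: eq_bigr => i _; rewrite hx.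
Qed.

(** Outside the null hyperplane the two foldings take at [x] the energy
    densities of [u] at [x] and at its mirror image, in some order. *)
Lemma energyJ_fold u (a : 'rV[R]_n) b : a != 0 -> regular u ->
  regular (fold_plus a b u) -> regular (fold_minus a b u) ->
  energyJ p (fold_plus a b u) + energyJ p (fold_minus a b u) = 2 * energyJ p u.
Proof.
move=> a0 ru rp rm.
have na0 : - a != 0 by rewrite oppr_eq0.
have reflN x : reflect_hyp (- a) (- b) x = reflect_hyp a b x.
  rewrite /reflect_hyp !dotvE scalerN -scaleNr; congr (_ - _ *: _).
  by rewrite !opprK; ring.
have A1 : {ae lebesgue n, forall x,
    grad_energy p (fold_plus a b u) x = if b < dotv x a then grad_energy p u x
      else grad_energy p u (reflect_hyp a b x)}.
  apply: grad_energy_fold => // x; rewrite /fold_plus; first by move=> /ltW ->.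
  by rewrite ltNge => /negbTE ->.
have A2 : {ae lebesgue n, forall x,
    grad_energy p (fold_minus a b u) x =
      if - b < dotv x (- a) then grad_energy p u x
      else grad_energy p u (reflect_hyp (- a) (- b) x)}.
  apply: grad_energy_fold => // x; rewrite /fold_minus dotvNr ltrN2.
    by move=> /ltW ->.
  by rewrite reflN ltNge => /negbTE ->.
have A3 := ae_not_on_hyperplane b a0.
have A : {ae lebesgue n, forall x,
    grad_energy p (fold_plus a b u) x + grad_energy p (fold_minus a b u) x =
    grad_energy p u x + grad_energy p u (reflect_hyp a b x)}.
  have sum2 (E1 E2 e r d : R) : E1 = (if b < d then e else r) ->
      E2 = (if - b < - d then e else r) -> d != b -> E1 + E2 = e + r.
    by move=> -> ->; rewrite ltrN2; case: ltgtP => // _ _; rewrite addrC.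
  apply: filterS3 A1 A2 A3 => x e1; rewrite reflN dotvNr => e2 e3.
  exact: sum2 e1 e2 e3.
have sR := scales_lebesgue_reflect b a0.
have [mR _] := sR.
have iR : (lebesgue n).-integrable setT
    (EFin \o (fun x => grad_energy p u (reflect_hyp a b x))).
  apply: (integrable_scales ler01 sR measurableT _ (reg_energy ru)).
  by apply/measurable_EFinP; exact: regular_energy_measurable ru.
have E1 : \int[lebesgue n]_x grad_energy p (fold_plus a b u) x +
    \int[lebesgue n]_x grad_energy p (fold_minus a b u) x =
    \int[lebesgue n]_x grad_energy p u x +
    \int[lebesgue n]_x grad_energy p u (reflect_hyp a b x).
  have X1 := RintegralD measurableT (reg_energy rp) (reg_energy rm).
  have X2 := RintegralD measurableT (reg_energy ru) iR.
  apply: (etrans (esym X1)); apply: (etrans _ X2).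
  apply: Rintegral_eq_ae A.
    exact: measurable_funD (regular_energy_measurable rp)
      (regular_energy_measurable rm).
  exact: measurable_funD (regular_energy_measurable ru)
    (measurableT_comp (regular_energy_measurable ru) mR).
have E2 := RintegralT_scales ltr01 sR (regular_energy_measurable ru).
have E3 := etrans E1 (congr1 (fun z => _ + z) E2).
apply: (etrans (esym (mulrDr _ _ _))); apply: (etrans (congr1 ( *%R p^-1) E3)).
by rewrite /energyJ; ring.
Qed.

Lemma integrable_reflect (f : 'rV[R]_n -> R) (a : 'rV[R]_n) b : a != 0 ->
  (lebesgue n).-integrable setT (EFin \o f) ->
  (lebesgue n).-integrable setT (EFin \o (fun x => f (reflect_hyp a b x))) /\
  \int[lebesgue n]_x f (reflect_hyp a b x) = \int[lebesgue n]_x f x.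
Proof.
move=> a0 fi; have /integrableP[mf _] := fi.
have sR := scales_lebesgue_reflect b a0; split.
  exact: (integrable_scales ler01 sR measurableT mf fi).
by rewrite (RintegralT_scales ltr01 sR) ?mul1r //; exact/measurable_EFinP.
Qed.

Lemma energyV_fold u (a : 'rV[R]_n) b : a != 0 -> regular u ->
  regular (fold_plus a b u) -> regular (fold_minus a b u) ->
  energyV G (fold_plus a b u) + energyV G (fold_minus a b u) = 2 * energyV G u.
Proof.
move=> a0 ru rp rm; rewrite /energyV.
have [iR ER] := integrable_reflect b a0 (reg_G ru).
rewrite -RintegralD //; [|exact: reg_G rp|exact: reg_G rm].
rewrite mulr2n mulrDl mul1r -[in X in _ = _ + X]ER -RintegralD //; last exact: reg_G ru.
apply: eq_Rintegral => x _; rewrite /fold_plus /fold_minus.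
case: ltgtP => [_|_|ab]; [by []|by rewrite addrC|].
suff -> : reflect_hyp a b x = x by [].
by rewrite /reflect_hyp -ab subrr mulr0 mul0r scale0r subr0.
Qed.

Lemma dominated_Rintegral (f_ : nat -> 'rV[R]_n -> R) (f h : 'rV[R]_n -> R) :
  (forall k, measurable_fun [set: 'rV[R]_n] (f_ k)) ->
  measurable_fun [set: 'rV[R]_n] f ->
  {ae lebesgue n, forall x, f_ k x @[k --> \oo] --> f x} ->
  (lebesgue n).-integrable setT (EFin \o h) ->
  (forall k x, `|f_ k x| <= `|h x|) ->
  \int[lebesgue n]_x f_ k x @[k --> \oo] --> \int[lebesgue n]_x f x.
Proof.
move=> mf_ mf cf ih fh.
have mE k : measurable_fun [set: 'rV[R]_n] (EFin \o f_ k) by exact/measurable_EFinP.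
have mF : measurable_fun [set: 'rV[R]_n] (EFin \o f) by exact/measurable_EFinP.
have cE : {ae lebesgue n, forall x, setT x ->
    (EFin \o f_ k) x @[k --> \oo] --> (EFin \o f) x}.
  apply: filterS cf => x hx _; apply: cvg_EFin => //; by near=> k.
have bE : {ae lebesgue n, forall x, forall k, setT x ->
    (`|(EFin \o f_ k) x| <= (abse \o (EFin \o h)) x)%E}.
  by apply/aeW => x k _ /=; rewrite lee_fin.
have iE : (lebesgue n).-integrable setT (abse \o (EFin \o h)).
  exact: integrable_abse.
have [fi _ h0] := dominated_convergence measurableT mE mF cE iE bE.
apply: fine_cvg; rewrite fineK //.
exact: integrable_fin_num.
Unshelve. all: by end_near. Qed.

Lemma measurable_half_space (f : 'rV[R]_n -> R) (a : 'rV[R]_n) b :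
  measurable_fun [set: 'rV[R]_n] f ->
  measurable_fun [set: 'rV[R]_n] (fun x => if b < dotv x a then f x else 0).
Proof.
move=> mf.
rewrite (_ : (fun x => _) = fun x => f x * \1_[set x | b < dotv x a] x).
  apply: measurable_funM => //; apply: measurable_indic.
  by apply: open_measurable_rV; exact: open_half_space.
apply/funext => x; rewrite indicE; case: ifP => h.
  by rewrite mem_set ?mulr1.
by rewrite memNset ?mulr0 //= h.
Qed.

(** The mass beyond the hyperplane [x . a = b] depends continuously on [b]
    because hyperplanes are null, and runs from the total mass to zero. *)
Lemma half_mass (f : 'rV[R]_n -> R) (a : 'rV[R]_n) : a != 0 ->
  (lebesgue n).-integrable setT (EFin \o f) -> 0 < \int[lebesgue n]_x f x ->
  exists b, \int[lebesgue n]_x (if b < dotv x a then f x else 0) =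
    2^-1 * \int[lebesgue n]_x f x.
Proof.
move=> a0 fi; set I := \int[lebesgue n]_x f x => I0.
have /integrableP[/measurable_EFinP mf _] := fi.
pose F (b : R) : R := \int[lebesgue n]_x (if b < dotv x a then f x else 0).
have mH b := measurable_half_space a b mf.
have dom (b_ : nat -> R) k x : `|if b_ k < dotv x a then f x else 0| <= `|f x|.
  by case: ifP => // _; rewrite normr0.
have Fc : continuous F.
  move=> b; apply/(@cvg_nbhsP _ R^o F) => b_ bb; rewrite /F.
  apply: (@dominated_Rintegral (fun k x => if b_ k < dotv x a then f x else 0)
    _ f) => //.
  apply: filterS (ae_not_on_hyperplane b a0) => x; rewrite neq_lt => /orP[xb|bx].
    rewrite (ltNge b) (ltW xb) /=; apply: cvg_near_cst.
    have : \forall k \near \oo, dotv x a < b_ k by exact: (cvgr_gt b bb).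
    by apply: filterS => k h; rewrite ltNge (ltW h).
  rewrite bx; apply: cvg_near_cst.
  have : \forall k \near \oo, b_ k < dotv x a by exact: (cvgr_lt b bb).
  by apply: filterS => k h; rewrite h.
have Fp : F k%:R @[k --> \oo] --> (0 : R).
  rewrite -(_ : \int[lebesgue n]_x (fun=> 0) x = 0); last by rewrite Rintegral_cst // mul0r.
  apply: (@dominated_Rintegral (fun k x => if k%:R < dotv x a then f x else 0)
    _ f) => //.
  apply/aeW => x; apply: cvg_near_cst; near=> k.
  rewrite ltNge (ltW (lt_le_trans (truncnS_gt (dotv x a)) _)) // ler_nat.
  by near: k; exact: nbhs_infty_ge.
have Fm : F (- k%:R) @[k --> \oo] --> I.
  apply: (@dominated_Rintegral (fun k x => if - k%:R < dotv x a then f x else 0)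
    _ f) => //.
  apply/aeW => x; apply: cvg_near_cst; near=> k.
    rewrite ltrNl (lt_le_trans (truncnS_gt (- dotv x a)) _) // ler_nat.
    by near: k; exact: nbhs_infty_ge.
  exact: (dom (fun k => - k%:R)).
have h0 : 0 < 2^-1 * I by rewrite mulr_gt0.
have h1 : 2^-1 * I < I by lra.
have [k [k1 k2]] : exists k : nat, F k%:R < 2^-1 * I /\ 2^-1 * I < F (- k%:R).
  have [k _ hk] : \forall k \near \oo, F k%:R < 2^-1 * I /\ 2^-1 * I < F (- k%:R).
    near=> k; split; near: k; [exact: (cvgr_lt _ Fp)|exact: (cvgr_gt _ Fm)].
  by exists k; apply: hk => /=.
have kk : - k%:R <= k%:R :> R by rewrite ge0_cp.
have cF : {within `[- k%:R, k%:R], continuous F} by exact: continuous_subspaceT.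
have mid : Num.min (F (- k%:R)) (F k%:R) <= 2^-1 * I <= Num.max (F (- k%:R)) (F k%:R).
  by rewrite ge_min le_max (ltW k1) (ltW k2) orbT.
by have [b _ hb] := IVT kk cF mid; exists b.
Unshelve. all: by end_near. Qed.

Lemma energyV_half u (a : 'rV[R]_n) b : a != 0 -> regular u ->
  regular (fold_plus a b u) ->
  energyV G (fold_plus a b u) =
    2 * \int[lebesgue n]_x (if b < dotv x a then G (u x) else 0).
Proof.
move=> a0 ru rp.
pose h x := if b < dotv x a then G (u x) else 0.
have mGu := regular_G_measurable ru.
have mh : measurable_fun [set: 'rV[R]_n] h := measurable_half_space a b mGu.
have ih : (lebesgue n).-integrable setT (EFin \o h).
  apply: (le_integrable measurableT _ _ (reg_G ru)); first exact/measurable_EFinP.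
  by move=> x _ /=; rewrite lee_fin /h; case: ifP => // _; rewrite normr0.
have [iR ER] := integrable_reflect b a0 ih.
rewrite mulr2n mulrDl mul1r -[in X in _ = _ + X]ER -RintegralD //.
apply: Rintegral_eq_ae.
- exact: regular_G_measurable rp.
- by apply: measurable_funD => //; have /integrableP[/measurable_EFinP] := iR.
apply: filterS (ae_not_on_hyperplane b a0) => x xb.
rewrite /h dotv_reflect // /fold_plus; case: ltgtP xb => // [hx|hx] _.
  rewrite (_ : b < 2 * b - dotv x a = false) ?addr0 //.
  by apply/negbTE; rewrite -leNgt; lra.
rewrite (_ : b < 2 * b - dotv x a) ?add0r //; lra.
Qed.

End foldings.

(** * Functions with zero gradient *)

Section zero_gradient.
Context {R : realType} {n : nat}.
Implicit Types (phi f : 'rV[R]_n -> R).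

Lemma differentiable_translate (h x : 'rV[R]_n) : differentiable (fun x => x + h) x.
Proof. by apply: (@differentiableD _ _ _ id (cst h)). Qed.

Lemma derive_translate (h v x : 'rV[R]_n) : 'D_v (fun x => x + h) x = v.
Proof. by apply: derive_affine => k; rewrite -addrA addrC. Qed.

Lemma test_function_translate phi (h : 'rV[R]_n) : test_function phi ->
  test_function (fun x => phi (x + h)).
Proof.
apply: (@test_function_comp _ _ _ (fun x => x + h) (fun x => x - h)
  (fun j => delta_mx 0 j)).
- exact: differentiable_translate.
- by move=> j x; exact: derive_translate.
- by move=> x; rewrite addrK.
- by move=> x; apply: differentiable_continuous; exact: differentiable_translate.
Qed.

Lemma derive_translate_comp phi (h x : 'rV[R]_n) j : test_function phi ->
  'D_(delta_mx 0 j) (fun x => phi (x + h)) x = 'D_(delta_mx 0 j) phi (x + h).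
Proof.
move=> tphi; rewrite (@derive_comp_affine _ _ phi (fun x => x + h) (fun j => delta_mx 0 j)).
- rewrite (bigD1 j) //= big1 ?addr0 ?mxE ?eqxx ?mul1r // => i /negPf ij.
  by rewrite mxE ij andbF mul0r.
- exact: differentiable_translate.
- by move=> i y; exact: derive_translate.
- exact: test_function_differentiable.
Qed.

Lemma derive_along phi (x v : 'rV[R]_n) (t : R) : differentiable phi (x + t *: v) ->
  is_derive t 1 (fun t => phi (x + t *: v)) ('D_v phi (x + t *: v)).
Proof.
move=> dphi.
have dl : differentiable (fun t : R => x + t *: v) t.
  by apply: differentiableD => //; apply: differentiableZl.
have dc : differentiable (fun t : R => phi (x + t *: v)) t.
  exact: (@differentiable_comp _ _ _ _ (fun t : R => x + t *: v) phi).
split; first exact/derivable1_diffP.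
rewrite deriveE // (@diff_comp _ _ _ _ (fun t : R => x + t *: v) phi) //=.
rewrite -(deriveE _ dl) (@derive_affine _ _ _ _ _ _ v) -?deriveE //.
move=> h; rewrite scalerDl -[h *: 1]/(h * 1) mulr1 [_ *: v + _]addrC addrA //.
Qed.

Lemma test_function_supp_bounded phi : test_function phi ->
  exists2 r, 0 <= r & forall x, phi x != 0 -> `|x| <= r.
Proof.
move=> [_ /compact_bounded[M [Mr hM]]]; exists (`|M| + 1); first by rewrite addr_ge0.
move=> x hx; apply: hM; first by rewrite ltr_pwDr // ler_norm.
exact: subset_closure.
Qed.

(** The derivative in [t] of the left side is [\int f * 'D_j psi] for a test
    function [psi], a translate of [phi]; it vanishes by assumption. *)
Lemma weak_partial0_translate j f phi (t : R) : loc_integrable f ->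
  is_weak_partial j f (fun=> 0) -> test_function phi ->
  \int[lebesgue n]_x (f x * phi (x + t *: delta_mx 0 j)) =
  \int[lebesgue n]_x (f x * phi x).
Proof.
move=> lf [_ hf] tphi.
pose e : 'rV[R]_n := delta_mx 0 j.
pose F (s : R) : R := \int[lebesgue n]_x (f x * phi (x + s *: e)).
have tt s : test_function (fun x => phi (x + s *: e)) by exact: test_function_translate.
have dF (s : R) x : is_derive s 1 (fun s => f x * phi (x + s *: e))
    (f x * 'D_e phi (x + s *: e)).
  have := is_deriveZ (f x) (derive_along (test_function_differentiable (x + s *: e) tphi)).
  by [].
have tD := test_function_derive j tphi.
have [C C0 hC] := test_function_sup tD.
have [r r0 hr] := test_function_supp_bounded tD.
have F0 (s : R) : is_derive s 1 F 0.
  pose K := [set x : 'rV[R]_n | forall i, `[- (r + (`|s| + 1) * `|e|),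
    r + (`|s| + 1) * `|e|]%classic (x ord0 i)].
  have cK : compact K by exact: (rV_compact (fun i => @segment_compact R _ _)).
  have mK := compact_measurable_rV cK.
  pose H x := C * `|f x| * \1_K x.
  have iH : (lebesgue n).-integrable setT (EFin \o H).
    rewrite (_ : EFin \o H = (fun x => C%:E * (abse \o (EFin \o f)) x)%E \_ K).
      apply/(integrable_mkcond _ mK); apply: integrableZl => //.
      by apply: integrable_abse; exact: loc_integrable_on.
    apply/funext => x; rewrite patchE /H /= indicE.
    by case: (x \in K); rewrite ?mulr1 ?mulr0.
  have Is : `]s - 1, s + 1[%classic s by rewrite /= in_itv /=; apply/andP; split; lra.
  have iF y : `]s - 1, s + 1[%classic y ->
      (lebesgue n).-integrable setT (EFin \o (fun x => f x * phi (x + y *: e))).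
    by move=> _; exact: integrable_test.
  have p1 y x : partial1of2 (fun s x => f x * phi (x + s *: e)) y x =
      f x * 'D_e phi (x + y *: e).
    by rewrite /partial1of2 derive1E; exact: (@derive_val _ _ _ _ _ _ _ (dF y x)).
  have Hb y x : `]s - 1, s + 1[%classic y -> [set: 'rV[R]_n] x ->
      `|partial1of2 (fun s x => f x * phi (x + s *: e)) y x| <= H x.
    rewrite /= in_itv /= p1 => /andP[y1 y2] _; rewrite /H indicE.
    have [xK|] := boolP (x \in K).
      by rewrite mulr1 normrM mulrC ler_wpM2r.
    rewrite mulr0 notin_setE => nK; have [->|d0] := eqVneq ('D_e phi (x + y *: e)) 0.
      by rewrite mulr0 normr0.
    exfalso; apply: nK => i /=; rewrite in_itv /= -ler_norml.
    have h1 : `|x| <= r + (`|s| + 1) * `|e|.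
      rewrite -[x](addrK (y *: e)); apply: le_trans (ler_normB _ _) _.
      rewrite lerD // ?hr // normrZ ler_wpM2r //.
      by have := ler_norm s; have := ler_norm (- s); rewrite normrN ler_norml;
        move=> *; apply/andP; split; lra.
    apply: le_trans h1; rewrite /Num.norm/= mx_normE.
    exact: (@le_bigmax _ _ _ _ (fun ij : 'I_1 * 'I_n => `|x ij.1 ij.2|%:nng) (0, i)).
  have H0 x : 0 <= H x.
    by rewrite /H !mulr_ge0 // indicE ler0n.
  have dF' (y : R) x : `]s - 1, s + 1[%classic y -> [set: 'rV[R]_n] x ->
      derivable (fun s : R => f x * phi (x + s *: e)) y 1.
    by move=> _ _; exact: (@ex_derive _ _ _ _ _ _ _ (dF y x)).
  split; first exact: (derivable_under_integral measurableT Is iF dF' H0 iH Hb).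
  rewrite -derive1E (differentiation_under_integral measurableT Is iF dF' H0 iH Hb).
  under eq_Rintegral do rewrite p1 -(derive_translate_comp _ _ _ tphi).
  rewrite hf //; under eq_Rintegral do rewrite mul0r.
  by rewrite Rintegral_cst // mul0r oppr0.
rewrite -[LHS]/(F t) (is_derive_0_is_cst t 0 F0) /F.
by under eq_Rintegral do rewrite scale0r addr0.
Qed.

(** Shifting a test function does not change its integral against [f]; so [f]
    and its translate define the same distribution. *)
Lemma weak_partial0_periodic j f (t : R) : loc_integrable f ->
  is_weak_partial j f (fun=> 0) ->
  {ae lebesgue n, forall x, f (x - t *: delta_mx 0 j) = f x}.
Proof.
move=> lf hf; pose h := t *: (delta_mx 0 j : 'rV[R]_n).
have sT := scales_lebesgue_translate (- h).
have cT : continuous (fun x : 'rV[R]_n => x - h).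
  by move=> x; apply: differentiable_continuous; exact: differentiable_translate.
have lfh : loc_integrable (fun x => f (x - h)).
  apply: (@loc_integrable_comp _ _ 1 (fun x => x - h) (fun x => x + h) f) => //.
  by move=> x; rewrite subrK.
have : {ae lebesgue n, forall x, f (x - h) - f x = 0}.
  apply: du_bois_reymond; first exact: loc_integrableB.
  move=> phi tphi; rewrite (Rintegral_test_sub lfh lf tphi).
  have th : test_function (fun x => phi (x + h)) by exact: test_function_translate.
  have mfp : measurable_fun [set: 'rV[R]_n] (fun x => f x * phi (x + h)).
    by apply: measurable_funM; [case: lf|exact: test_function_measurable].
  have := RintegralT_scales ltr01 sT mfp; rewrite mul1r.
  rewrite (weak_partial0_translate t lf hf tphi) => <-.
  by apply/eqP; rewrite subr_eq0; apply/eqP/eq_Rintegral => x _; rewrite subrK.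
by apply: filterS => x /eqP; rewrite subr_eq0 => /eqP.
Qed.

(** [f] has every period along the [j]-th axis, so a bounded part of a
    superlevel set has infinitely many disjoint translates inside the set. *)
Lemma weak_partial0_eq0 j f : loc_integrable f ->
  is_weak_partial j f (fun=> 0) ->
  (forall al, 0 < al -> (lebesgue n [set x | (al < `|f x|)%R] < +oo)%E) ->
  {ae lebesgue n, forall x, f x = 0}.
Proof.
move=> lf hf ffin; have [mf _] := lf.
have mA al : measurable [set x | al < `|f x|].
  by apply: measurable_superlevel; exact: measurableT_comp.
suff hk (k : nat) : {ae lebesgue n, forall x, box (const_mx (- k%:R)) (const_mx k%:R) x ->
    `|f x| <= k.+1%:R^-1}.
  apply: filterS (ae_foralln hk) => x hx.
  have [k _ bk] : (\bigcup_k box (const_mx (- k%:R)) (const_mx k%:R)) x.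
    by rewrite bigcup_box.
  apply/eqP; rewrite -normr_le0; apply/ler_addgt0Pr => e e0; rewrite add0r.
  pose i := maxn k (Num.truncn e^-1).
  apply: (@le_trans _ _ i.+1%:R^-1).
    apply: hx => l; have := bk l; rewrite !mxE => /andP[h1 h2].
    have ki : k%:R <= i%:R :> R by rewrite ler_nat leq_maxl.
    by apply/andP; split; lra.
  rewrite invf_ple ?posrE // (le_trans (ltW (truncnS_gt _))) // ler_nat.
  by rewrite ltnS leq_maxr.
(* The box has width [2 k] along the axis. *)
pose h (i : nat) : 'rV[R]_n := (- (i%:R * (2 * k%:R + 1))) *: delta_mx 0 j.
have : {ae lebesgue n, forall x, forall i, f (x - h i) = f x}.
  by apply: ae_foralln => i; exact: weak_partial0_periodic.
move=> [N0 [mN0 N00 hN0]].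
pose A := ([set x | k.+1%:R^-1 < `|f x|] `&` box (const_mx (- k%:R)) (const_mx k%:R))
  `\` N0.
have mAA : measurable A.
  by apply: measurableD => //; apply: measurableI => //; exact: measurable_box.
have A0 : lebesgue n A = 0%E.
  apply: (@disjoint_translates_null _ _ A [set x | k.+1%:R^-1 < `|f x|] h) => //.
  - exact: ffin.
  - move=> i x [[/= fx _] nx].
    have : forall l, f (x + h i - h l) = f (x + h i).
      by apply/not_notP => hx; apply: nx; exact: hN0.
    by move=> /(_ i); rewrite addrK => ->.
  - move=> i l x [[_ bi] _] [[_ bl] _].
    have := bi j; have := bl j; rewrite !mxE !eqxx !mulr1 => /andP[l1 l2] /andP[i1 i2].
    have k0 : 0 <= 2 * k%:R + 1 :> R by rewrite addr_ge0 // mulr_ge0.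
    case: (ltngtP i l) => // il.
      have : (i%:R + 1) * (2 * k%:R + 1) <= l%:R * (2 * k%:R + 1) :> R.
        by rewrite ler_wpM2r // natr1 ler_nat.
      by move=> hil; exfalso; clear -l1 l2 i1 i2 k0 hil; lra.
    have : (l%:R + 1) * (2 * k%:R + 1) <= i%:R * (2 * k%:R + 1) :> R.
      by rewrite ler_wpM2r // natr1 ler_nat.
    by move=> hil; exfalso; clear -l1 l2 i1 i2 k0 hil; lra.
exists (A `|` N0); split.
- exact: measurableU.
- by rewrite measureU0.
move=> x /= /not_implyP[bx /negP]; rewrite -ltNge => fx.
by have [?|?] := pselect (N0 x); [right|left; split].
Qed.

End zero_gradient.

(** * Radial symmetry from foldings *)

Section euclidean_geometry.
Context {R : realType} {n : nat}.
Implicit Types (x y a c : 'rV[R]_n).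

Lemma cauchy_schwarz x y : dotv x y ^+ 2 <= dotv x x * dotv y y.
Proof.
have [->|y0] := eqVneq y 0.
  by rewrite -(scale0r 0) !(dotvZr, dotvZl) !mul0r expr0n mulr0.
have yy : 0 < dotv y y by rewrite dotv_gt0.
have := dotv_ge0 (dotv y y *: x - dotv x y *: y).
rewrite !dotvE (dotvC y x) => h.
have : 0 <= dotv y y * (dotv x x * dotv y y - dotv x y ^+ 2).
  by apply: le_trans h _; rewrite le_eqVlt; apply/orP; left; apply/eqP; ring.
by rewrite pmulr_rge0 // subr_ge0.
Qed.

Lemma enormD x y : enorm (x + y) <= enorm x + enorm y.
Proof.
rewrite -(@ler_pXn2r _ 2%N) ?nnegrE ?addr_ge0 ?enorm_ge0 //.
rewrite sqrrD !enormE !dotvE (dotvC y x).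
suff : dotv x y <= enorm x * enorm y by move=> ?; lra.
have [xy|/ltW xy] := leP (dotv x y) 0.
  by apply: le_trans xy _; rewrite mulr_ge0 ?enorm_ge0.
rewrite -(@ler_pXn2r _ 2%N) ?nnegrE ?mulr_ge0 ?enorm_ge0 //.
by rewrite exprMn !enormE cauchy_schwarz.
Qed.

Lemma enormN x : enorm (- x) = enorm x.
Proof. by rewrite /enorm !dotvE opprK. Qed.

Lemma enormZn (k : R) x : enorm (k *: x) = `|k| * enorm x.
Proof.
have [k0|/ltW k0] := leP 0 k; first by rewrite enormZ // ger0_norm.
by rewrite -[k]opprK scaleNr enormN enormZ ?oppr_ge0 // normrN ger0_norm ?oppr_ge0.
Qed.

Lemma enorm_dist x y : `|enorm x - enorm y| <= enorm (x - y).
Proof.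
rewrite ler_distl; apply/andP; split.
  by rewrite lerBlDr -(enormN (x - y)) opprB -{1}(subrK x y) addrC enormD // subrK.
by have := enormD (x - y) y; rewrite subrK addrC.
Qed.

Lemma enorm_continuous : continuous (@enorm R n).
Proof.
move=> x; apply: (@continuous_comp _ _ _ (fun x => dotv x x) Num.sqrt).
  exact: dotvv_continuous.
exact: sqrt_continuous.
Qed.

Lemma is_derive_circle c x y (t : R) :
  differentiable (fun t => c + (cos t *: x + sin t *: y)) t /\
  'D_1 (fun t => c + (cos t *: x + sin t *: y)) t = - sin t *: x + cos t *: y.
Proof.
have dc : differentiable (@cos R) t by apply/derivable1_diffP; exact: derivable_cos.
have ds : differentiable (@sin R) t by apply/derivable1_diffP; exact: derivable_sin.
have d : differentiable (fun t => c + (cos t *: x + sin t *: y)) t.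
  apply: (@differentiableD _ _ _ (cst c) (fun t => cos t *: x + sin t *: y));
    first exact: differentiable_cst.
  apply: (@differentiableD _ _ _ (fun t => cos t *: x) (fun t => sin t *: y));
    exact: differentiableZl.
split=> //; rewrite derive_mx; last exact: diff_derivable.
apply/matrixP => i j; rewrite !mxE.
rewrite (_ : (fun t0 => _) = cst (c i j) + (x i j \*: (@cos R) + y i j \*: (@sin R))).
  have dxy : is_derive t 1 (cst (c i j) + (x i j \*: (@cos R) + y i j \*: (@sin R)))
      (0 + (x i j *: - sin t + y i j *: cos t)).
    by apply: is_deriveD; apply: is_deriveD; apply: is_deriveZ.
  by rewrite (@derive_val _ _ _ _ _ _ _ dxy) add0r -![_ *: _]/(_ * _) ![x i j * _]mulrC
    ![y i j * _]mulrC.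
by apply/funext => z; rewrite !mxE /= mulrC [_ * y i j]mulrC.
Qed.

(** A great circle joins any two points of a sphere that are not antipodal, and
    its velocity is tangential; evenness relates antipodal points. *)
Lemma tangential_radial (f : 'rV[R]_n -> R) c :
  (forall x, differentiable f x) ->
  (forall x a, dotv (x - c) a = 0 -> 'D_a f x = 0) ->
  (forall x, f (c - x) = f (c + x)) ->
  forall x y, enorm (x - c) = enorm (y - c) -> f x = f y.
Proof.
move=> df tf ef x0 y0.
rewrite -{2}(subrK c x0) -{2}(subrK c y0).
move: (x0 - c) (y0 - c) => x y; rewrite ![_ + c]addrC => xy {x0 y0}.
have dxy : dotv x x = dotv y y by rewrite -!enormE xy.
have [x0|x0] := eqVneq x 0.
  by have := enorm_eq0 y; rewrite -xy enorm_eq0 x0 eqxx => /esym/eqP ->.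
have r0 : 0 < dotv x x by rewrite dotv_gt0.
pose k := dotv x y / dotv x x.
have k1 : k ^+ 2 <= 1.
  have d2 : dotv x x ^+ 2 = dotv x x * dotv y y by rewrite expr2 -dxy.
  by rewrite /k expr_div_n ler_pdivrMr ?exprn_gt0 // mul1r d2 cauchy_schwarz.
have kE : dotv x y = k * dotv x x by rewrite /k divfK ?gt_eqF.
have [kk|kk] := eqVneq (k ^+ 2) 1.
  have : (k == 1) || (k == -1) by rewrite -eqf_sqr expr1n kk.
  case/orP => /eqP k1'.
    suff -> : x = y by [].
    apply/eqP; rewrite -subr_eq0 -dotv_eq0 !dotvE (dotvC y x) kE k1' -dxy.
    by apply/eqP; ring.
  suff -> : y = - x by rewrite ef.
  apply/eqP; rewrite -addr_eq0 -dotv_eq0 !dotvE (dotvC y x) kE k1' -dxy.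
  by apply/eqP; ring.
have s0 : 0 < 1 - k ^+ 2 by rewrite subr_gt0 lt_neqAle kk.
pose s := Num.sqrt (1 - k ^+ 2).
have sp : 0 < s by rewrite sqrtr_gt0.
have s2 : s ^+ 2 = 1 - k ^+ 2 by rewrite sqr_sqrtr // ltW.
pose e := s^-1 *: (y - k *: x).
have xe : dotv x e = 0 by rewrite /e !dotvE kE; ring.
have ee : dotv e e = dotv x x.
  have -> : dotv e e = (s ^+ 2)^-1 * ((1 - k ^+ 2) * dotv x x).
    by rewrite /e !dotvE (dotvC y x) kE -dxy -exprVn; ring.
  by rewrite s2 mulrA mulVf ?mul1r // gt_eqF.
pose th := acos k.
have k11 : -1 <= k <= 1.
  by rewrite -ler_norml -(@ler_pXn2r _ 2%N) ?nnegrE // real_normK ?num_real // expr1n.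
have [_ cosE] := acos_def k11.
have sinE : sin th = s by rewrite /th sin_acos.
have orth (z : 'rV[R]_n) t : dotv x z = 0 -> dotv z z = dotv x x ->
    dotv (c + (cos t *: x + sin t *: z) - c) (- sin t *: x + cos t *: z) = 0.
  by move=> xz zz; rewrite [c + _]addrC addrK !dotvE (dotvC z x) xz zz; ring.
pose F (t : R) := f (c + (cos t *: x + sin t *: e)).
have F0 (t : R) : is_derive t 1 F 0.
  have [dg Dg] := is_derive_circle c x e t.
  have dF : differentiable F t.
    exact: (@differentiable_comp _ _ _ _ (fun t => c + (cos t *: x + sin t *: e)) f).
  split; first exact/derivable1_diffP.
  rewrite deriveE // (@diff_comp _ _ _ _ (fun t => c + (cos t *: x + sin t *: e)) f) //=.
  rewrite -(deriveE _ dg) Dg -(deriveE _ (df _)); apply: tf.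
  exact: orth.
have := is_derive_0_is_cst 0 th F0; rewrite /F cos0 sin0 scale1r scale0r addr0 => ->.
congr (f (c + _)); rewrite cosE sinE /e scalerA mulfV ?gt_eqF // scale1r.
by rewrite addrC subrK.
Qed.

End euclidean_geometry.

Section abs_derivative.
Context {R : realType}.

(** The right and left derivatives at [0] of [t |-> phi |t|] are [d] and [- d]. *)
Lemma derivable_abs_eq0 (phi : R -> R) (d d' : R) :
  is_derive (0 : R) 1 phi d -> is_derive (0 : R) 1 (fun t : R => phi `|t|) d' ->
  d = 0.
Proof.
move=> [ex1 v1] [ex2 v2].
have c1 : h^-1 *: ((phi \o shift 0) (h *: (1 : R)) - phi 0) @[h --> 0^'] --> d.
  by rewrite -v1; exact: ex1.
pose psi (t : R) : R := phi `|t|.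
have c2 : h^-1 *: ((psi \o shift 0) (h *: (1 : R)) - psi 0) @[h --> 0^'] --> d'.
  by rewrite -v2; exact: ex2.
apply/eqP; rewrite -normr_le0; apply/ler_addgt0Pr => e e0; rewrite add0r.
have e3 : 0 < e / 3 by rewrite divr_gt0.
move/cvgrPdist_lt: c1 => /(_ _ e3); move/cvgrPdist_lt: c2 => /(_ _ e3).
rewrite !near_withinE => h2 h1.
have h12 : nbhs (0 : R) _ := @filterI _ _ (nbhs_filter (0 : R)) _ _ h1 h2.
have [r /= r0 hr] := iffLR (nbhs_ballP _ _) h12.
pose h := r / 2; have h0 : 0 < h by rewrite divr_gt0.
have hn : h != 0 by rewrite gt_eqF.
have b1 : ball (0 : R) r h.
  by rewrite /ball /= sub0r normrN gtr0_norm // /h ltr_pdivrMr //; lra.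
have b2 : ball (0 : R) r (- h).
  by rewrite /ball /= sub0r opprK gtr0_norm // /h ltr_pdivrMr //; lra.
have [/(_ hn) q1 /(_ hn) q2] := hr _ b1.
have nh : - h != 0 by rewrite oppr_eq0.
have [_ /(_ nh) q3] := hr _ b2.
move: q1 q2 q3; rewrite /psi /= !addr0 !normr0 -![_ *: 1]/(_ * 1) !mulr1 normrN (gtr0_norm h0).
rewrite invrN scaleNr; set q := h^-1 *: _.
rewrite !ltr_distl => /andP[? ?] /andP[? ?] /andP[? ?].
by rewrite ler_norml; apply/andP; split; lra.
Qed.

End abs_derivative.

Section folding_geometry.
Context {R : realType} {m n : nat}.
Implicit Types (w : 'rV[R]_n -> 'rV[R]_m) (a c x : 'rV[R]_n).

(** One formula for both sides of the hyperplane, from which continuity and the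
    behaviour along the normal can be read off. *)
Lemma fold_plusE T a b (w : 'rV[R]_n -> T) x : a != 0 -> fold_plus a b w x =
  w (x + ((b - dotv x a + `|b - dotv x a|) / dotv a a) *: a).
Proof.
move=> a0; rewrite /fold_plus; case: leP => h.
  by rewrite ler0_norm ?subr_le0 // subrr mul0r scale0r addr0.
rewrite gtr0_norm ?subr_gt0 // /reflect_hyp -scaleNr; congr (w (_ + _ *: _)).
by ring.
Qed.

Lemma fold_minusE T a b (w : 'rV[R]_n -> T) : a != 0 ->
  fold_minus a b w = fold_plus (- a) (- b) w.
Proof.
move=> a0; apply/funext => x; rewrite /fold_minus /fold_plus dotvNr lerN2.
case: ifP => // _; congr w; rewrite /reflect_hyp !dotvE scalerN -scaleNr.
by congr (_ - _ *: _); rewrite !opprK; ring.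
Qed.

Lemma enorm_comp_continuous w : (forall i x, differentiable (component w i) x) ->
  continuous (fun x => enorm (w x)).
Proof.
move=> dw x; apply: (@continuous_comp _ _ _ (fun x => dotv (w x) (w x)) Num.sqrt);
  last exact: sqrt_continuous.
apply: continuous_sumr => i {}x.
have cw : {for x, continuous (component w i)} by exact: differentiable_continuous.
exact: (@continuousM _ _ (component w i) (component w i)).
Qed.

Lemma fold_plus_continuous a b (f : 'rV[R]_n -> R) : a != 0 ->
  continuous f -> continuous (fold_plus a b f).
Proof.
move=> a0 cf.
rewrite (_ : fold_plus a b f = f \o
  (fun x => x + ((b - dotv x a + `|b - dotv x a|) / dotv a a) *: a)); last first.
  by apply/funext => x; rewrite fold_plusE.
have cd : continuous (fun x => b - dotv x a).
  move=> x; apply: (@continuousB _ _ _ (cst b) (fun x => dotv x a)).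
    exact: cst_continuous.
  exact: dotv_continuous.
move=> x; apply: continuous_comp; last exact: cf.
apply: (@continuousD _ _ _ id); first exact: continuous_id_rV.
apply: (@continuousZr_tmp _ _ _ (fun x => (b - dotv x a + `|b - dotv x a|) / dotv a a)).
apply: (@continuousM _ _ (fun x => b - dotv x a + `|b - dotv x a|)
  (cst (dotv a a)^-1)); last exact: cst_continuous.
apply: (@continuousD _ _ _ (fun x => b - dotv x a)); first exact: cd.
apply: (@continuous_comp _ _ _ (fun x => b - dotv x a) Num.norm); first exact: cd.
exact: norm_continuous.
Qed.

(** Along the normal at a point of the hyperplane the folding is
    [t |-> f (x + |t| a)]. *)
Lemma fold_normal_derivative (f : 'rV[R]_n -> R) a b x : a != 0 ->
  (forall x, differentiable f x) -> (forall x, differentiable (fold_plus a b f) x) ->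
  dotv x a = b -> 'D_a f x = 0.
Proof.
move=> a0 df dF xb.
have d1 : is_derive (0 : R) 1 (fun t : R => f (x + t *: a)) ('D_a f x).
  have := @derive_along _ _ f x a 0 (df _).
  by rewrite scale0r addr0.
have d2 : is_derive (0 : R) 1 (fun t : R => f (x + `|t| *: a))
    ('D_a (fold_plus a b f) x).
  have := @derive_along _ _ (fold_plus a b f) x a 0 (dF _).
  rewrite scale0r addr0; congr (is_derive _ _ _ _); apply/funext => t.
  rewrite fold_plusE // !dotvE xb -addrA -scalerDl; congr (f (_ + _ *: _)).
  have aa : 0 < dotv a a by rewrite dotv_gt0.
  rewrite opprD addrA subrr sub0r normrN normrM (gtr0_norm aa).
  by field; rewrite gt_eqF.
exact: (@derivable_abs_eq0 _ (fun t : R => f (x + t *: a)) _ _ d1 d2).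
Qed.

End folding_geometry.

Section radial_from_foldings.
Context {R : realType} {m n : nat}.
Implicit Types (w : 'rV[R]_n -> 'rV[R]_m) (a c x y : 'rV[R]_n).

Definition radial_about c w :=
  forall x y, enorm (x - c) = enorm (y - c) -> w x = w y.

(** [M] stands for the C^1 representatives of the minimizers; the symmetry
    argument uses the following properties of them only. *)
Variable M : set ('rV[R]_n -> 'rV[R]_m).
Hypothesis M_diff : forall w i x, M w -> differentiable (component w i) x.
Hypothesis M_fold : forall w a, M w -> a != 0 ->
  exists b, M (fold_plus a b w) /\ M (fold_minus a b w).
Hypothesis M_fold_center : forall w a c, M w -> a != 0 ->
  (forall x, w (c - x) = w (c + x)) -> M (fold_plus a (dotv c a) w).
Hypothesis M_finite : forall w al, M w -> 0 < al ->
  (lebesgue n [set x | (al < enorm (w x))%R] < +oo)%E.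
Hypothesis M_neq0 : forall w, M w -> exists x, w x != 0.
Hypothesis n_gt1 : (1 < n)%N.

Local Notation e_ i := (delta_mx 0 i : 'rV[R]_n).
Local Notation mirror c i := (reflect_hyp (e_ i) (c 0 i)).

Lemma delta_neq0 i : e_ i != 0.
Proof.
apply/eqP => /rowP/(_ i); rewrite !mxE !eqxx /= => /eqP.
by rewrite oner_eq0.
Qed.

Lemma dotv_delta2 i : dotv (e_ i) (e_ i) = 1.
Proof. by rewrite dotv_delta mxE !eqxx. Qed.

Lemma mirrorE i b x j : reflect_hyp (e_ i) b x 0 j =
  if j == i then 2 * b - x 0 i else x 0 j.
Proof.
rewrite /reflect_hyp dotv_delta2 dotv_delta !mxE eqxx /= divr1.
by case: eqP => [->|_] /=; ring.
Qed.

Lemma M_continuous w : M w -> continuous (fun x => enorm (w x)).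
Proof. by move=> Mw; apply: enorm_comp_continuous => i x; exact: M_diff. Qed.

(** The [n] coordinate mirrors are applied one after the other; [z k] is the
    image of [c + x] under the first [k] of them. *)
Lemma even_of_mirrors w c :
  (forall i x, w (mirror c i x) = w x) -> forall x, w (c - x) = w (c + x).
Proof.
move=> sw x.
pose z (k : nat) : 'rV[R]_n :=
  \row_j (if (j < k)%N then c 0 j - x 0 j else c 0 j + x 0 j).
have zk k : (k <= n)%N -> w (z k) = w (c + x).
  elim: k => [_|k IH kn].
    by congr w; apply/rowP => j; rewrite !mxE ltn0.
  apply: etrans (IH (ltnW kn)); apply: etrans (sw (Ordinal kn) (z k)).
  congr w; apply/rowP => j.
  rewrite mirrorE !mxE ltnS leq_eqVlt -val_eqE /=.
  case: (eqVneq (val j) k) => [jk|jk] //=; rewrite ltnn.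
  have -> : j = Ordinal kn by apply: val_inj.
  by ring.
rewrite -(zk n) //; congr w; apply/rowP => j.
by rewrite !mxE ltn_ord.
Qed.

(** Each vector tangent to a sphere about [c] is normal to a hyperplane through
    its base point and [c], along which the function may be folded. *)
Lemma radial_of_even w c : M w -> (forall x, w (c - x) = w (c + x)) ->
  radial_about c w.
Proof.
move=> Mw ew x y xy; apply/rowP => i.
rewrite -/(component w i x) -/(component w i y).
apply: (@tangential_radial _ _ _ c) => //.
- by move=> z; exact: M_diff.
- move=> z a; have [-> _|a0 za] := eqVneq a 0.
    by rewrite deriveE ?linear0 //; exact: M_diff.
  have MF := M_fold_center Mw a0 ew.
  apply: (@fold_normal_derivative _ _ (component w i) a (dotv c a)) => //.
  + by move=> t; exact: M_diff.
  + move=> t; rewrite (_ : fold_plus _ _ _ = component (fold_plus a (dotv c a) w) i).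
      exact: M_diff.
    by apply/funext => s; rewrite /component /fold_plus; case: ifP.
  + by apply/eqP; rewrite -subr_eq0 -dotvNl -dotvDl za.
- by move=> t; rewrite /component ew.
Qed.

(** On the line through the two centres the common values are even about each
    of them, hence periodic. So [w1], which is radial, is periodic in the
    distance to [c1], and its size exceeds a positive bound on infinitely many
    disjoint balls. *)
Lemma same_centers w1 w2 c1 c2 : M w1 -> radial_about c1 w1 ->
  radial_about c2 w2 ->
  (forall t : R, w1 (c1 + t *: (c2 - c1)) = w2 (c1 + t *: (c2 - c1))) -> c1 = c2.
Proof.
move=> Mw1 r1 r2 w12; apply/eqP/negPn/negP => c12.
pose d := c2 - c1.
have d0 : d != 0 by rewrite subr_eq0 eq_sym.
have ed : 0 < enorm d by rewrite lt_neqAle enorm_ge0 eq_sym enorm_eq0 d0.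
pose f (t : R) := w1 (c1 + t *: d).
have f_even t : f (- t) = f t.
  by apply: r1; rewrite ![c1 + _]addrC !addrK scaleNr enormN.
have f_sym t : f (2 - t) = f t.
  rewrite /f !w12; apply: r2.
  have cE s : c1 + s *: d - c2 = (s - 1) *: d.
    by apply/rowP => i; rewrite !mxE; ring.
  rewrite !cE !enormZn; congr (_ * _); rewrite -normrN; congr Num.norm; ring.
have f_per t : f (t + 2) = f t.
  have -> : t + 2 = 2 - (- t) by ring.
  by rewrite f_sym f_even.
have f_pern t (k : nat) : f (t + 2 * k%:R) = f t.
  elim: k => [|k IH]; first by rewrite mulr0 addr0.
  by rewrite -[k.+1]addn1 natrD mulrDr mulr1 addrA f_per.
have w1E x : w1 x = f (enorm (x - c1) / enorm d).
  apply: r1; rewrite [c1 + _]addrC addrK enormZ ?divr_ge0 ?enorm_ge0 //.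
  by rewrite divfK // gt_eqF.
have [x0 wx0] := M_neq0 Mw1.
pose t0 := enorm (x0 - c1) / enorm d.
have t00 : 0 <= t0 by rewrite divr_ge0 ?enorm_ge0.
have ft0 : 0 < enorm (f t0).
  by rewrite -w1E lt_neqAle enorm_ge0 eq_sym enorm_eq0 wx0.
pose al := enorm (f t0) / 2.
have al0 : 0 < al by rewrite divr_gt0.
have cf : {for t0, continuous (fun t => enorm (f t))}.
  apply: (@continuous_comp _ _ _ (fun t : R => c1 + t *: d) (fun x => enorm (w1 x)));
    last exact: M_continuous.
  apply: (@continuousD _ _ _ (cst c1) (fun t : R => t *: d)); first exact: cst_continuous.
  exact: (@continuousZr_tmp _ _ _ id).
have [del [del0 del1 hdel]] : exists del, [/\ 0 < del, del <= 1 &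
    forall t, `|t - t0| < del -> al < enorm (f t)].
  have : \forall t \near t0, al < enorm (f t).
    by apply: (cvgr_gt _ cf); rewrite /al ltr_pdivrMr //; lra.
  move=> /nbhs_ballP[r /= r0 hr]; exists (Num.min r 1); split.
  - by rewrite lt_min r0 ltr01.
  - by rewrite ge_min lexx orbT.
  - by move=> t; rewrite lt_min => /andP[tr _]; apply: hr; rewrite /ball /= distrC.
pose z0 := c1 + t0 *: d.
pose A := [set x | enorm (x - z0) < del * enorm d].
have oA : open A.
  apply: (@open_comp _ _ (fun x => enorm (x - z0)) [set s | s < del * enorm d]);
    last exact: open_lt.
  move=> x _; apply: (@continuous_comp _ _ _ (fun x => x - z0) (@enorm R n)).
    by apply: differentiable_continuous; exact: differentiable_translate.
  exact: enorm_continuous.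
have A0 : (0 < lebesgue n A)%E.
  apply: lebesgue_open_gt0 => //; exists z0; rewrite /A /= subrr.
  by rewrite (_ : enorm 0 = 0) ?mulr_gt0 //; apply/eqP; rewrite enorm_eq0.
pose h (k : nat) := (- (2 * k%:R)) *: d.
have mB : measurable [set x | al < enorm (w1 x)].
  apply: measurable_superlevel; apply: continuous_measurable_rV.
  exact: M_continuous.
have : lebesgue n A = 0%E.
  apply: (@disjoint_translates_null _ _ A [set x | al < enorm (w1 x)] h) => //.
  - exact: open_measurable_rV.
  - exact: M_finite.
  - move=> k x; rewrite /A /h /= => hx; rewrite w1E.
    rewrite -[enorm (x - c1) / _](subrK (2 * k%:R)) f_pern; apply: hdel.
    have h1 := enorm_dist (x - c1) ((t0 + 2 * k%:R) *: d).
    have E : x - c1 - (t0 + 2 * k%:R) *: d = x + - (2 * k%:R) *: d - z0.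
      by apply/rowP => i; rewrite !mxE; ring.
    rewrite E in h1; have := le_lt_trans h1 hx.
    rewrite enormZ; last by rewrite addr_ge0 // mulr_ge0.
    have -> : enorm (x - c1) / enorm d - 2 * k%:R - t0 =
        (enorm (x - c1) - (t0 + 2 * k%:R) * enorm d) / enorm d.
      by field; rewrite gt_eqF.
    by rewrite normrM normfV (gtr0_norm ed) ltr_pdivrMr.
  - move=> i k x; rewrite /A /h /= => hi hk.
    have : enorm ((2 * (k%:R - i%:R)) *: d) < 2 * del * enorm d.
      have -> : (2 * (k%:R - i%:R)) *: d =
          (x + - (2 * i%:R) *: d - z0) + - (x + - (2 * k%:R) *: d - z0).
        by apply/rowP => j; rewrite !mxE; ring.
      apply: le_lt_trans (enormD _ _) _; rewrite enormN; lra.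
    rewrite enormZn ltr_pM2r // normrM gtr0_norm // ltr_pM2l // => ki.
    have : `|k%:R - i%:R| < 1 :> R by exact: lt_le_trans ki del1.
    rewrite ltr_norml => /andP[]; case: (ltngtP i k) => // ik.
      have : i%:R + 1 <= k%:R :> R by rewrite natr1 ler_nat.
      by move=> ? ? ?; exfalso; clear A0 oA mB; lra.
    have : k%:R + 1 <= i%:R :> R by rewrite natr1 ler_nat.
    by move=> ? ? ?; exfalso; clear A0 oA mB; lra.
by move=> A00; rewrite A00 ltxx in A0.
Qed.

Lemma mirror_comm i j b b' x : i != j ->
  reflect_hyp (e_ i) b (reflect_hyp (e_ j) b' x) =
  reflect_hyp (e_ j) b' (reflect_hyp (e_ i) b x).
Proof.
move=> ij; apply/rowP => k; rewrite !mirrorE.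
rewrite [j == i]eq_sym (negPf ij).
by have [->|ki] := eqVneq k i; rewrite ?(negPf ij).
Qed.

Lemma fold_plus_mirror w c i j b : i != j -> (forall x, w (mirror c j x) = w x) ->
  forall x, fold_plus (e_ i) b w (mirror c j x) = fold_plus (e_ i) b w x.
Proof.
move=> ij sw x; rewrite /fold_plus !dotv_delta mirrorE (negPf ij).
by case: ifP => // _; rewrite mirror_comm.
Qed.

Lemma fold_minus_mirror w c i j b : i != j -> (forall x, w (mirror c j x) = w x) ->
  forall x, fold_minus (e_ i) b w (mirror c j x) = fold_minus (e_ i) b w x.
Proof.
move=> ij sw x; rewrite /fold_minus !dotv_delta mirrorE (negPf ij).
by case: ifP => // _; rewrite mirror_comm.
Qed.

Lemma fold_plus_self w i b x :
  fold_plus (e_ i) b w (reflect_hyp (e_ i) b x) = fold_plus (e_ i) b w x.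
Proof.
have K := reflect_hypK b (delta_neq0 i).
rewrite /fold_plus !dotv_delta mirrorE eqxx K.
have [h|h|h] := ltgtP b (x 0 i).
- by rewrite ifF //; apply/negbTE; rewrite -ltNge; lra.
- by rewrite ifT //; lra.
- rewrite ifT; last lra; congr w; apply/rowP => j; rewrite mirrorE.
  by case: eqP => // ->; lra.
Qed.

Lemma fold_minus_self w i b x :
  fold_minus (e_ i) b w (reflect_hyp (e_ i) b x) = fold_minus (e_ i) b w x.
Proof.
have K := reflect_hypK b (delta_neq0 i).
rewrite /fold_minus !dotv_delta mirrorE eqxx K.
have [h|h|h] := ltgtP b (x 0 i).
- by rewrite ifT //; lra.
- by rewrite ifF //; apply/negbTE; rewrite -ltNge; lra.
- rewrite ifT; last lra; congr w; apply/rowP => j; rewrite mirrorE.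
  by case: eqP => // ->; lra.
Qed.

(** Downward induction on the number [k] of coordinate mirrors: folding along
    the next coordinate gives two functions with one more mirror, radial by
    induction, and their centres coincide. *)
Lemma radial_of_mirrors k w c : (k <= n)%N -> M w ->
  (forall i : 'I_n, (i < k)%N -> forall x, w (mirror c i x) = w x) ->
  exists c', (forall i : 'I_n, (i < k)%N -> c' 0 i = c 0 i) /\ radial_about c' w.
Proof.
move=> kn; rewrite -(subKn kn); move: (n - k)%N (leq_subr k n) => l {k kn}.
elim: l w c => [|l IH] w c ln Mw sw.
  exists c; split => //; apply: radial_of_even => //; apply: even_of_mirrors => i.
  by apply: sw; rewrite subn0.
have kn : (n - l.+1 < n)%N by lia.
pose i0 : 'I_n := Ordinal kn.
have [b [Mp Mm]] := M_fold Mw (delta_neq0 i0).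
pose c2 : 'rV[R]_n := \row_j (if j == i0 then b else c 0 j).
have lt_ne (i : 'I_n) : (i < n - l)%N -> i != i0 -> (i < n - l.+1)%N.
  move=> h /eqP hn; have : val i <> (n - l.+1)%N by move=> hv; apply: hn; apply: val_inj.
  by move=> /= ?; lia.
have mir i x : i != i0 -> mirror c2 i x = mirror c i x.
  by move=> ii; rewrite /c2 mxE (negPf ii).
have mir0 x : mirror c2 i0 x = reflect_hyp (e_ i0) b x by rewrite /c2 mxE eqxx.
have sp (i : 'I_n) : (i < n - l)%N -> forall x,
    fold_plus (e_ i0) b w (mirror c2 i x) = fold_plus (e_ i0) b w x.
  move=> il x; have [->|ii] := eqVneq i i0; first by rewrite mir0 fold_plus_self.
  rewrite mir //; apply: fold_plus_mirror; first by rewrite eq_sym.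
  by apply: sw; exact: lt_ne.
have sm (i : 'I_n) : (i < n - l)%N -> forall x,
    fold_minus (e_ i0) b w (mirror c2 i x) = fold_minus (e_ i0) b w x.
  move=> il x; have [->|ii] := eqVneq i i0; first by rewrite mir0 fold_minus_self.
  rewrite mir //; apply: fold_minus_mirror; first by rewrite eq_sym.
  by apply: sw; exact: lt_ne.
have ln' : (l <= n)%N by lia.
have [cp [hcp rp]] := IH _ c2 ln' Mp sp.
have [cm [hcm rm]] := IH _ c2 ln' Mm sm.
have i0l : (i0 < n - l)%N by rewrite /=; lia.
have cp0 : cp 0 i0 = b by rewrite hcp // mxE eqxx.
have cm0 : cm 0 i0 = b by rewrite hcm // mxE eqxx.
have on_plane x : x 0 i0 = b -> fold_plus (e_ i0) b w x = w x /\
    fold_minus (e_ i0) b w x = w x.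
  by move=> xb; rewrite /fold_plus /fold_minus dotv_delta xb lexx.
have cpm : cp = cm.
  apply: (same_centers Mp rp rm) => t.
  have xb : (cp + t *: (cm - cp)) 0 i0 = b.
    by rewrite !mxE cp0 cm0 subrr mulr0 addr0.
  by have [e1 e2] := on_plane _ xb; rewrite e1 e2.
exists cp; split.
  move=> i il; rewrite hcp; last by lia.
  rewrite mxE; case: eqP => // ii; exfalso; move: il; rewrite ii /=; lia.
have [j ji0] : exists j : 'I_n, j != i0.
  have [i00|i00] := eqVneq (val i0) 0%N.
    by exists (Ordinal n_gt1); rewrite -val_eqE i00.
  by exists (Ordinal (ltnW n_gt1)); rewrite -val_eqE eq_sym.
pose z (r : R) := cp + r *: e_ j.
have z0 r : z r 0 i0 = b by rewrite !mxE [i0 == j]eq_sym (negPf ji0) andbF mulr0 addr0 cp0.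
suff wz x : w x = w (z (enorm (x - cp))) by move=> x y xy; rewrite wz xy -wz.
have ez : enorm (x - cp) = enorm (z (enorm (x - cp)) - cp).
  rewrite /z [cp + _]addrC addrK enormZ ?enorm_ge0 //.
  by rewrite [enorm (e_ j)]/enorm dotv_delta2 sqrtr1 mulr1.
have [zp zm] := on_plane _ (z0 (enorm (x - cp))).
have [xb|bx] := leP b (x 0 i0).
  have <- : fold_plus (e_ i0) b w x = w x by rewrite /fold_plus dotv_delta xb.
  by rewrite -zp; exact: rp ez.
have <- : fold_minus (e_ i0) b w x = w x by rewrite /fold_minus dotv_delta ltW.
by rewrite -zm; apply: rm; rewrite -cpm.
Qed.

Lemma radial_of_foldings w : M w -> exists c, radial_about c w.
Proof.
by move=> Mw; have [//|c [_ rc]] := @radial_of_mirrors 0 w 0 (leq0n n) Mw; exists c.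
Qed.

End radial_from_foldings.

(** * Minimizers are radial *)

Section mean.
Context {R : realType}.
Implicit Types x y z : R.

Lemma mean_eq x y z : x + y = 2 * z -> x = z -> y = z.
Proof. lra. Qed.

Lemma mean_extremal x y z : x + y = 2 * z -> z <= x -> z <= y -> x = z /\ y = z.
Proof. by move=> *; split; lra. Qed.

Lemma mean_same x y z : x + y = 2 * z -> x = y -> x = z.
Proof. lra. Qed.

End mean.

Section minimizers.
Context {R : realType} {m n : nat} {p : R}.
Context {g : 'I_m -> 'rV[R]_m -> R} {G : 'rV[R]_m -> R}.
Context {X : set ('rV[R]_n -> 'rV[R]_m)}.
Hypothesis admX : admissible p g G X.
Hypothesis n_gt1 : (1 < n)%N.
Hypothesis min_C1 : forall u, minimizer p G X u -> C1_function u.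
Implicit Types (u v w : 'rV[R]_n -> 'rV[R]_m) (a c : 'rV[R]_n).
Local Notation regular := (@regular R m n p g G).

Let regX u : X u -> regular u := admissible_regular admX.

(** The energies of the foldings have mean [energyJ p u], and both foldings are
    competitors, so neither energy can exceed the minimum. *)
Lemma minimizer_fold u a b : minimizer p G X u -> a != 0 ->
  energyV G (fold_plus a b u) = 1 ->
  minimizer p G X (fold_plus a b u) /\ minimizer p G X (fold_minus a b u).
Proof.
move=> [[Xu Vu] mu] a0 Vp.
have [_ _ _ /(_ u a b Xu a0)[Xp Xm]] := admX.
have EV := energyV_fold a0 (regX Xu) (regX Xp) (regX Xm).
have EJ := energyJ_fold a0 (regX Xu) (regX Xp) (regX Xm).
have Vm : energyV G (fold_minus a b u) = 1.
  exact: (mean_eq (etrans EV (congr1 _ Vu)) Vp).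
have Jp := mu _ (conj Xp Vp); have Jm := mu _ (conj Xm Vm).
have [Jpe Jme] := mean_extremal EJ Jp Jm.
split; (split; first by split) => v cv.
  by rewrite Jpe; exact: mu.
by rewrite Jme; exact: mu.
Qed.

(** The continuous representatives of the minimizers; passing to them turns
    almost everywhere identities into identities. *)
Definition C1_minimizer w := exists u, [/\ minimizer p G X u,
  (forall i, C1_on setT (component w i)) & {ae lebesgue n, forall x, u x = w x}].

Lemma C1_minimizer_diff w i x : C1_minimizer w -> differentiable (component w i) x.
Proof. by move=> [u [_ /(_ i x I)[]]]. Qed.

(** The C^1 representative of the folding of [u] and the folding of [w] are
    continuous and equal almost everywhere, hence equal. *)
Lemma C1_minimizer_fold_plus u w a b : a != 0 ->
  (forall i, C1_on setT (component w i)) -> {ae lebesgue n, forall x, u x = w x} ->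
  minimizer p G X (fold_plus a b u) -> C1_minimizer (fold_plus a b w).
Proof.
move=> a0 Cw uw mf.
have [w' [Cw' fw']] := min_C1 mf.
have cont v i : (forall i, C1_on setT (component v i)) -> continuous (component v i).
  by move=> Cv x; apply: differentiable_continuous; have [] := Cv i x I.
have ff : {ae lebesgue n, forall x, fold_plus a b u x = fold_plus a b w x}.
  have uwr := scales_lebesgue_ae (scales_lebesgue_reflect b a0) uw.
  apply: filterS2 uw uwr => x h1 h2; rewrite /fold_plus.
  by case: ifP.
suff -> : fold_plus a b w = w' by exists (fold_plus a b u).
apply/funext => x; apply/rowP => i.
have cf : continuous (fold_plus a b (component w i)).
  by apply: fold_plus_continuous => //; exact: cont.
have fE y : fold_plus a b w y 0 i = fold_plus a b (component w i) y.
  by rewrite /fold_plus /component; case: ifP.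
rewrite fE; apply: (ae_eq_continuous cf (cont _ i Cw')).
by apply: filterS2 ff fw' => y h1 h2; rewrite -fE -h1 h2.
Qed.

Lemma C1_minimizer_fold w a : C1_minimizer w -> a != 0 ->
  exists b, C1_minimizer (fold_plus a b w) /\ C1_minimizer (fold_minus a b w).
Proof.
move=> [u [mu Cw uw]] a0; have [[Xu Vu] _] := mu.
have [b hb] : exists b, \int[lebesgue n]_x (if b < dotv x a then G (u x) else 0) =
    2^-1 * \int[lebesgue n]_x G (u x).
  apply: (half_mass a0); first exact: reg_G (regX Xu).
  by rewrite -/(energyV G u) Vu.
exists b.
have [_ _ _ /(_ u a b Xu a0)[Xp Xm]] := admX.
have Vp : energyV G (fold_plus a b u) = 1.
  rewrite (energyV_half a0 (regX Xu) (regX Xp)) hb -/(energyV G u) Vu mulr1.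
  by rewrite mulfV.
have [mp mm] := minimizer_fold mu a0 Vp.
split; first exact: C1_minimizer_fold_plus Cw uw mp.
have na0 : - a != 0 by rewrite oppr_eq0.
rewrite fold_minusE //; rewrite fold_minusE // in mm.
exact: C1_minimizer_fold_plus Cw uw mm.
Qed.

Lemma scales_lebesgue_point_reflection c :
  scales_lebesgue 1 (fun x : 'rV[R]_n => - x + (c + c)).
Proof.
rewrite -[1](mulr1 1); apply: (scales_lebesgue_comp (scales_lebesgue_translate (c + c))).
apply: scales_lebesgue_isometry.
- by move=> x; apply: (@continuousN _ _ _ id); exact: continuous_id_rV.
- by move=> x y; rewrite opprD.
- by move=> x; rewrite opprK.
- by move=> x; rewrite dotvNl dotvNr opprK.
Qed.

(** A hyperplane through a centre of symmetry halves the constraint, because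
    the point reflection exchanges its two sides. *)
Lemma C1_minimizer_fold_center w a c : C1_minimizer w -> a != 0 ->
  (forall x, w (c - x) = w (c + x)) -> C1_minimizer (fold_plus a (dotv c a) w).
Proof.
move=> [u [mu Cw uw]] a0 ew; have [[Xu Vu] _] := mu.
set b := dotv c a.
have na0 : - a != 0 by rewrite oppr_eq0.
have [_ _ _ /(_ u a b Xu a0)[Xp Xm]] := admX.
have Vpm : energyV G (fold_plus a b u) = energyV G (fold_minus a b u).
  have mE := fold_minusE b u a0.
  have Xm' : X (fold_plus (- a) (- b) u) by rewrite -mE.
  rewrite mE.
  rewrite (energyV_half a0 (regX Xu) (regX Xp)) (energyV_half na0 (regX Xu) (regX Xm')).
  congr (_ * _); have sT := scales_lebesgue_point_reflection c.
  have mG := regular_G_measurable (regX Xu).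
  have m1 := measurable_half_space a b mG.
  have m2 := measurable_half_space (- a) (- b) mG.
  rewrite -[LHS]mul1r -(RintegralT_scales ltr01 sT m1).
  apply: Rintegral_eq_ae => //; first by apply: measurableT_comp m1 _; case: sT.
  have uwT := scales_lebesgue_ae sT uw.
  apply: filterS2 uw uwT => x h1 h2.
  have -> : u (- x + (c + c)) = u x.
    rewrite h1 h2 (_ : - x + (c + c) = c - (x - c)).
      by rewrite ew addrC subrK.
    by rewrite opprB addrC addrA.
  have -> : dotv (- x + (c + c)) a = 2 * b - dotv x a by rewrite !dotvE -/b; ring.
  congr (if _ then _ else _); rewrite dotvNr; apply/idP/idP => ?; lra.
have EV := energyV_fold a0 (regX Xu) (regX Xp) (regX Xm).
have Vp : energyV G (fold_plus a b u) = 1.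
  exact: (mean_same (etrans EV (congr1 _ Vu)) Vpm).
have [mp _] := minimizer_fold mu a0 Vp.
exact: C1_minimizer_fold_plus Cw uw mp.
Qed.

Lemma measurable_superlevel_enorm u al :
  (forall i, loc_integrable (component u i)) ->
  measurable [set x | al < enorm (u x)].
Proof.
move=> lu; apply: measurable_superlevel.
by apply: measurable_enorm => j; case: (lu j).
Qed.

Lemma C1_minimizer_finite w al : C1_minimizer w -> 0 < al ->
  (lebesgue n [set x | (al < enorm (w x))%R] < +oo)%E.
Proof.
move=> [u [[[Xu _] _] Cw [A [mA A0 hA]]]] al0.
have [_ /(_ u Xu)[lu /(_ al al0) fu _ _ _] _ _] := admX.
have mu := measurable_superlevel_enorm al lu.
apply: (@le_lt_trans _ _ (lebesgue n ([set x | al < enorm (u x)] `|` A))); last first.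
  have h : (lebesgue n ([set x | (al < enorm (u x))%R] `|` A) <=
      lebesgue n [set x | (al < enorm (u x))%R] + lebesgue n A)%E.
    exact: measureU2.
  by rewrite A0 adde0 in h; exact: le_lt_trans h fu.
apply: le_measure; rewrite ?inE.
- apply: measurable_superlevel; apply: continuous_measurable_rV.
  by apply: enorm_comp_continuous => i x; have [] := Cw i x I.
- exact: measurableU.
- move=> x /= wx; have [uw|uw] := eqVneq (u x) (w x); [left|right].
    by rewrite uw.
  by apply: hA => /= e; rewrite e eqxx in uw.
Qed.

(** Dilations fix a trivial function and multiply the constraint by [2 ^+ n]. *)
Lemma energyV_trivial u : X u -> {ae lebesgue n, forall x, u x = 0} -> energyV G u = 0.
Proof.
move=> Xu u0.
have Xd : X (dilate 2 u) by have [_ _ h _] := admX; exact: h.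
have E := energyV_dilate (ltr0n R 2) (regX Xu).
have E0 : energyV G (dilate 2 u) = energyV G u.
  apply: Rintegral_eq_ae; [exact: regular_G_measurable (regX Xd)
    |exact: regular_G_measurable (regX Xu)|].
  have u0d := scales_lebesgue_ae (scales_lebesgue_dilate n (ltr0n R 2)) u0.
  by apply: filterS2 u0 u0d => x h1 h2; rewrite /dilate h1 h2.
have : (2 ^+ n - 1) * energyV G u = 0 by rewrite mulrBl -E E0 mul1r subrr.
move=> /eqP; rewrite mulf_eq0 => /orP[|/eqP //].
by rewrite subr_eq0 pexprn_eq1 ?ler1n // pnatr_eq1 -leqn0 leqNgt (ltnW n_gt1).
Qed.

Lemma C1_minimizer_neq0 w : C1_minimizer w -> exists x, w x != 0.
Proof.
move=> [u [[[Xu Vu] _] _ uw]]; apply/not_existsP => w0.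
have : energyV G u = 0.
  apply: energyV_trivial => //; apply: filterS uw => x ->.
  by apply/eqP/negPn/negP; exact: w0.
by rewrite Vu => /eqP; rewrite oner_eq0.
Qed.

Lemma minimizer_radial u : minimizer p G X u -> radial_up_to_translation u.
Proof.
move=> mu; have [w [Cw uw]] := min_C1 mu.
have Mw : C1_minimizer w by exists u.
have [c rc] := radial_of_foldings C1_minimizer_diff C1_minimizer_fold
  C1_minimizer_fold_center C1_minimizer_finite C1_minimizer_neq0 n_gt1 Mw.
pose e : 'rV[R]_n := delta_mx 0 (Ordinal (ltnW n_gt1)).
exists c, (fun r => w (c + r *: e)).
apply: filterS uw => x ->; apply: rc.
rewrite [c + _]addrC addrK enormZ ?enorm_ge0 //.
by rewrite [enorm e]/enorm dotv_delta2 sqrtr1 mulr1.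
Qed.

End minimizers.

(** * Least energy solutions *)

Section least_energy.
Context {R : realType} {m n : nat} {p : R}.
Context {g : 'I_m -> 'rV[R]_m -> R} {G : 'rV[R]_m -> R}.
Context {X : set ('rV[R]_n -> 'rV[R]_m)}.
Hypothesis admX : admissible p g G X.
Hypothesis p_gt1 : 1 < p.
Hypothesis p_ltn : p < n%:R.
Implicit Types (u v w : 'rV[R]_n -> 'rV[R]_m).
Local Notation regular := (@regular R m n p g G).

Let regX u : X u -> regular u := admissible_regular admX.

Let n_gt1 : (1 < n)%N.
Proof. by rewrite -(ltr_nat R) (lt_trans p_gt1). Qed.

Lemma grad_energy_ge0 u x : 0 <= grad_energy p u x.
Proof. by apply: sumr_ge0 => i _; exact: powR_ge0. Qed.

Lemma energyJ_eq0 u : regular u -> energyJ p u = 0 ->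
  {ae lebesgue n, forall x, grad_energy p u x = 0}.
Proof.
move=> ru J0.
have p0 : p != 0 by rewrite gt_eqF // (lt_trans ltr01).
have mE : measurable_fun [set: 'rV[R]_n] (EFin \o grad_energy p u).
  by apply/measurable_EFinP; exact: regular_energy_measurable ru.
have fin := integrable_fin_num measurableT (reg_energy ru).
have I0 : fine (\int[lebesgue n]_x (EFin \o grad_energy p u) x) = 0.
  have /eqP := J0; rewrite /energyJ mulf_eq0 invr_eq0 (negPf p0) => /eqP.
  exact.
have I1 : (\int[lebesgue n]_x (EFin \o grad_energy p u) x = 0)%E.
  exact: etrans (esym (fineK fin)) (congr1 EFin I0).
have I2 : (\int[lebesgue n]_x `|(EFin \o grad_energy p u) x| = 0)%E.
  apply: etrans I1; apply: eq_integral => x _.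
  by apply: gee0_abs; rewrite lee_fin; exact: grad_energy_ge0.
have := iffLR (ae_eq_integral_abs (lebesgue n) measurableT mE) I2.
by apply: filterS => x /(_ I) [].
Qed.

(** If the energy vanishes, so does one weak partial derivative of each
    component, and [weak_partial0_eq0] applies to the components. *)
Lemma energyJ_gt0 u : X u -> nontrivial u -> 0 < energyJ p u.
Proof.
move=> Xu ntu; have ru := regX Xu.
have p0 : 0 < p := lt_trans ltr01 p_gt1.
rewrite lt_neqAle; apply/andP; split; last first.
  apply: mulr_ge0; first by rewrite invr_ge0 ltW.
  by apply: Rintegral_ge0 => x _; exact: grad_energy_ge0.
apply/negP => /eqP /esym J0; apply: ntu.
have E0 := energyJ_eq0 ru J0.
suff : {ae lebesgue n, forall x, forall i, u x 0 i = 0}.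
  by apply: filterS => x hx; apply/rowP => i; rewrite hx mxE.
apply: ae_forall_ord => i.
pose j : 'I_n := Ordinal (ltnW n_gt1).
have [lw hw] := weak_partialP j (reg_diff ru i).
have w0 : {ae lebesgue n, forall x, weak_partial j (component u i) x = 0}.
  apply: filterS E0 => x; rewrite /grad_energy => /eqP.
  rewrite psumr_eq0; last by move=> k _; exact: powR_ge0.
  move=> /allP /(_ i (mem_index_enum i)) /implyP /(_ isT) /eqP /powR_eq0_eq0 /eqP.
  by rewrite enorm_eq0 => /eqP /rowP /(_ j); rewrite !mxE.
have wp0 : is_weak_partial j (component u i) (fun=> 0).
  split; first exact: loc_integrable0.
  move=> phi tphi; rewrite hw //; congr (- _).
  have [mw _] := lw; have mphi := test_function_measurable tphi.
  apply: Rintegral_eq_ae; [exact: measurable_funM|exact: measurable_funM|].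
  by apply: filterS w0 => x ->.
apply: (weak_partial0_eq0 (reg_loc ru i) wp0) => al al0.
have [_ /(_ u Xu)[lu /(_ al al0) fu _ _ _] _ _] := admX.
apply: le_lt_trans fu; apply: le_measure; rewrite ?inE.
- by apply: measurable_superlevel; apply: measurableT_comp => //; case: (lu i).
- exact: measurable_superlevel_enorm.
- move=> x /= h; apply: lt_le_trans h _.
  rewrite -sqrtr_sqr ler_wsqrtr // /dotv (bigD1 i) //= -expr2 lerDl.
  by apply: sumr_ge0 => k _; rewrite -expr2 sqr_ge0.
Qed.

(** The ratio of [energyV] to [energyJ] imposed on solutions by the Pohozaev
    identity. *)
Let kappa := (n%:R - p) / n%:R.

Let n_gt0 : 0 < n%:R :> R.
Proof. by rewrite ltr0n ltnW. Qed.

Let kappa_gt0 : 0 < kappa.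
Proof. by rewrite divr_gt0 // subr_gt0. Qed.



Hypothesis pohozaev : forall alpha u, X u -> weak_system p g alpha u ->
  (n%:R - p) * energyJ p u = alpha * n%:R * energyV G u.

Lemma pohozaevE alpha u : X u -> weak_system p g alpha u ->
  alpha * energyV G u = kappa * energyJ p u.
Proof.
move=> Xu hu; rewrite /kappa mulrAC (pohozaev Xu hu).
by field; rewrite gt_eqF.
Qed.

Lemma solution_energyV_gt0 v : solution p g X v -> nontrivial v -> 0 < energyV G v.
Proof.
move=> [Xv sv] ntv.
by rewrite -[energyV G v]mul1r (pohozaevE Xv sv) mulr_gt0 ?energyJ_gt0.
Qed.

Lemma solution_action v : solution p g X v ->
  action p G v = (kappa^-1 - 1) * energyV G v.
Proof.
move=> [Xv sv]; have := pohozaevE Xv sv; rewrite mul1r => VJ.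
by rewrite /action VJ; field; rewrite gt_eqF.
Qed.

(** The factor of the dilation that puts a function in the constraint set. *)
Definition normalizer v := (energyV G v)^-1 `^ n%:R^-1.

Lemma normalizer_gt0 v : 0 < energyV G v -> 0 < normalizer v.
Proof. by move=> V0; rewrite powR_gt0 // invr_gt0. Qed.

Lemma normalizer_pow v : 0 < energyV G v -> normalizer v ^+ n = (energyV G v)^-1.
Proof.
move=> V0; rewrite -powR_mulrn ?powR_ge0 // -powRrM mulVf ?gt_eqF //.
by rewrite powRr1 // invr_ge0 ltW.
Qed.

Lemma normalized_constraint v : X v -> 0 < energyV G v ->
  constraint_set G X (dilate (normalizer v) v).
Proof.
move=> Xv V0; split.
  by have [_ _ h _] := admX; apply: h => //; exact: normalizer_gt0.
rewrite (energyV_dilate (normalizer_gt0 V0) (regX Xv)) normalizer_pow //.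
by rewrite mulVf // gt_eqF.
Qed.

Lemma normalized_energyJ v : solution p g X v -> nontrivial v ->
  kappa * energyJ p (dilate (normalizer v) v) = (normalizer v)^-1 `^ p.
Proof.
move=> sv ntv; have V0 := solution_energyV_gt0 sv ntv.
have [Xv wv] := sv; have := pohozaevE Xv wv; rewrite mul1r => VJ.
have [Xd _] := normalized_constraint Xv V0.
rewrite (energyJ_dilate (normalizer_gt0 V0) (regX Xv) (regX Xd)) normalizer_pow //.
have E (a b c d : R) : a != 0 -> a = b * c -> b * (a^-1 * d * c) = d.
  move=> a0 abc; have -> : b * (a^-1 * d * c) = a^-1 * (b * c) * d by ring.
  by rewrite -abc mulVf // mul1r.
by apply: E VJ; rewrite gt_eqF.
Qed.

(** [sigma] is the dilation turning the minimizer [u0] into a solution. *)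
Section comparison.
Variables (u0 : 'rV[R]_n -> 'rV[R]_m) (sigma : R).
Hypothesis min_u0 : minimizer p G X u0.
Hypothesis sigma_gt0 : 0 < sigma.
Hypothesis sigmaE : sigma `^ p = kappa * energyJ p u0.

(** Normalizing a solution [v] gives a competitor of [u0]; comparing their
    energies bounds [energyV G v], hence the action of [v], from below. *)
Lemma solution_energyV_ge v : solution p g X v -> nontrivial v ->
  sigma ^+ n <= energyV G v.
Proof.
move=> sv ntv; have V0 := solution_energyV_gt0 sv ntv; have [Xv _] := sv.
have p0 : 0 < p := lt_trans ltr01 p_gt1.
have [_ /(_ _ (normalized_constraint Xv V0)) J] := min_u0.
have : sigma `^ p <= (normalizer v)^-1 `^ p.
  by rewrite sigmaE -(normalized_energyJ sv ntv) ler_pM2l.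
have t0 : 0 < (normalizer v)^-1 by rewrite invr_gt0 normalizer_gt0.
have [sle _|slt] := leP sigma (normalizer v)^-1.
  rewrite -[energyV G v]invrK -normalizer_pow // -exprVn.
  by rewrite lerXn2r // nnegrE ltW.
by rewrite leNgt (gt0_ltr_powR p0) // nnegrE ltW.
Qed.

(** When the bound is attained the competitor has the energy of [u0]. *)
Lemma minimizer_of_solution v : solution p g X v -> nontrivial v ->
  energyV G v = sigma ^+ n -> minimizer p G X (dilate (normalizer v) v).
Proof.
move=> sv ntv VE; have V0 := solution_energyV_gt0 sv ntv; have [Xv _] := sv.
split; first exact: normalized_constraint.
have [_ mu0] := min_u0.
have sE : (normalizer v)^-1 = sigma.
  apply/eqP; rewrite -(@eqrXn2 _ n) ?ltW ?invr_gt0 ?normalizer_gt0 //.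
    by rewrite exprVn normalizer_pow // invrK VE.
  by rewrite -(ltr0n R).
have E : kappa * energyJ p (dilate (normalizer v) v) = kappa * energyJ p u0.
  by apply: etrans (normalized_energyJ sv ntv) _; rewrite sE sigmaE.
have JE := mulfI (lt0r_neq0 kappa_gt0) E.
by move=> w cw; rewrite JE; exact: mu0.
Qed.

End comparison.

Lemma radial_dilate s u : 0 < s -> radial_up_to_translation (dilate s u) ->
  radial_up_to_translation u.
Proof.
move=> s0 [x0 [h hE]].
exists (s^-1 *: x0), (fun r => h (s * r)).
have si : 0 < s^-1 by rewrite invr_gt0.
have := scales_lebesgue_ae (scales_lebesgue_dilate n si) hE.
apply: filterS => x; rewrite /dilate invrK scalerA mulVf ?gt_eqF // scale1r => ->.
congr h; rewrite -enormZ ?ltW //; congr enorm.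
by rewrite scalerBr scalerA mulfV ?gt_eqF // scale1r.
Qed.

End least_energy.

Theorem proposition3 (R : realType) (m N : nat) (p : R)
    (g : 'I_m -> 'rV[R]_m -> R) (G : 'rV[R]_m -> R)
    (X : set ('rV[R]_N -> 'rV[R]_m)) :
  (1 <= m)%N ->
  1 < p -> p < N%:R ->
  (forall i, g i 0 = 0) ->
  continuous G ->
  C1_on [set y | y != 0] G ->
  (forall i y, y != 0 -> g i y = 'D_(delta_mx 0 i) G y) ->
  admissible p g G X ->
  (0 < ereal_inf [set (energyJ p u)%:E | u in constraint_set G X])%E ->
  (exists u, minimizer p G X u) ->
  (forall u, minimizer p G X u ->
     C1_function u /\ exists alpha, weak_system p g alpha u) ->
  (forall alpha u, X u -> weak_system p g alpha u ->
     (N%:R - p) * energyJ p u = alpha * N%:R * energyV G u) ->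
  (exists u, least_energy_solution p g G X u) /\
  (forall u, least_energy_solution p g G X u -> radial_up_to_translation u).
Proof.
move=> _ p1 pN _ _ _ _ admX T0 [u0 mu0] hmin pohozaev.
have p0 : 0 < p := lt_trans ltr01 p1.
have n0 : 0 < N%:R :> R := lt_trans p0 pN.
have n1 : (1 < N)%N by rewrite -(ltr_nat R) (lt_trans p1).
have [[Xu0 Vu0] _] := mu0.
have [_ [alpha sys]] := hmin _ mu0.
have J0 : 0 < energyJ p u0.
  rewrite -lte_fin; apply: lt_le_trans T0 _; apply: ereal_inf_lbound.
  by exists u0.
(* Pohozaev's identity for the minimizer identifies its Lagrange multiplier
   [alpha]; dilating by [sigma] divides the multiplier by [sigma `^ p]. *)
set kappa := (N%:R - p) / N%:R.
have kappa0 : 0 < kappa by rewrite divr_gt0 // subr_gt0.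
have kappa1 : 0 < kappa^-1 - 1.
  by rewrite subr_gt0 invf_gt1 // ltr_pdivrMr // mul1r ltrBlDr ltrDl.
have alphaE : alpha = kappa * energyJ p u0.
  by have := pohozaevE p1 pN pohozaev Xu0 sys; rewrite Vu0 mulr1.
have alpha0 : 0 < alpha by rewrite alphaE mulr_gt0.
pose sigma := alpha `^ p^-1.
have sigma0 : 0 < sigma by rewrite powR_gt0.
have sigmaE : sigma `^ p = alpha.
  by rewrite /sigma -powRrM mulVf ?gt_eqF // powRr1 // ltW.
have sigmaJ : sigma `^ p = kappa * energyJ p u0 by rewrite sigmaE.
pose u1 := dilate sigma u0.
have Xu1 : X u1 by have [_ _ h _] := admX; exact: h.
have r0 := admissible_regular admX Xu0; have r1 := admissible_regular admX Xu1.
have Vu1 : energyV G u1 = sigma ^+ N.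
  by rewrite (energyV_dilate sigma0 r0) Vu0 mulr1.
have su1 : solution p g X u1.
  split=> //; have := weak_system_dilate sigma0 r0 r1 sys.
  by rewrite -powR_inv1 ?ltW // -powRrM mulN1r powRN sigmaE mulVf ?gt_eqF.
have nt1 : nontrivial u1.
  move=> /(energyV_trivial admX n1 Xu1); rewrite Vu1 => /eqP.
  by rewrite expf_eq0 (gt_eqF sigma0) andbF.
have actE v := @solution_action _ _ _ _ _ _ _ p1 pN pohozaev v.
have Vge v := @solution_energyV_ge _ _ _ _ _ _ _ admX p1 pN pohozaev _ _ mu0 sigma0 sigmaJ v.
split.
  exists u1; split=> //; apply/eqP; rewrite eq_le; apply/andP; split; last first.
    by apply: ereal_inf_lbound; exists u1.
  apply: le_ereal_inf_tmp => _ [v [sv ntv] <-].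
  by rewrite lee_fin !actE // ler_pM2l // Vu1 Vge.
move=> v [sv ntv inf].
have Vv : energyV G v = sigma ^+ N.
  apply/le_anti/andP; split; last exact: Vge.
  rewrite -Vu1 -(ler_pM2l kappa1) -!actE // -lee_fin inf.
  by apply: ereal_inf_lbound; exists u1.
have mv := minimizer_of_solution admX p1 pN pohozaev mu0 sigma0 sigmaJ sv ntv Vv.
have V0 : 0 < energyV G v by rewrite Vv exprn_gt0.
apply: (radial_dilate (normalizer_gt0 V0)).
apply: (minimizer_radial admX n1 _ mv) => u mu.
by have [] := hmin u mu.
Qed.
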